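(* Let $k\ge 2$, let $\alpha=(\alpha_1,\dots,\alpha_k)^\top\in(0,\infty)^k$, let $A$ be a non-singular real $k\times k$ matrix, and let $\mathbf X\overset{d}{=}A^\top R\,\mathbf U$, where $R>0$ almost surely has distribution function $F$, $\mathbf U$ has the symmetrised Dirichlet distribution $\mathcal{SD}(k,\alpha)$, and $R$ and $\mathbf U$ are independent. Set $C:=(A^\top)^{-1}$, $\Sigma:=A^\top A$. Suppose that $F$ has infinite upper endpoint, $F(0)=0$, and $F$ is in the Gumbel max-domain of attraction with positive scaling function $w$, i.e. $\lim_{u\to\infty}\overline F(u+x/w(u))/\overline F(u)=e^{-x}$ for all $x\in\mathbb R$. Let $\mathbf a\in(0,\infty)^k$, let $I$, with $m$ elements, be the minimal index set of the quadratic programme $\mathcal P(\Sigma^{-1},\mathbf a)$ with unique solution $\overline{\mathbf a}$, and put $J:=\{1,\dots,k\}\setminus I$. Let $u_n$ be positive constants with $u_n\to\infty$ and put $\delta_n:=u_n\|\mathbf a_I\|$, $\zeta_n:=w(\delta_n)$. Let $\mathbf t_n\in\mathbb R^k$ be componentwise positive for all sufficiently large $n$ and satisfy $\lim_{n\to\infty}\zeta_n(\mathbf t_n-u_n\overline{\mathbf a})_I=\mathbf q_I\in\mathbb R^m$ and, if $m<k$, $\lim_{n\to\infty}(\zeta_n/\delta_n)^{1/2}(\mathbf t_n-u_n\overline{\mathbf a})_J=\mathbf q_J\in[-\infty,\infty)^{k-m}$. Let $\mathbf X^*:=A^\top R\mathbf V$, where $\mathbf V$ is uniformly distributed on the unit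 sphere of $\mathbb R^k$ and independent of $R$. If the set $L:=\{i:1\le i\le k,\ \alpha_i\neq1/2,\ (C\overline{\mathbf a})_i=0\}$ is empty, then $$\lim_{n\to\infty}\frac{\mathbf P\{\mathbf X>\mathbf t_n\}}{\mathbf P\{\mathbf X^*>\mathbf t_n\}}=c_{\alpha,A,\mathbf a}:=\tau_M^*\,\frac{\Gamma(\overline\alpha)\,\Gamma(1/2)^k}{\Gamma(k/2)\prod_{i=1}^k\Gamma(\alpha_i)}\in(0,\infty),$$ where (as $L=\emptyset$, $M:=\{1,\dots,k\}\setminus L=\{1,\dots,k\}$) $$\tau_M^*:=\prod_{i\in M,\ \alpha_i\ne1/2}\Big(\|\mathbf a_I\|^{1-2\alpha_i}\,|(C\overline{\mathbf a})_i|^{2\alpha_i-1}\Big).$$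
   Context: Symmetrised Dirichlet distribution: let $\mathbf D=(D_1,\dots,D_k)^\top$ be Dirichlet distributed with parameter $\alpha\in(0,\infty)^k$ and let $\varepsilon_1,\dots,\varepsilon_k$ be independent Rademacher ($\pm1$ with probability $1/2$) variables independent of $\mathbf D$; then $\mathcal{SD}(k,\alpha)$ is the law of $(\varepsilon_1\sqrt{D_1},\dots,\varepsilon_k\sqrt{D_k})^\top$. Notation: $\overline F:=1-F$. $\overline\alpha:=\sum_{i=1}^k\alpha_i$; empty products equal $1$. For index sets $K,K'$, $\mathbf x_K$ is the subvector of $\mathbf x$ with indices in $K$, and $B_{KK'}$ is the submatrix of $B$ with rows in $K$ and columns in $K'$; $\Sigma_{II}^{-1}:=(\Sigma_{II})^{-1}$. $\|\mathbf x_I\|:=(\mathbf x_I^\top\Sigma_{II}^{-1}\mathbf x_I)^{1/2}$. Vector inequalities are componentwise. Quadratic programme: $\mathcal P(\Sigma^{-1},\mathbf a)$ is the problem of minimising $\mathbf x^\top\Sigma^{-1}\mathbf x$ subject to $\mathbf x\ge\mathbf a$. It has a unique solution $\overline{\mathbf a}$, and there is a unique non-empty index set $I\subset\{1,\dots,k\}$, called the minimal index set, such that $\overline{\mathbf a}_I=\mathbf a_I$, $\Sigma_{II}^{-1}\mathbf a_I>\mathbf 0_I$ and, if $J=\{1,\dots,k\}\setminus I\neq\emptyset$, $\overline{\mathbf a}_J=\Sigma_{JI}\Sigma_{II}^{-1}\mathbf a_I\ge\mathbf a_J$. *)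

(* Defs.v *)
From HB Require Import structures.
From mathcomp Require Import all_boot all_order all_algebra.
From mathcomp Require Import all_classical all_reals all_analysis.

Set Implicit Arguments.
Unset Strict Implicit.
Unset Printing Implicit Defensive.

Import Order.TTheory GRing.Theory Num.Theory.
Import numFieldNormedType.Exports.

Local Open Scope classical_set_scope.
Local Open Scope ring_scope.

(* Random vectors take values in k.-tuple R, whose library sigma-algebra is
   generated by the coordinates (the Borel sigma-algebra of R^k); deterministic
   vectors are column matrices. *)
Definition colv (R : realType) (k : nat) (x : k.-tuple R) : 'cV[R]_k :=
  \col_i tnth x i.

Definition tupv (R : realType) (k : nat) (x : 'cV[R]_k) : k.-tuple R :=
  [tuple x i 0 | i < k].

Section probability_notions.
Context {R : realType}.

Definition same_law d1 d2 d (T1 : measurableType d1) (T2 : measurableType d2)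
    (E : measurableType d) (P1 : probability T1 R) (P2 : probability T2 R)
    (X : T1 -> E) (Y : T2 -> E) : Prop :=
  forall B : set E, measurable B -> P1 (X @^-1` B) = P2 (Y @^-1` B).

Definition independent_rv d d1 d2 (T : measurableType d)
    (E1 : measurableType d1) (E2 : measurableType d2) (P : probability T R)
    (X : T -> E1) (Y : T -> E2) : Prop :=
  forall (B1 : set E1) (B2 : set E2), measurable B1 -> measurable B2 ->
    P (X @^-1` B1 `&` Y @^-1` B2) = (P (X @^-1` B1) * P (Y @^-1` B2))%E.

(* Taking B i = setT for some of the indices gives the product rule for every
   subfamily. *)
Definition independent_coords d (T : measurableType d) (P : probability T R)
    (k : nat) (X : T -> k.-tuple R) : Prop :=
  forall B : 'I_k -> set R, (forall i, measurable (B i)) ->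
    P [set o | forall i, B i (tnth (X o) i)] =
    (\prod_(i < k) P [set o | B i (tnth (X o) i)])%E.

Definition rademacher_vector d (T : measurableType d) (P : probability T R)
    (k : nat) (eps : {RV P >-> k.-tuple R}) : Prop :=
  independent_coords P eps /\
  forall i, P [set o | tnth (eps o) i = 1] = (2^-1)%:E /\
            P [set o | tnth (eps o) i = -1] = (2^-1)%:E.

Definition Gamma (a : R) : R :=
  \int[lebesgue_measure]_(x in `]0, +oo[) (x `^ (a - 1) * expR (- x)).

(* Lebesgue integral over R^n of a nonnegative measurable function, as an
   iterated integral (Tonelli). *)
Fixpoint tuple_integral (n : nat) : (n.-tuple R -> \bar R) -> \bar R :=
  match n with
  | 0 => fun f => f [tuple]
  | n'.+1 => fun f => (\int[lebesgue_measure]_x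
      tuple_integral (fun v : n'.-tuple R => f (cons_tuple (x : R) v)))%E
  end.

(* (x_1, .., x_{k-1}) |-> (x_1, .., x_{k-1}, 1 - x_1 - .. - x_{k-1}) *)
Definition simplex_point (k : nat) (x : k.-1.-tuple R) : k.-tuple R :=
  [tuple if (i < k.-1)%N then nth 0 x i else 1 - \sum_(j < k.-1) tnth x j
  | i < k].

Definition dirichlet_density (k : nat) (alpha : 'I_k -> R)
    (p : k.-tuple R) : R :=
  if [forall i, 0 < tnth p i]
  then Gamma (\sum_i alpha i) / (\prod_i Gamma (alpha i)) *
       \prod_i tnth p i `^ (alpha i - 1)
  else 0.

(* The first k - 1 coordinates have the Dirichlet density with respect to
   Lebesgue measure on R^(k-1), and the last one is 1 minus their sum. *)
Definition dirichlet_rv d (T : measurableType d) (P : probability T R)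
    (k : nat) (alpha : 'I_k -> R) (D : {RV P >-> k.-tuple R}) : Prop :=
  forall B : set (k.-tuple R), measurable B ->
    P (D @^-1` B) = tuple_integral (fun x =>
      (\1_B (simplex_point x) * dirichlet_density alpha (simplex_point x))%:E).

Definition symm_dirichlet_rv d (T : measurableType d) (P : probability T R)
    (k : nat) (alpha : 'I_k -> R) (U : {RV P >-> k.-tuple R}) : Prop :=
  exists (d0 : measure_display) (T0 : measurableType d0)
    (P0 : probability T0 R) (D eps : {RV P0 >-> k.-tuple R}),
    [/\ dirichlet_rv alpha D, rademacher_vector eps, independent_rv P0 D eps &
        same_law P P0 U (fun o =>
          [tuple tnth (eps o) i * Num.sqrt (tnth (D o) i) | i < k])].

(* The uniform distribution on the unit sphere is the rotation-invariant
   probability measure carried by it. *)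
Definition uniform_sphere_rv d (T : measurableType d) (P : probability T R)
    (k : nat) (V : {RV P >-> k.-tuple R}) : Prop :=
  P [set o | \sum_i tnth (V o) i ^+ 2 = 1] = 1%E /\
  forall Q : 'M[R]_k, Q^T *m Q = 1%:M ->
    same_law P P (fun o => tupv (Q *m colv (V o))) V.

Definition gumbel_mda (F w : R -> R) : Prop :=
  forall x : R,
    (1 - F (u + x / w u)) / (1 - F u) @[u --> +oo] --> expR (- x).

End probability_notions.

Section quadratic_programme.
Context {R : realType} {k : nat}.
Implicit Types (M Sigma : 'M[R]_k) (a x : 'cV[R]_k) (K I : {set 'I_k}).

Definition subv K x : 'cV[R]_#|K| := rowsub (@enum_val _ (mem K)) x.

Definition subm K K' M : 'M[R]_(#|K|, #|K'|) :=
  mxsub (@enum_val _ (mem K)) (@enum_val _ (mem K')) M.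

Definition quad_form n (M : 'M[R]_n) (x : 'cV[R]_n) : R :=
  (x^T *m M *m x) 0 0.

Definition qp_solution M a x : Prop :=
  (forall i, a i 0 <= x i 0) /\
  (forall y : 'cV[R]_k, (forall i, a i 0 <= y i 0) ->
     quad_form M x <= quad_form M y).

Definition minimal_index_set Sigma a abar I : Prop :=
  let J := (~: I)%SET in
  let SIIa := invmx (subm I I Sigma) *m subv I a in
  [/\ I != finset.set0,
      subv I abar = subv I a,
      (forall i, 0 < SIIa i 0) &
      J != finset.set0 ->
        subv J abar = subm J I Sigma *m SIIa /\
        (forall j, subv J a j 0 <= subv J abar j 0)].

Definition norm_sub Sigma I x : R :=
  Num.sqrt (quad_form (invmx (subm I I Sigma)) (subv I x)).

Definition degenerate_set (alpha : 'I_k -> R) (C : 'M[R]_k)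
    (abar : 'cV[R]_k) : {set 'I_k} :=
  [set i | (alpha i != 2^-1) && ((C *m abar) i 0 == 0)]%SET.

Definition tau_star (alpha : 'I_k -> R) (C Sigma : 'M[R]_k)
    (a abar : 'cV[R]_k) I : R :=
  \prod_(i in (~: degenerate_set alpha C abar)%SET | alpha i != 2^-1)
     (norm_sub Sigma I a `^ (1 - 2 * alpha i) *
      `|(C *m abar) i 0| `^ (2 * alpha i - 1)).

Definition tail_constant (alpha : 'I_k -> R) (A : 'M[R]_k)
    (a abar : 'cV[R]_k) I : R :=
  tau_star alpha (invmx A^T) (A^T *m A) a abar I *
  (Gamma (\sum_i alpha i) * Gamma 2^-1 ^+ k /
   (Gamma (k%:R / 2) * \prod_i Gamma (alpha i))).

End quadratic_programme.

(* Main.v *)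
Require Import Defs.
From HB Require Import structures.
From mathcomp Require Import all_boot all_order all_algebra.
From mathcomp Require Import all_classical all_reals all_analysis.
From mathcomp Require Import measurable_realfun ring lra.

Set Implicit Arguments.
Unset Strict Implicit.
Unset Printing Implicit Defensive.

Import Order.TTheory GRing.Theory Num.Theory.
Import numFieldNormedType.Exports.

Local Open Scope classical_set_scope.
Local Open Scope ring_scope.

(** Write V for the uniform direction and g for the function angular_density,
    v |-> c0 * prod_i |v_i| ^ (2 alpha_i - 1).

    The law of U has the density g with respect to the law of V
    (symm_dirichlet_le and symm_dirichlet_ge, stated as bounds for sets on which
    g is bounded).  To see this, V is compared with the direction of a Gaussian
    vector.  Both are carried by the unit sphere and give balls centred on it a
    mass that depends only on the radius: for V because reflections exchange the
    points of the sphere, for the Gaussian vector because products of planar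
    rotations preserve volume.  Such a probability is unique
    (ball_uniform_unique).  The substitution y = x ^ 2 in each coordinate and the
    polar decomposition with respect to the sum of the coordinates show that the
    squares of the Gaussian direction are Dirichlet distributed with parameters
    1/2 (gauss_direction_square), and g is a constant times the quotient of two
    Dirichlet densities.  That the normalising constants are positive follows
    from the total mass 1 of the laws in which they occur.

    Let z be the vector of multipliers of the quadratic programme
    (minimal_index_multiplier): it is supported by the minimal index set and
    positive there, and A^T (A z) is the solution abar.  Put v0 := A z, which is
    C abar and has the norm |a_I|, and let vbar be v0 divided by its norm.
    Testing an exceedance of t_n by R A^T v against z shows that
    R > (1 + e/2) delta_n for large n if v is away from vbar (exceedance_far),
    whereas every v close to vbar gives an exceedance as soon as
    R > (1 + kappa) delta_n (exceedance_near).  The tail of R varies rapidly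
    (gumbel_rapid_variation), so for kappa < e/2 the first event is negligible
    with respect to the second.  Hence only directions near vbar matter in both
    probabilities, and their ratio tends to g(vbar) because g is continuous
    there: a coordinate of vbar vanishes only if its exponent is 0
    (exceedance_ratio_cvg).  Finally g(vbar) is the constant c_{alpha,A,a}
    (tail_constantE).  The limits q of the thresholds enter only through the
    bounds t_n <= u_n (abar + o(1)) for all coordinates and
    t_n >= u_n (abar - o(1)) on the minimal index set. *)

(** * Iterated integrals *)

Section tuple_integral_theory.
Context {R : realType}.
Local Open Scope ereal_scope.
Local Notation mu := (@lebesgue_measure R).

Lemma measurable_cons_tuple n :
  measurable_fun setT (fun p : R * n.-tuple R => cons_tuple p.1 p.2).
Proof. exact: (@measurable_cons _ _ _ _ fst n snd). Qed.

Lemma measurable_cons_param d (E : measurableType d) n :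
  measurable_fun setT (fun p : E * R * n.-tuple R =>
    (p.1.1, cons_tuple p.1.2 p.2)).
Proof.
apply/measurable_fun_pair; first exact: measurableT_comp.
by apply: measurable_cons => //; exact: measurableT_comp.
Qed.

Lemma measurable_cons_section n (f : n.+1.-tuple R -> \bar R) (x : R) :
  measurable_fun setT f -> measurable_fun setT (fun v => f (cons_tuple x v)).
Proof.
move=> mf; apply: (measurableT_comp mf).
exact: (@measurable_cons _ _ _ _ (cst x) n id).
Qed.

Lemma tuple_integral_ge0 n (f : n.-tuple R -> \bar R) :
  (forall v, 0 <= f v) -> 0 <= tuple_integral f.
Proof.
elim: n f => [|n IH] f f0 //=; apply: integral_ge0 => x _.
by apply: IH => v.
Qed.

(** Integrating out a tuple preserves measurability in a parameter. *)
Lemma measurable_fun_tuple_integral n d (E : measurableType d)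
    (f : E * n.-tuple R -> \bar R) :
  (forall x, 0 <= f x) -> measurable_fun setT f ->
  measurable_fun setT (fun e => tuple_integral (fun v => f (e, v))).
Proof.
elim: n d E f => [|n IH] d E f f0 mf /=.
  exact: measurableT_comp.
pose F (p : E * R) := tuple_integral (fun v => f (p.1, cons_tuple p.2 v)).
apply: (measurable_fun_fubini_tonelli_F (m2 := mu) F).
- apply: (IH _ _ (fun q : (E * R) * n.-tuple R =>
    f (q.1.1, cons_tuple q.1.2 q.2))) => //.
  apply: (measurableT_comp mf).
  exact: measurable_cons_param.
- by move=> p; apply: tuple_integral_ge0 => v.
Qed.

Lemma measurable_tuple_integral_cons n (f : n.+1.-tuple R -> \bar R) :
  (forall x, 0 <= f x) -> measurable_fun setT f ->
  measurable_fun setT (fun x : R => tuple_integral (fun v => f (cons_tuple x v))).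
Proof.
move=> f0 mf.
apply: (@measurable_fun_tuple_integral n _ _
  (fun p : R * n.-tuple R => f (cons_tuple p.1 p.2))) => //.
by apply: (measurableT_comp mf); exact: measurable_cons_tuple.
Qed.

Lemma le_tuple_integral n (f g : n.-tuple R -> \bar R) :
  (forall x, 0 <= f x) -> measurable_fun setT f ->
  measurable_fun setT g -> (forall x, f x <= g x) ->
  tuple_integral f <= tuple_integral g.
Proof.
elim: n f g => [|n IH] f g f0 mf mg fg /=; first exact: fg.
apply: ge0_le_integral => //.
- by move=> x _; apply: tuple_integral_ge0.
- exact: measurable_tuple_integral_cons.
- apply: measurable_tuple_integral_cons => // x.
  exact: (le_trans (f0 x)).
- by move=> x _; apply: IH => //; exact: measurable_cons_section.
Qed.

Lemma tuple_integralZl n (c : \bar R) (f : n.-tuple R -> \bar R) : 0 <= c ->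
  (forall x, 0 <= f x) -> measurable_fun setT f ->
  tuple_integral (fun v => c * f v) = c * tuple_integral f.
Proof.
move=> c0; elim: n f => [//|n IH] f f0 mf /=.
rewrite -ge0_integralZl//.
- by apply: eq_integral => x _; rewrite IH//; exact: measurable_cons_section.
- exact: measurable_tuple_integral_cons.
- by move=> x _; apply: tuple_integral_ge0.
Qed.

Lemma tuple_integral_nneseries n (f : nat -> n.-tuple R -> \bar R) :
  (forall i x, 0 <= f i x) -> (forall i, measurable_fun setT (f i)) ->
  tuple_integral (fun v => \sum_(i <oo) f i v) =
  \sum_(i <oo) tuple_integral (f i).
Proof.
elim: n f => [//|n IH] f f0 mf /=.
rewrite -integral_nneseries//.
- by apply: eq_integral => x _; rewrite IH// => i; exact: measurable_cons_section.
- by move=> i; exact: measurable_tuple_integral_cons.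
- by move=> i x _; exact: tuple_integral_ge0.
Qed.

(** Tonelli's theorem for an iterated integral and one more integral. *)
Lemma tuple_integral_swap n d (E : measurableType d)
    (m : {sigma_finite_measure set E -> \bar R})
    (f : E * n.-tuple R -> \bar R) :
  (forall x, 0 <= f x) -> measurable_fun setT f ->
  \int[m]_e tuple_integral (fun v => f (e, v)) =
  tuple_integral (fun v => \int[m]_e f (e, v)).
Proof.
elim: n f => [//|n IH] f f0 mf /=.
pose F (p : E * R) := tuple_integral (fun v => f (p.1, cons_tuple p.2 v)).
have mF : measurable_fun setT F.
  apply: (@measurable_fun_tuple_integral n _ _ (fun q : (E * R) * n.-tuple R =>
    f (q.1.1, cons_tuple q.1.2 q.2))) => //.
  by apply: (measurableT_comp mf); exact: measurable_cons_param.
rewrite (fubini_tonelli (m1 := m) (m2 := mu) F mF); last first.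
  by move=> p; exact: tuple_integral_ge0.
apply: eq_integral => x _.
apply: (IH (fun q => f (q.1, cons_tuple x q.2))) => //.
apply: (measurableT_comp mf).
apply/measurable_fun_pair; first exact: measurable_fst.
by apply: measurable_cons => //.
Qed.

(** The last variable may be integrated out first. *)
Lemma tuple_integral_rcons n (f : n.+1.-tuple R -> \bar R) :
  tuple_integral f =
  tuple_integral (fun v : n.-tuple R => \int[mu]_z f (rcons_tuple v z)).
Proof.
elim: n f => [|n IH] f.
  rewrite /=; apply: eq_integral => x _; congr f.
  by apply/val_inj.
have S m (g : m.+1.-tuple R -> \bar R) : tuple_integral g =
  \int[mu]_x tuple_integral (fun v => g (cons_tuple x v)) by [].
rewrite (S _ f) S; apply: eq_integral => x _.
rewrite (IH (fun v => f (cons_tuple x v))); congr tuple_integral.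
apply/funext => v; apply: eq_integral => z _.
by congr f; apply/val_inj.
Qed.

End tuple_integral_theory.

(** * Affine substitutions and planar rotations *)

Section lebesgue_substitution.
Context {R : realType}.
Local Notation mu := (@lebesgue_measure R).
Local Open Scope ereal_scope.

Let measurable_affine (a b : R) : measurable_fun setT (fun x : R => a * x + b)%R.
Proof. by apply: measurable_funD => //; exact: measurable_funM. Qed.

(** Both sides are measures in B that agree on half-open intervals. *)
Lemma lebesgue_measure_affine (a b : R) (B : set R) : a != 0%R ->
  measurable B -> mu B = `|a|%:E * mu ((fun x => a * x + b)%R @^-1` B).
Proof.
move=> a0 mB.
pose phi (x : measurableTypeR R) : measurableTypeR R := (a * x + b)%R.
have mphi : measurable_fun setT phi := measurable_affine a b.
pose m0 : {measure set (measurableTypeR R) -> \bar R} :=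
  mscale (NngNum (normr_ge0 a)) (pushforward mu phi).
pose m := m0 mphi.
suff : mu B = m B by [].
apply: lebesgue_measure_unique => // X [[s t]/= _ <-].
rewrite /m /m0 /mscale /= /pushforward lebesgue_measure_itv/=.
have [a_gt0|a_lt0|/eqP] := ltgtP 0%R a; last by rewrite eq_sym (negPf a0).
- have -> : phi @^-1` `]s, t] = `] ((s - b) / a)%R, ((t - b) / a)%R]%classic.
    apply/seteqP; split => x /=; rewrite !in_itv/= /phi.
      by rewrite ltr_pdivrMr// ler_pdivlMr// (mulrC x) ltrBlDr lerBrDr.
    by rewrite ltr_pdivrMr// ler_pdivlMr// (mulrC x) ltrBlDr lerBrDr.
  rewrite [RHS](congr1 _ (lebesgue_measure_itv _))/= !lte_fin.
  rewrite ltr_pM2r ?invr_gt0// ltrD2r.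
  case: ifPn => st; last by rewrite mule0.
  rewrite -!EFinB -EFinM gtr0_norm//; congr EFin.
  by field; rewrite gt_eqF.
- have -> : phi @^-1` `]s, t] = `[ ((t - b) / a)%R, ((s - b) / a)%R[%classic.
    apply/seteqP; split => x /=; rewrite !in_itv/= /phi.
      by rewrite ler_ndivrMr// ltr_ndivlMr// (mulrC x) ltrBlDr lerBrDr andbC.
    by rewrite ler_ndivrMr// ltr_ndivlMr// (mulrC x) ltrBlDr lerBrDr andbC.
  rewrite [RHS](congr1 _ (lebesgue_measure_itv _))/= !lte_fin.
  rewrite ltr_nM2r ?invr_lt0// ltrD2r.
  case: ifPn => st; last by rewrite mule0.
  rewrite -!EFinB -EFinM ltr0_norm//; congr EFin.
  by field; rewrite lt_eqF.
Qed.

Lemma integral_affine (a b : R) (f : R -> \bar R) : a != 0%R ->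
  measurable_fun setT f -> (forall x, 0 <= f x) ->
  \int[mu]_x f x = `|a|%:E * \int[mu]_x f (a * x + b)%R.
Proof.
move=> a0 mf f0.
pose phi (x : measurableTypeR R) : measurableTypeR R := (a * x + b)%R.
have mphi : measurable_fun setT phi := measurable_affine a b.
pose m0 : {measure set (measurableTypeR R) -> \bar R} :=
  mscale (NngNum (normr_ge0 a)) (pushforward mu phi).
pose m := m0 mphi.
rewrite (eq_measure_integral m); last first.
  by move=> A mA _; exact: (lebesgue_measure_affine b a0 mA).
rewrite ge0_integral_mscale//= ge0_integral_pushforward//.
Qed.

Lemma integral_shift (b : R) (f : R -> \bar R) :
  measurable_fun setT f -> (forall x, 0 <= f x) ->
  \int[mu]_x f (x + b)%R = \int[mu]_x f x.
Proof.
move=> mf f0; rewrite [RHS](@integral_affine 1 b)// ?oner_eq0//.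
rewrite normr1 mul1e; apply: eq_integral => x _; by rewrite mul1r.
Qed.

Lemma integral_oppr (f : R -> \bar R) :
  measurable_fun setT f -> (forall x, 0 <= f x) ->
  \int[mu]_x f (- x)%R = \int[mu]_x f x.
Proof.
move=> mf f0; rewrite [RHS](@integral_affine (-1) 0)// ?oppr_eq0 ?oner_eq0//.
rewrite normrN1 mul1e; apply: eq_integral => x _; by rewrite mulN1r addr0.
Qed.

(** The planar integral, in terms of which rotations are described. *)
Definition integral2 (F : R * R -> \bar R) := \int[mu]_x \int[mu]_y F (x, y).

Lemma integral2_shear_l (a : R) (F : R * R -> \bar R) :
  measurable_fun setT F -> (forall p, 0 <= F p) ->
  integral2 (fun p => F (p.1 + a * p.2, p.2)%R) = integral2 F.
Proof.
move=> mF F0.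
pose G (p : R * R) := F (p.1 + a * p.2, p.2)%R.
have mG : measurable_fun setT G.
  apply: (measurableT_comp mF); apply/measurable_fun_pair => //=.
  by apply: measurable_funD => //; apply: measurable_funM.
apply: (etrans (fubini_tonelli (m1 := mu) (m2 := mu) G mG (fun p => F0 _))).
apply/esym/(etrans (fubini_tonelli (m1 := mu) (m2 := mu) F mF F0)).
apply/esym.
apply: eq_integral => y _.
rewrite (@integral_shift (a * y) (fun x => F (x, y)))//.
by apply: (measurableT_comp mF); exact: measurable_pair2.
Qed.

Lemma integral2_shear_r (a : R) (F : R * R -> \bar R) :
  measurable_fun setT F -> (forall p, 0 <= F p) ->
  integral2 (fun p => F (p.1, p.2 + a * p.1)%R) = integral2 F.
Proof.
move=> mF F0; rewrite /integral2.
apply: eq_integral => x _.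
rewrite (@integral_shift (a * x) (fun y => F (x, y)))//.
by apply: (measurableT_comp mF); exact: measurable_pair1.
Qed.

(** A rotation with s <> 0 is a product of three shears; the others are the
    identity and the half-turn. *)
Lemma integral2_rotation (c s : R) (F : R * R -> \bar R) :
  (c ^+ 2 + s ^+ 2 = 1)%R ->
  measurable_fun setT F -> (forall p, 0 <= F p) ->
  integral2 (fun p => F (c * p.1 + s * p.2, - s * p.1 + c * p.2)%R)
  = integral2 F.
Proof.
move=> cs1 mF F0.
have mlin (a b : R) : measurable_fun [set: R * R] (fun p => a * p.1 + b * p.2)%R.
  by apply: measurable_funD; exact: measurable_funM.
have [s0|s0] := eqVneq s 0%R; last first.
  pose a := ((1 - c) / s)%R.
  pose F1 p := F (p.1 + a * p.2, p.2)%R.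
  pose F2 p := F1 (p.1, p.2 + (- s) * p.1)%R.
  have mF1 : measurable_fun setT F1.
    apply: (measurableT_comp mF); apply/measurable_fun_pair => //=.
    by apply: measurable_funD => //; exact: measurable_funM.
  have mF2 : measurable_fun setT F2.
    apply: (measurableT_comp mF1); apply/measurable_fun_pair => //=.
    by apply: measurable_funD => //; exact: measurable_funM.
  apply: (etrans _ (@integral2_shear_l a F mF F0)).
  apply: (etrans _ (@integral2_shear_r (- s) F1 mF1 (fun p => F0 _))).
  apply: (etrans _ (@integral2_shear_l a F2 mF2 (fun p => F0 _))).
  congr integral2; apply/funext => -[x y]; rewrite /F2 /F1 /=.
  have sa : (s * a = 1 - c)%R by rewrite /a mulrC divfK.
  have E1 : (a * (1 + c) = s)%R.
    apply: (mulfI s0); rewrite mulrA sa -expr2.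
    have -> : (s ^+ 2 = 1 - c ^+ 2)%R by rewrite -cs1; ring.
    by ring.
  congr F; congr pair.
    transitivity ((1 - s * a) * x + (a + a * (1 - s * a)) * y)%R; last by ring.
    rewrite sa; have -> : (1 - (1 - c) = c)%R by ring.
    by rewrite -E1; ring.
  transitivity (- s * x + (1 - s * a) * y)%R; last by ring.
  by rewrite sa; ring.
have c2 : (c ^+ 2 == 1 ^+ 2)%R by rewrite expr1n -[X in _ == X]cs1 s0 expr0n/= addr0.
move: c2; rewrite s0 eqf_sqr => /orP[]/eqP -> {cs1 s0}.
  congr integral2; apply/funext => -[x y]/=; congr F; congr pair; ring.
transitivity (integral2 (fun p => F (- p.1, - p.2)%R)).
  congr integral2; apply/funext => -[x y]/=; congr F; congr pair; ring.
rewrite /integral2.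
under eq_integral => x _.
  rewrite (@integral_oppr (fun y => F (- x, y)%R))//; last first.
    by apply: (measurableT_comp mF); exact: measurable_pair1.
  over.
rewrite (@integral_oppr (fun x => \int[mu]_y F (x, y)))//.
  exact: (measurable_fun_fubini_tonelli_F (m2 := mu) F).
by move=> x; apply: integral_ge0.
Qed.

End lebesgue_substitution.

(** * The measure induced by an integration functional *)

Section functional_measure.
Context {R : realType} {d} {T : measurableType d}.
Local Open Scope ereal_scope.
Variable L : (T -> \bar R) -> \bar R.
Hypothesis L0 : L (fun=> 0) = 0.
Hypothesis L_ge0 : forall f, (forall x, 0 <= f x) -> 0 <= L f.
Hypothesis L_series : forall f : nat -> T -> \bar R, (forall i x, 0 <= f i x) ->
  (forall i, measurable_fun setT (f i)) ->
  L (fun x => \sum_(i <oo) f i x) = \sum_(i <oo) L (f i).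

(** The set function induced by a countably additive functional on
    nonnegative functions; the unit mass at x evaluates the indicator. *)
Definition functional_measure (B : set T) := L (fun x => \d_x B).

Let fm0 : functional_measure set0 = 0.
Proof.
rewrite /functional_measure -[RHS]L0; congr L; apply/funext => x.
by rewrite measure0.
Qed.

Let fm_ge0 B : 0 <= functional_measure B.
Proof. by apply: L_ge0 => x; exact: measure_ge0. Qed.

Let fm_sigma_additive : semi_sigma_additive functional_measure.
Proof.
move=> F mF tF mUF.
rewrite [X in _ --> X](_ : _ = \sum_(n <oo) functional_measure (F n)).
  apply/cvg_closeP; split; last by rewrite closeE.
  by apply: is_cvg_nneseries => *; exact: fm_ge0.
rewrite /functional_measure -L_series//.
- congr L; apply/funext => x; apply/esym/cvg_lim => //.
  exact: (measure_semi_sigma_additive (s := \d_x) F).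
- by move=> i; apply: measurable_fun_dirac.
Qed.

HB.instance Definition _ := isMeasure.Build _ _ _ functional_measure
  fm0 fm_ge0 fm_sigma_additive.

Definition measure_of_functional : {measure set T -> \bar R} :=
  functional_measure.

End functional_measure.

(** * The substitution y = x ^ 2 *)

Section square_substitution.
Context {R : realType}.
Local Notation mu := (@lebesgue_measure R).
Local Open Scope ereal_scope.

(** The derivative of x ^ 2 on the positive half-line, extended by 0. *)
Let dsq (x : R) : R := if (0 < x)%R then (2 * x)%R else 0%R.

Let dsq_ge0 x : (0 <= dsq x)%R.
Proof. by rewrite /dsq; case: ifPn => // x0; rewrite mulr_ge0// ltW. Qed.

Let measurable_dsq : measurable_fun setT dsq.
Proof.
by apply: measurable_fun_ifT => //=; exact: measurable_fun_ltr.
Qed.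

Let Lsq (f : R -> \bar R) := \int[mu]_x ((dsq x)%:E * f (x ^+ 2)%R).

Let measurable_Lsq (f : R -> \bar R) : measurable_fun setT f ->
  measurable_fun setT (fun x => (dsq x)%:E * f (x ^+ 2)%R).
Proof.
move=> mf; apply: emeasurable_funM; first exact/measurable_EFinP.
by apply: (measurableT_comp mf); exact: measurable_funX.
Qed.

Let Lsq0 : Lsq (fun=> 0) = 0.
Proof. by apply: integral0_eq => x _; rewrite mule0. Qed.

Let Lsq_ge0 f : (forall x, 0 <= f x) -> 0 <= Lsq f.
Proof.
by move=> f0; apply: integral_ge0 => x _; rewrite mule_ge0// lee_fin.
Qed.

Let Lsq_series (f : nat -> R -> \bar R) : (forall i x, 0 <= f i x) ->
  (forall i, measurable_fun setT (f i)) ->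
  Lsq (fun x => \sum_(i <oo) f i x) = \sum_(i <oo) Lsq (f i).
Proof.
move=> f0 mf; rewrite /Lsq -integral_nneseries//.
- apply: eq_integral => x _; rewrite nneseriesZl//.
- by move=> i; exact: measurable_Lsq.
- by move=> i x _; rewrite mule_ge0// lee_fin.
Qed.

Let posreal := [set x : R | (0 < x)%R].

Let mpos : measurable (posreal : set (measurableTypeR R)).
Proof. by rewrite /posreal -set_itvoy; exact: measurable_itv. Qed.

(** Lebesgue measure restricted to the positive half-line, and the image under
    x ^ 2 of the measure with density 2 x there. *)
Let m1 : {measure set (measurableTypeR R) -> \bar R} := mrestr mu mpos.
Let m2 : {measure set (measurableTypeR R) -> \bar R} :=
  @measure_of_functional R _ (measurableTypeR R) Lsq Lsq0 Lsq_ge0 Lsq_series.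

Let integral_dsq (a b : R) : (0 <= a)%R -> (a < b)%R ->
  \int[mu]_(x in `]a, b]) (2 * x)%:E = (b ^+ 2 - a ^+ 2)%:E.
Proof.
move=> a0 ab.
have mf : measurable_fun setT (fun x : R => 2 * x)%R by exact: measurable_funM.
rewrite integral_itv_obnd_cbnd; last first.
  by apply/measurable_EFinP; exact: measurable_funTS.
rewrite (@continuous_FTC2 _ _ (fun x => x ^+ 2)%R)//.
- by apply: continuous_subspaceT => x; exact: mulrl_continuous.
- split.
  + by move=> x _; exact: exprn_derivable.
  + by apply: cvg_at_right_filter; exact: exprn_continuous.
  + by apply: cvg_at_left_filter; exact: exprn_continuous.
- move=> x _; rewrite exp_derive1 expr1 -mulr_natl.
  by [].
Qed.

Let m1m2_itv (X : set R) : ocitv X -> m1 X = m2 X.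
Proof.
move=> [[a b]/= _ <-]; rewrite /m1 /m2 /= /mrestr /functional_measure.
pose a' := Num.max a 0%R.
have a'0 : (0 <= a')%R by rewrite le_max lexx orbT.
have -> : `]a, b]%classic `&` posreal = `]a', b]%classic.
  apply/seteqP; split => x /=; rewrite !in_itv/= /posreal/= /a' gt_max.
    by move=> [/andP[-> ->] ->].
  by move=> /andP[/andP[-> ->] ->].
transitivity (\int[mu]_(x in `](Num.sqrt a')%R, (Num.sqrt b)%R]) (2 * x)%:E);
    last first.
  rewrite integral_mkcond; apply: eq_integral => x _.
  rewrite patchE /Lsq diracE /dsq mem_setE in_itv/=.
  have [x0|x0] := ltP 0%R x; last first.
    by rewrite mul0e ifF// ltNge (le_trans x0)// sqrtr_ge0.
  rewrite mem_setE in_itv/=.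
  have -> : (a < x ^+ 2 <= b)%R = (Num.sqrt a' < x <= Num.sqrt b)%R.
    congr andb.
      rewrite -[in RHS](gtr0_norm x0) -sqrtr_sqr ltr_sqrt ?exprn_gt0//.
      by rewrite /a' gt_max exprn_gt0// andbT.
    have [b0|b0] := leP 0%R b.
      by rewrite -[in RHS](gtr0_norm x0) -sqrtr_sqr ler_sqrt.
    rewrite ler0_sqrtr ?(ltW b0)// [RHS]leNgt x0/=; apply/negbTE.
    by rewrite -ltNge (lt_trans b0)// exprn_gt0.
  by case: ifPn => _; rewrite ?mule1 ?mule0.
have [ab|ba] := ltP a' b.
  have b0 : (0 < b)%R := le_lt_trans a'0 ab.
  rewrite integral_dsq ?sqrtr_ge0 ?ltr_sqrt//.
  rewrite !sqr_sqrtr ?(ltW b0)//.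
  by rewrite [LHS]lebesgue_measure_itv/= lte_fin ab EFinB.
rewrite set_itv_ge ?measure0; last by rewrite bnd_simp -leNgt.
rewrite set_itv_ge ?integral_set0//.
by rewrite bnd_simp -leNgt; exact: ler_wsqrtr.
Qed.

Let m1m2 (B : set R) : measurable B -> m1 B = m2 B.
Proof.
pose g (n : nat) : set R := `](- n%:R)%R, n%:R]%classic.
move=> mB.
apply: (@measure_unique _ R (measurableTypeR R) (@ocitv R) g _ _ _ _ m1 m2) => //.
- by move=> X Y; exact: (@measurableI _ (ocitv_type R)).
- by move=> n; exact: is_ocitv.
- apply/seteqP; split => // x _; exists (Num.truncn `|x|).+1 => //.
  rewrite /g /= in_itv/=.
  have : (`|x| < (Num.truncn `|x|).+1%:R)%R by rewrite truncnS_gt.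
  by rewrite ltr_norml => /andP[-> /ltW ->].
- move=> n; apply: (@le_lt_trans _ _ (mu (g n))); first
    by rewrite /m1/= /mrestr; apply: measureIl => //; exact: measurable_itv.
  by rewrite [mu _]lebesgue_measure_itv/=; case: ifP => // _; rewrite ltry.
Qed.

(** The substitution y = x ^ 2 on the positive half-line. *)
Lemma integral_square_positive (g : R -> \bar R) :
  measurable_fun setT g -> (forall x, 0 <= g x) ->
  \int[mu]_(y in [set y : R | (0 < y)%R]) g y =
  \int[mu]_(x in [set x : R | (0 < x)%R]) ((2 * x)%:E * g (x ^+ 2)%R).
Proof.
move=> mg g0; rewrite [LHS]integral_mkcond [RHS]integral_mkcond.
(* layer-cake formula: the value e is the length of the interval ]0, e[ *)
pose K (e : \bar R) : set R := [set s : R | (0 < s)%R /\ s%:E < e].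
have mK e : measurable (K e : set (measurableTypeR R)).
  rewrite /K; case: e => [r| |].
  - rewrite (_ : mkset _ = `]0%R, r[%classic)//.
    by apply/seteqP; split => s; rewrite /= in_itv/= lte_fin => /andP.
  - rewrite (_ : mkset _ = `]0%R, +oo[%classic)//.
    by apply/seteqP; split => s; rewrite /= in_itv/= ltry andbT // => -[].
  - by rewrite (_ : mkset _ = set0)// -subset0 => s [].
have layer e : 0 <= e -> e = \int[mu]_s (\1_(K e) s)%:E.
  move=> e0; rewrite integral_indic// setIT.
  case: e e0 => [r| |] // e0.
    rewrite /K (_ : mkset _ = `]0%R, r[%classic); last first.
      by apply/seteqP; split => s; rewrite /= in_itv/= lte_fin => /andP.
    rewrite [RHS]lebesgue_measure_itv/= lte_fin; case: ifPn; rewrite ?sube0//.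
    by rewrite -leNgt => r0; apply/eqP; rewrite eq_le e0 lee_fin r0.
  rewrite /K (_ : mkset _ = `]0%R, +oo[%classic); last first.
    by apply/seteqP; split => s; rewrite /= in_itv/= ltry andbT // => -[].
  by rewrite [RHS]lebesgue_measure_itv/= ltry.
pose H : set (R * R) := [set p | (0 < p.2)%R /\ p.2%:E < g p.1].
have mH : measurable H.
  have -> : H = (setT `&` [set p : R * R | 0 < p.2%:E]) `&`
                (setT `&` [set p : R * R | 0 < g p.1 - p.2%:E]).
    apply/seteqP; split => -[y s].
      by move=> [s0 sg]; split; split => //; rewrite /mkset sube_gt0.
    by move=> [[_ s0] [_ sg]]; split => //; rewrite -sube_gt0.
  apply: measurableI; apply: emeasurable_fun_o_infty => //.
    exact: measurableT_comp.
  by apply: emeasurable_funB; apply: measurableT_comp.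
have HK y s : \1_H (y, s) = \1_(K (g y)) s :> R.
  by rewrite !indicE; congr (_%:R); apply/asboolP/asboolP.
pose A s : set R := [set y | H (y, s)].
have mA s : measurable (A s).
  rewrite /A (_ : mkset _ = ysection H s); first exact: measurable_ysection.
  by apply/seteqP; split => y; rewrite /ysection /= inE.
have mH1 : measurable_fun setT (fun p : R * R => (\1_H p : R)%:E).
  exact/measurable_EFinP/measurable_indic.
transitivity (\int[mu]_y \int[mu]_s ((\1_posreal y)%:E * (\1_H (y, s))%:E)).
  apply: eq_integral => y _.
  rewrite ge0_integralZl//; last first.
    by apply: (measurableT_comp mH1); exact: measurable_pair1.
  under eq_integral do rewrite HK.
  rewrite -layer// patchE indicE /posreal.
  by case: ifPn => _; rewrite ?mul1e ?mul0e.
pose G1 (p : R * R) := (\1_posreal p.1 : R)%:E * (\1_H p)%:E.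
have mG1 : measurable_fun setT G1.
  apply: emeasurable_funM => //; apply/measurable_EFinP.
  by apply: (measurableT_comp (measurable_indic _)) => //; exact: mpos.
have G10 p : 0 <= G1 p by rewrite mule_ge0// lee_fin.
apply: (etrans (fubini_tonelli (m1 := mu) (m2 := mu) G1 mG1 G10)).
transitivity (\int[mu]_s \int[mu]_x ((dsq x)%:E * (\1_H (x ^+ 2, s)%R)%:E)).
  apply: eq_integral => s _.
  transitivity (m1 (A s)); last first.
    exact: m1m2.
  rewrite /m1/= /mrestr.
  rewrite -(setIT (A s `&` posreal)).
  have mAp : measurable ((A s `&` posreal) : set (measurableTypeR R)).
    by apply: measurableI; [exact: mA|exact: mpos].
  rewrite -integral_indic//.
  apply: eq_integral => y _.
  rewrite indicI /G1 [LHS]muleC /=.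
  by [].
pose G2 (p : R * R) := (dsq p.1)%:E * (\1_H (p.1 ^+ 2, p.2)%R)%:E.
have mG2 : measurable_fun setT G2.
  apply: emeasurable_funM => //.
    by apply/measurable_EFinP; apply: measurableT_comp.
  apply: (measurableT_comp mH1); apply/measurable_fun_pair => //.
  by apply: measurable_funX.
have G20 p : 0 <= G2 p by rewrite mule_ge0// lee_fin.
apply: (etrans (esym (fubini_tonelli (m1 := mu) (m2 := mu) G2 mG2 G20))).
apply: eq_integral => x _; rewrite /G2 /=.
rewrite ge0_integralZl//; last 2 first.
  by apply: (measurableT_comp mH1); exact: measurable_pair1.
  by rewrite lee_fin.
under eq_integral do rewrite HK.
rewrite -layer// patchE /dsq.
have -> : (x \in [set x : R | (0 < x)%R]) = (0 < x)%R by apply/idP/idP; rewrite inE.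
by case: ifPn => _; rewrite ?mul0e.
Qed.

(** Integrals of functions of x ^ 2. *)
Lemma integral_square (f : R -> \bar R) :
  measurable_fun setT f -> (forall x, 0 <= f x) ->
  \int[mu]_x f (x ^+ 2)%R =
  \int[mu]_(y in [set y : R | (0 < y)%R]) ((y `^ (- 2^-1))%:E * f y).
Proof.
move=> mf f0.
have mpw : measurable_fun setT (fun y : R => (y `^ (- 2^-1))%:E).
  by apply/measurable_EFinP; exact: measurable_powR.
have msq : measurable_fun setT (fun x : R => f (x ^+ 2)%R).
  by apply: (measurableT_comp mf); exact: measurable_funX.
rewrite (@integral_square_positive (fun y => (y `^ (- 2^-1))%:E * f y)); last 2 first.
- exact: emeasurable_funM.
- by move=> y; rewrite mule_ge0// lee_fin powR_ge0.
transitivity (2%:E * \int[mu]_(x in [set x : R | (0 < x)%R]) f (x ^+ 2)%R).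
  rewrite -{1}(setUv [set x : R | (0 < x)%R]) ge0_integral_setU//=; last 3 first.
  - by apply: measurableC; exact: mpos.
  - by rewrite setUv.
  - exact/disj_setPCl.
  rewrite mule_natl mule2n; congr (_ + _).
  rewrite -set_itvoy integral_itv_obnd_cbnd; last exact: measurable_funTS.
  rewrite [RHS]integral_mkcond -[RHS]integral_oppr; last 2 first.
  - by apply/(measurable_restrictT _ _).1 => //; exact: measurable_funTS.
  - by move=> x; apply: erestrict_ge0.
  rewrite [LHS]integral_mkcond; apply: eq_integral => x _.
  rewrite !patchE sqrrN mem_setE in_itv/= andbT oppr_ge0.
  by congr (if _ then _ else _); rewrite leNgt in_setC mem_setE in_itv/= andbT.
rewrite -ge0_integralZl//; last first.
- exact: measurable_funTS.
apply: eq_integral => x; rewrite inE/= => x0.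
rewrite muleA -EFinM; congr (_%:E * _).
rewrite -powR_mulrn ?ltW// -powRrM mulrN divff// powR_inv1 ?ltW//.
by rewrite -mulrA divff ?mulr1// gt_eqF.
Qed.
End square_substitution.

(** * Linear isometries that preserve volume *)

Section tuple_geometry.
Context {R : realType}.

(** The squared Euclidean norm and distance. *)
Definition normsq n (x : n.-tuple R) : R := \sum_i tnth x i ^+ 2.

Definition distsq n (x y : n.-tuple R) : R :=
  \sum_i (tnth x i - tnth y i) ^+ 2.

(** Multiplication of a vector by a scalar. *)
Definition scale_tuple n (c : R) (x : n.-tuple R) : n.-tuple R :=
  [tuple c * tnth x i | i < n].

(** The vector (r, 0, .., 0). *)
Definition axis_tuple n (r : R) : n.-tuple R :=
  [tuple if i == 0%N :> nat then r else 0 | i < n].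

Lemma normsq_ge0 n (x : n.-tuple R) : 0 <= normsq x.
Proof. by apply: sumr_ge0 => i _; exact: sqr_ge0. Qed.

Lemma distsqC n (x y : n.-tuple R) : distsq x y = distsq y x.
Proof. by apply: eq_bigr => i _; rewrite -sqrrN opprB. Qed.

Lemma normsq_cons n a (x : n.-tuple R) :
  normsq (cons_tuple a x) = a ^+ 2 + normsq x.
Proof.
rewrite /normsq big_ord_recl tnth0; congr (_ + _).
by apply: eq_bigr => i _; rewrite tnthS.
Qed.

Lemma distsq_cons n a b (x y : n.-tuple R) :
  distsq (cons_tuple a x) (cons_tuple b y) = (a - b) ^+ 2 + distsq x y.
Proof.
rewrite /distsq big_ord_recl !tnth0; congr (_ + _).
by apply: eq_bigr => i _; rewrite !tnthS.
Qed.

Lemma scale_tuple_cons n c a (x : n.-tuple R) :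
  scale_tuple c (cons_tuple a x) = cons_tuple (c * a) (scale_tuple c x).
Proof.
apply: eq_from_tnth => i; rewrite tnth_mktuple.
have [->|[j ->]] : i = ord0 \/ exists j, i = lift ord0 j.
  by case: (unliftP ord0 i) => [j ->|->]; [right; exists j|left].
  by rewrite !tnth0.
by rewrite !tnthS tnth_mktuple.
Qed.

Lemma axis_tupleS n r : axis_tuple n.+1 r = cons_tuple r (axis_tuple n 0).
Proof.
apply: eq_from_tnth => i; rewrite tnth_mktuple.
have [->|[j ->]] : i = ord0 \/ exists j, i = lift ord0 j.
  by case: (unliftP ord0 i) => [j ->|->]; [right; exists j|left].
  by rewrite tnth0.
by rewrite tnthS tnth_mktuple /=; case: ifP.
Qed.

Lemma normsq_dist0 n (x : n.-tuple R) : normsq x = distsq x (scale_tuple 0 x).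
Proof.
by apply: eq_bigr => i _; rewrite tnth_mktuple mul0r subr0.
Qed.

Lemma normsq_scale n c (x : n.-tuple R) :
  normsq (scale_tuple c x) = c ^+ 2 * normsq x.
Proof.
by rewrite /normsq big_distrr; apply: eq_bigr => i _; rewrite tnth_mktuple exprMn.
Qed.

(** A pair of leading coordinates is singled out. *)
Definition cons_pair n (p : (R * R) * n.-tuple R) : n.+2.-tuple R :=
  cons_tuple p.1.1 (cons_tuple p.1.2 p.2).

Lemma measurable_cons_pair n : measurable_fun setT (@cons_pair n).
Proof.
rewrite /cons_pair.
  apply: (@measurable_cons _ _ _ _ (fun p : (R * R) * n.-tuple R => p.1.1)).
  by apply: measurableT_comp => //.
by apply: measurable_cons => //; apply: measurableT_comp => //.
Qed.

Lemma tuple_integral2 n (f : n.+2.-tuple R -> \bar R) :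
  tuple_integral f =
  integral2 (fun p => tuple_integral (fun v => f (cons_pair (p, v)))).
Proof. by []. Qed.

(** The rotation of the first two coordinates by the angle with cosine c and
    sine s. *)
Definition givens n (c s : R) (x : n.+2.-tuple R) : n.+2.-tuple R :=
  let x' := behead_tuple x in
  cons_pair ((c * thead x + s * thead x', - s * thead x + c * thead x'),
             behead_tuple x').

Lemma givensE n c s a b (v : n.-tuple R) :
  givens c s (cons_pair ((a, b), v)) =
  cons_pair ((c * a + s * b, - s * a + c * b), v).
Proof. by rewrite /givens; congr cons_pair; congr pair; apply/val_inj. Qed.

Lemma cons_pair_surj n (x : n.+2.-tuple R) :
  exists a b v, x = cons_pair ((a, b), v).
Proof. by case: (tupleP x) => a y; case: (tupleP y) => b v; exists a, b, v. Qed.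

Lemma measurable_givens n c s : measurable_fun setT (@givens n c s).
Proof.
have mb m : measurable_fun setT (fun x : m.+1.-tuple R => behead_tuple x).
  exact: measurable_behead.
have mh m : measurable_fun setT (fun x : m.+1.-tuple R => thead x).
  exact: measurable_tnth.
apply: (measurableT_comp (@measurable_cons_pair n)).
apply/measurable_fun_pair; last exact: (measurableT_comp (mb n) (mb n.+1)).
have mh' : measurable_fun setT (fun x : n.+2.-tuple R => thead (behead_tuple x)).
  exact: (measurableT_comp (mh n) (mb n.+1)).
have mh0 := mh n.+1.
by apply/measurable_fun_pair; apply: measurable_funD; apply: measurable_funM.
Qed.

Lemma tuple_integral_givens n c s (f : n.+2.-tuple R -> \bar R) :
  c ^+ 2 + s ^+ 2 = 1 -> (forall x, (0 <= f x)%E) -> measurable_fun setT f ->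
  tuple_integral (fun x => f (givens c s x)) = tuple_integral f.
Proof.
move=> cs f0 mf; rewrite [RHS]tuple_integral2.
pose F (p : R * R) := tuple_integral (fun v => f (cons_pair (p, v))).
have mF : measurable_fun setT F.
  apply: (@measurable_fun_tuple_integral _ n _ _ (fun q => f (cons_pair q))) => //.
  by apply: (measurableT_comp mf); exact: measurable_cons_pair.
have F0 p : (0 <= F p)%E by exact: tuple_integral_ge0.
apply: (etrans _ (integral2_rotation cs mF F0)).
rewrite tuple_integral2; congr integral2; apply/funext => -[a b].
by rewrite /F/=; congr tuple_integral; apply/funext => v; rewrite givensE.
Qed.

Lemma distsq_givens n c s (x y : n.+2.-tuple R) :
  c ^+ 2 + s ^+ 2 = 1 -> distsq (givens c s x) (givens c s y) = distsq x y.
Proof.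
move=> cs; have [a [b [v ->]]] := cons_pair_surj x.
have [a' [b' [v' ->]]] := cons_pair_surj y.
rewrite !givensE /cons_pair/= !distsq_cons.
transitivity ((c ^+ 2 + s ^+ 2) * (a - a') ^+ 2 +
  ((c ^+ 2 + s ^+ 2) * (b - b') ^+ 2 + distsq v v')); first by ring.
by rewrite cs !mul1r.
Qed.

Lemma scale_givens n c s l (x : n.+2.-tuple R) :
  givens c s (scale_tuple l x) = scale_tuple l (givens c s x).
Proof.
have [a [b [v ->]]] := cons_pair_surj x.
rewrite givensE /cons_pair/= !scale_tuple_cons.
rewrite -[cons_tuple (l * a) _]/(cons_pair ((l * a, l * b), scale_tuple l v)).
rewrite givensE /cons_pair/=; congr cons_tuple; first by ring.
by congr cons_tuple; ring.
Qed.

(** A linear isometry of R^n that preserves the iterated Lebesgue integral;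
    an isometry that commutes with scaling fixes the origin and so is linear. *)
Definition volume_isometry n (rho : n.-tuple R -> n.-tuple R) : Prop :=
  [/\ measurable_fun setT rho,
      (forall f : n.-tuple R -> \bar R, (forall x, 0 <= f x)%E ->
        measurable_fun setT f ->
        tuple_integral (fun x => f (rho x)) = tuple_integral f),
      (forall x y, distsq (rho x) (rho y) = distsq x y) &
      (forall c x, rho (scale_tuple c x) = scale_tuple c (rho x))].

Lemma volume_isometry_comp n (rho1 rho2 : n.-tuple R -> n.-tuple R) :
  volume_isometry rho1 -> volume_isometry rho2 ->
  volume_isometry (rho1 \o rho2).
Proof.
move=> [m1 i1 d1 s1] [m2 i2 d2 s2]; split => [|f f0 mf|x y|c x] /=.
- exact: measurableT_comp.
- by rewrite (i2 (fun x => f (rho1 x))) ?i1//; exact: measurableT_comp.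
- by rewrite d1 d2.
- by rewrite s2 s1.
Qed.

Lemma volume_isometry_cons n (rho : n.-tuple R -> n.-tuple R) :
  volume_isometry rho -> volume_isometry
    (fun x : n.+1.-tuple R => cons_tuple (thead x) (rho (behead_tuple x))).
Proof.
move=> [m i d s]; split => [|f f0 mf|x y|c x].
- apply: measurable_cons; first exact: measurable_tnth.
  by apply: (measurableT_comp m); exact: measurable_behead.
- apply: eq_integral => a _.
  have fa0 v : (0 <= f (cons_tuple a v))%E by [].
  apply: (etrans _ (i (fun v => f (cons_tuple a v)) fa0 (measurable_cons_section a mf))).
  rewrite /=; congr tuple_integral; apply/funext => v; congr f; congr cons_tuple.
  by congr rho; apply/val_inj.
- case: (tupleP x) => a v; case: (tupleP y) => b v'.
  rewrite !distsq_cons !theadE; congr (_ + _).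
  by rewrite -[RHS]d; congr distsq; congr rho; apply/val_inj.
- case: (tupleP x) => a v; rewrite !scale_tuple_cons !theadE; congr cons_tuple.
  have E b (w : n.-tuple R) : behead_tuple (cons_tuple b w) = w by apply/val_inj.
  by rewrite !E s.
Qed.

Lemma volume_isometry_opp1 :
  volume_isometry (fun x : 1.-tuple R => scale_tuple (-1) x).
Proof.
split => [|f f0 mf|x y|c x].
- apply/measurable_fun_tnthP => i.
  apply: (eq_measurable_fun (fun x : 1.-tuple R => -1 * tnth x i)).
    by move=> x _; rewrite /= tnth_mktuple.
  by apply: measurable_funM => //; exact: measurable_tnth.
- rewrite /= -[RHS]integral_oppr//; last first.
    by apply: measurableT_comp => //; exact: (@measurable_cons _ _ _ _ id 0 (cst [tuple])).
  apply: eq_integral => a _; congr f; rewrite scale_tuple_cons mulN1r.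
  by rewrite (tuple0 (scale_tuple _ _)).
- by apply: eq_bigr => i _; rewrite !tnth_mktuple -mulrBr exprMn sqrrN expr1n mul1r.
- by apply: eq_from_tnth => i; rewrite !tnth_mktuple mulrCA.
Qed.

(** Volume-preserving linear isometries act transitively on spheres: a product
    of rotations of pairs of adjacent coordinates brings any vector to the first
    coordinate axis. *)
Lemma volume_isometry_axis n (x : n.-tuple R) :
  exists2 rho, volume_isometry rho &
    rho x = axis_tuple n (Num.sqrt (normsq x)).
Proof.
elim: n x => [|n IH] x.
  exists id; last by rewrite (tuple0 x) (tuple0 (axis_tuple _ _)).
  by split.
case: (tupleP x) => a v; case: n IH v {x} => [|n] IH v.
  have E : normsq (cons_tuple a v) = a ^+ 2.
    by rewrite normsq_cons /normsq big_ord0 addr0.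
  have V (w : 0.-tuple R) : w = v by rewrite (tuple0 w) (tuple0 v).
  rewrite E sqrtr_sqr; have [a0|a0] := leP 0 a.
    exists id; first by split.
    by rewrite axis_tupleS ger0_norm// (V (axis_tuple 0 0)).
  exists (scale_tuple (-1)); first exact: volume_isometry_opp1.
  rewrite scale_tuple_cons axis_tupleS mulN1r ltr0_norm//.
  by rewrite (V (axis_tuple 0 0)) (V (scale_tuple _ _)).
have [rho rhoP rhov] := IH v.
set b := Num.sqrt (normsq v) in rhov.
set r := Num.sqrt _.
have rE : r ^+ 2 = a ^+ 2 + b ^+ 2.
  by rewrite /r /b !sqr_sqrtr ?normsq_ge0// normsq_cons.
have [c [s [cs ca sb]]] : exists c s, [/\ c ^+ 2 + s ^+ 2 = 1,
    c * a + s * b = r & - s * a + c * b = 0].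
  have [r0|r0] := eqVneq r 0.
    have : a ^+ 2 + b ^+ 2 == 0 by rewrite -rE r0 expr0n.
    rewrite paddr_eq0 ?sqr_ge0// !sqrf_eq0 => /andP[/eqP -> /eqP ->].
    by exists 1, 0; rewrite r0; split; ring.
  exists (a / r), (b / r); split.
  - by rewrite !exprMn -mulrDl -rE -exprMn divff// expr1n.
  - rewrite mulrAC (mulrAC b) -mulrDl -!expr2 -rE expr2 -mulrA divff ?mulr1//.
  - by field.
exists (givens c s \o (fun x : n.+2.-tuple R =>
  cons_tuple (thead x) (rho (behead_tuple x)))).
  apply: volume_isometry_comp; last exact: volume_isometry_cons.
  split => [|f f0 mf|y z|l y].
  - exact: measurable_givens.
  - exact: tuple_integral_givens.
  - exact: distsq_givens.
  - exact: scale_givens.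
rewrite /= theadE.
have -> : behead_tuple (cons_tuple a v) = v by apply/val_inj.
rewrite rhov !axis_tupleS.
rewrite -[cons_tuple a _]/(cons_pair ((a, b), axis_tuple n 0)).
by rewrite givensE ca sb.
Qed.

End tuple_geometry.

(** * Measurability on spaces of tuples *)

Section tuple_measurability.
Context {R : realType}.

Lemma measurable_tuple_forall n (B : 'I_n -> set R) :
  (forall i, measurable (B i)) ->
  measurable [set x : n.-tuple R | forall i, B i (tnth x i)].
Proof.
move=> mB.
have -> : [set x : n.-tuple R | forall i, B i (tnth x i)] =
    \bigcap_(i in [set: 'I_n]) ((fun x => tnth x i) @^-1` B i).
  by apply/seteqP; split => x /= H i; [move=> _|]; exact: H.
apply: fin_bigcap_measurable => // i _.
by rewrite -[X in measurable X]setTI; apply: measurable_tnth.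
Qed.

Lemma measurable_sum_ord n d (T : measurableType d) (f : 'I_n -> T -> R) :
  (forall i, measurable_fun setT (f i)) ->
  measurable_fun setT (fun x => \sum_(i < n) f i x).
Proof. by move=> mf; apply: measurable_sum. Qed.

Lemma measurable_normsq n : measurable_fun setT (@normsq R n).
Proof.
apply: measurable_sum_ord => i; apply: measurable_funX.
exact: measurable_tnth.
Qed.

Lemma measurable_distsq n :
  measurable_fun setT (fun p : n.-tuple R * n.-tuple R => distsq p.1 p.2).
Proof.
apply: measurable_sum_ord => i; apply: measurable_funX; apply: measurable_funB.
  exact: (measurableT_comp (measurable_tnth i) measurable_fst).
exact: (measurableT_comp (measurable_tnth i) measurable_snd).
Qed.

Lemma measurable_scale_tuple n c : measurable_fun setT (@scale_tuple R n c).
Proof.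
apply/measurable_fun_tnthP => i.
apply: (eq_measurable_fun (fun x => c * tnth x i)).
  by move=> x _; rewrite /= tnth_mktuple.
by apply: measurable_funM => //; exact: measurable_tnth.
Qed.

Lemma measurable_normsq_eq n (r : R) :
  measurable [set x : n.-tuple R | normsq x = r].
Proof.
rewrite (_ : [set _ | _] = setT `&` normsq (n := n) @^-1` [set r]).
  exact: measurable_normsq.
by rewrite setTI.
Qed.

End tuple_measurability.

(** * Orthants generate the product sigma-algebra *)

Section orthants.
Context {R : realType} {n : nat}.

(** The lower orthants, which form a pi-system. *)
Definition orthant (c : 'I_n -> R) : set (n.-tuple R) :=
  [set x | forall i, tnth x i < c i].

Definition orthants : set (set (n.-tuple R)) := range orthant.

Lemma measurable_orthant c : measurable (orthant c).
Proof.
apply: (@measurable_tuple_forall _ _ (fun i => [set x | x < c i])) => i.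
by rewrite -set_itvNyo; exact: measurable_itv.
Qed.

Lemma orthants_setI : setI_closed orthants.
Proof.
move=> _ _ [c _ <-] [c' _ <-]; exists (fun i => Num.min (c i) (c' i)) => //.
apply/seteqP; split => x /=.
  by move=> H; split => i; have := H i; rewrite lt_min => /andP[].
by move=> [H H'] i; rewrite lt_min H H'.
Qed.

(** Finitely many conditions that hold eventually hold simultaneously. *)
Lemma near_le_nat (P : 'I_n -> nat -> Prop) :
  (forall i, \forall m \near \oo, P i m) -> exists m, forall i, P i m.
Proof.
move=> H.
have : \forall m \near \oo, forall i, P i m by exact: filter_forall.
by case=> N _ HN; exists N; apply: HN => /=.
Qed.

Lemma near_nat_gt (x : R) : \forall m \near \oo, x < m%:R.
Proof. exact: nbhs_infty_gtr. Qed.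

Lemma orthants_cover : \bigcup_m orthant (fun=> m%:R) = setT.
Proof.
apply/seteqP; split => // x _.
have [m Hm] := @near_le_nat (fun i m => tnth x i < m%:R)
  (fun i => near_nat_gt (tnth x i)).
by exists m.
Qed.

Lemma orthants_generate : @measurable _ (n.-tuple R) = <<s orthants >>.
Proof.
apply/seteqP; split; last first.
  apply: smallest_sub; first exact: sigma_algebra_measurable.
  by move=> _ [c _ <-]; exact: measurable_orthant.
move=> A mA.
suff mid : measurable_fun setT (id : g_sigma_algebraType orthants -> n.-tuple R).
  by have := mid measurableT _ mA; rewrite setTI.
apply/measurable_fun_tnthP => i.
apply: (measurability _ (RGenInftyO.measurableE R)) => //.
move=> _ [_ [c ->] <-]; rewrite setTI.
rewrite (_ : _ @^-1` _ =
   \bigcup_m orthant (fun j => if j == i then c else m%:R)).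
  apply: bigcupT_measurable => m; apply: sub_sigma_algebra.
  by exists (fun j => if j == i then c else m%:R).
apply/seteqP; split => x /=; rewrite in_itv/=.
  move=> xc; have [m Hm] := @near_le_nat (fun i m => tnth x i < m%:R)
    (fun i => near_nat_gt (tnth x i)).
  by exists m => // j; have [->//|_] := eqVneq j i.
by move=> [m _ /(_ i)]; rewrite eqxx.
Qed.

(** A finite measure is determined by its values on orthants. *)
Lemma measure_eq_orthants (m1 m2 : {measure set (n.-tuple R) -> \bar R}) :
  (m1 setT < +oo)%E -> (forall c, m1 (orthant c) = m2 (orthant c)) ->
  forall B, measurable B -> m1 B = m2 B.
Proof.
move=> m1oo m12 B mB.
apply: (measure_unique orthants (fun m => orthant (fun=> m%:R))) => //.
- exact: orthants_generate.
- exact: orthants_setI.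
- by move=> m; exists (fun=> m%:R).
- exact: orthants_cover.
- by move=> _ [c _ <-].
- move=> m; apply: le_lt_trans m1oo; apply: le_measure; rewrite ?inE//.
  exact: measurable_orthant.
Qed.

End orthants.

(** * Uniqueness of the uniform distribution on the sphere *)

Section spherical_uniqueness.
Context {R : realType} {n : nat}.
Local Notation T := (n.-tuple R).
Local Open Scope ereal_scope.

(** The unit sphere, as a set of tuples. *)
Definition unit_sphere : set T := [set x | normsq x = 1%R].

(** The open ball of squared radius r. *)
Definition sq_ball (x : T) (r : R) : set T := [set y | (distsq x y < r)%R].

(** A probability carried by the unit sphere for which the mass of a ball
    centred on the sphere depends only on its radius. *)
Definition ball_uniform (P : probability T R) : Prop :=
  P unit_sphere = 1 /\
  forall x y r, unit_sphere x -> unit_sphere y ->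
    P (sq_ball x r) = P (sq_ball y r).

(** The pairs of points whose squared distance is less than r. *)
Let D r : set (T * T) := [set p | (distsq p.1 p.2 < r)%R].

Let mD r : measurable (D r).
Proof.
rewrite (_ : D r = setT `&`
  (fun p : T * T => distsq p.1 p.2) @^-1` `]-oo, r[%classic).
  by apply: measurable_distsq => //; exact: measurable_itv.
by apply/seteqP; split => p; rewrite /D/= in_itv/=; [split|case].
Qed.

Lemma measurable_sq_ball x r : measurable (sq_ball x r).
Proof.
rewrite (_ : sq_ball x r = xsection (D r) x); first exact: measurable_xsection.
by apply/seteqP; split => y; rewrite /xsection /= inE.
Qed.

Lemma measurable_unit_sphere : measurable unit_sphere.
Proof. exact: measurable_normsq_eq. Qed.

(** The mass of the pairs at squared distance less than r with first point in E:
    almost every x lies on the sphere, where its ball has a constant mass. *)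
Let integral_ball (P Q : probability T R) (E : set T) (x0 : T) r :
  measurable E -> ball_uniform P -> ball_uniform Q -> unit_sphere x0 ->
  \int[P]_x \int[Q]_y (\1_(D r `&` E `*` setT) (x, y))%:E =
  P E * Q (sq_ball x0 r).
Proof.
move=> mE [PS _] [_ Qu] Sx0.
have mDE : measurable (D r `&` E `*` setT).
  by apply: measurableI => //; exact: measurableX.
transitivity (\int[P]_x (Q (sq_ball x0 r) * (\1_E x)%:E)); last first.
  rewrite ge0_integralZl//; last exact/measurable_EFinP/measurable_indic.
  by rewrite integral_indic// setIT muleC.
have mS := measurable_unit_sphere.
have PS0 : P (~` unit_sphere) = 0 by rewrite probability_setC// PS subee.
have in1 x : \int[Q]_y (\1_(D r `&` E `*` setT) (x, y))%:E =
    Q (sq_ball x r) * (\1_E x)%:E.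
  transitivity (\int[Q]_y (\1_(sq_ball x r) y * \1_E x)%:E).
    apply: eq_integral => y _; congr EFin.
    rewrite indicI/=; congr (_ * _)%R.
    rewrite !indicE; congr ((nat_of_bool _)%:R).
    by apply/idP/idP; rewrite !inE/= => // -[].
  under eq_integral do rewrite EFinM muleC.
  rewrite ge0_integralZl//.
  - rewrite integral_indic//; first by rewrite setIT muleC.
    exact: measurable_sq_ball.
  - by apply/measurable_EFinP/measurable_indic; exact: measurable_sq_ball.
apply: ae_eq_integral => //.
- apply: (measurable_fun_fubini_tonelli_F (m2 := Q)
    (fun p => (\1_(D r `&` E `*` setT) p)%:E)) => //.
  exact/measurable_EFinP/measurable_indic.
- apply: emeasurable_funM => //; exact/measurable_EFinP/measurable_indic.
exists (~` unit_sphere); split.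
- exact: measurableC.
- exact: PS0.
- move=> x /= H Sx; apply: H => _.
  by rewrite in1 (Qu x x0).
Qed.

(** The mass of the pairs at squared distance less than r with first point in E,
    computed by integrating in either order. *)
Lemma ball_uniform_transfer (P Q : probability T R) (E E' : set T) (x0 : T) r :
  ball_uniform P -> ball_uniform Q -> measurable E -> measurable E' ->
  unit_sphere x0 ->
  (forall x y, E x -> (distsq x y < r)%R -> E' y) ->
  P E * Q (sq_ball x0 r) <= Q E' * P (sq_ball x0 r).
Proof.
move=> Pu Qu mE mE' Sx0 EE'.
rewrite -integral_ball// -(integral_ball _ mE' Qu Pu Sx0).
have mDE (F : set T) : measurable F -> measurable (D r `&` F `*` setT).
  by move=> mF; apply: measurableI => //; exact: measurableX.
pose f (p : T * T) := (\1_(D r `&` E `*` setT) p : R)%:E.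
pose g (p : T * T) := (\1_(D r `&` E' `*` setT) (p.2, p.1) : R)%:E.
have mf : measurable_fun setT f by apply/measurable_EFinP/measurable_indic; exact: mDE.
have mg : measurable_fun setT g.
  apply/measurable_EFinP.
  apply: (measurableT_comp (measurable_indic (mDE _ mE'))).
  exact/measurable_fun_pair.
rewrite -(fubini_tonelli (m1 := P) (m2 := Q) g mg); last first.
  by move=> p; rewrite lee_fin.
apply: ge0_le_integral => //.
- by move=> x _; apply: integral_ge0 => y _; rewrite lee_fin.
- by apply: (measurable_fun_fubini_tonelli_F (m2 := Q) f) => // p; rewrite lee_fin.
- by apply: (measurable_fun_fubini_tonelli_F (m2 := Q) g) => // p; rewrite lee_fin.
move=> x _; apply: ge0_le_integral => //.
- by apply: (measurableT_comp mf); exact: measurable_pair1.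
- by apply: (measurableT_comp mg); exact: measurable_pair1.
move=> y _; rewrite lee_fin /f /g !indicE ler_nat.
have [|//] := boolP ((x, y) \in _).
rewrite inE => -[Dxy [Ex _]]; rewrite mem_set//.
split; first by rewrite /D /= distsqC.
by split => //; exact: (EE' x).
Qed.

(** The sphere is covered by countably many small cubes, each of which is
    contained in a ball of squared radius r centred at any of its points; if such
    balls were null, the sphere would be null. *)
Lemma ball_uniform_gt0 (P : probability T R) (x : T) r :
  ball_uniform P -> unit_sphere x -> (0 < r)%R -> 0 < P (sq_ball x r).
Proof.
move=> [PS Pu] Sx r0; rewrite lt0e measure_ge0 andbT; apply/eqP => Px0.
have mS := measurable_unit_sphere.
(* a cube with this side has a squared diameter n r / (n + 1) < r *)
pose eta := Num.sqrt (r / n.+1%:R).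
have eta2 : (eta ^+ 2 = r / n.+1%:R)%R by rewrite sqr_sqrtr// divr_ge0// ltW.
have eta0 : (0 < eta)%R by rewrite sqrtr_gt0 divr_gt0.
pose cell (c : n.-tuple int) : set T := [set y | forall i,
  ((tnth c i)%:~R * eta <= tnth y i < (tnth c i + 1)%:~R * eta)%R].
have mcell c : measurable (cell c).
  apply: (@measurable_tuple_forall _ _ (fun i => [set y : R |
    ((tnth c i)%:~R * eta <= y < (tnth c i + 1)%:~R * eta)%R])) => i.
  have := @measurable_itv R
    `[((tnth c i)%:~R * eta)%R, ((tnth c i + 1)%:~R * eta)%R[.
  by congr measurable; apply/seteqP; split => y /=; rewrite in_itv.
have cell_small c y z : cell c y -> cell c z -> (distsq y z < r)%R.
  move=> cy cz; apply: (@le_lt_trans _ _ (\sum_(i < n) eta ^+ 2)%R).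
    apply: ler_sum => i _; rewrite -[leLHS]real_normK ?num_real//.
    rewrite lerXn2r ?nnegrE ?normr_ge0 ?(ltW eta0)//.
    have /andP[y1 y2] := cy i; have /andP[z1 z2] := cz i.
    rewrite ler_norml; move: y1 y2 z1 z2; rewrite intrD mulrDl mul1r.
    by move=> *; apply/andP; split; lra.
  rewrite sumr_const card_ord eta2 -[ltLHS]mulr_natr mulrAC ltr_pdivrMr//.
  by rewrite ltr_pM2l// ltr_nat.
have cell_null c : P (cell c `&` unit_sphere) = 0.
  apply/eqP; rewrite eq_le measure_ge0 andbT.
  have [->|/set0P[y [cy Sy]]] := eqVneq (cell c `&` unit_sphere) set0.
    by rewrite measure0.
  rewrite -Px0 (Pu x y)//; apply: le_measure; rewrite ?inE//.
  - exact: measurableI.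
  - exact: measurable_sq_ball.
  - by move=> z [cz _]; exact: cell_small cy cz.
pose F m := if unpickle m is Some c then cell c `&` unit_sphere else set0.
have : P.-negligible (\bigcup_m F m).
  apply: negligible_bigcup => m; rewrite /F; case: unpickle => [c|].
    by apply/negligibleP; [exact: measurableI|exact: cell_null].
  exact: negligible_set0.
have -> : \bigcup_m F m = unit_sphere.
  apply/seteqP; split => [y [m _]|y Sy]; rewrite /F.
    by case: unpickle => // c [].
  pose c : n.-tuple int := [tuple Num.floor (tnth y i / eta) | i < n].
  exists (pickle c) => //; rewrite pickleK; split => // i.
  rewrite tnth_mktuple -ler_pdivlMr// -ltr_pdivrMr//.
  by rewrite floor_itv.
move/negligibleP => /(_ mS) PS0.
have : 1 = 0 :> \bar R by rewrite -PS; exact: PS0.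
by move/eqP; rewrite onee_eq0.
Qed.

(** A ball-uniform probability of E is at most any other one of a neighbourhood
    of E; for E = setT the transfer shows that balls have the same mass. *)
Lemma ball_uniform_le (P Q : probability T R) (E E' : set T) (x0 : T) r :
  ball_uniform P -> ball_uniform Q -> measurable E -> measurable E' ->
  unit_sphere x0 -> (0 < r)%R ->
  (forall x y, E x -> (distsq x y < r)%R -> E' y) -> P E <= Q E'.
Proof.
move=> Pu Qu mE mE' Sx0 r0 EE'.
have h (P1 Q1 : probability T R) : ball_uniform P1 -> ball_uniform Q1 ->
    Q1 (sq_ball x0 r) <= P1 (sq_ball x0 r).
  move=> P1u Q1u.
  have := @ball_uniform_transfer P1 Q1 setT setT x0 r P1u Q1u measurableT
    measurableT Sx0 (fun _ _ _ _ => I).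
  by rewrite !probability_setT !mul1e.
have PQ : P (sq_ball x0 r) = Q (sq_ball x0 r).
  by apply/eqP; rewrite eq_le !h.
have := ball_uniform_transfer Pu Qu mE mE' Sx0 EE'; rewrite PQ.
have Q0 := ball_uniform_gt0 Qu Sx0 r0.
have mB := measurable_sq_ball x0 r.
rewrite lee_pmul2r// ge0_fin_numE ?measure_ge0//.
by rewrite (le_lt_trans (probability_le1 _ _))// ltry.
Qed.

(** A ball-uniform probability is unique: an orthant is the increasing union of
    orthants of which it is a neighbourhood. *)
Theorem ball_uniform_unique (P Q : probability T R) :
  ball_uniform P -> ball_uniform Q ->
  forall B, measurable B -> P B = Q B.
Proof.
move=> Pu Qu.
have [x0 Sx0] : exists x0, unit_sphere x0.
  apply/set0P/eqP => S0; have := Pu.1.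
  by rewrite S0 measure0 => /eqP; rewrite eq_sym onee_eq0.
have le c (P1 Q1 : probability T R) : ball_uniform P1 -> ball_uniform Q1 ->
    P1 (orthant c) <= Q1 (orthant c).
  move=> P1u Q1u.
  pose F (m : nat) := orthant (fun i => c i - m.+1%:R^-1)%R.
  have mF m : measurable (F m) by exact: measurable_orthant.
  have UF : \bigcup_m F m = orthant c.
    apply/seteqP; split => [x [m _ Fx] i|x cx].
      by apply: (lt_le_trans (Fx i)); rewrite lerBlDr lerDl.
    have [m Hm] := @near_le_nat _ (fun i m => m.+1%:R^-1 < c i - tnth x i)%R
      (fun i => near_infty_natSinv_lt
        (PosNum (eq_ind_r is_true (cx i) (subr_gt0 _ _)))).
    by exists m => // i; have /= := Hm i; rewrite !ltrBrDr addrC.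
  have ndF : nondecreasing_seq F.
    move=> m m' mm'; apply/subsetPset => x Fx i; apply: (lt_le_trans (Fx i)).
    by rewrite lerD2l lerN2 lef_pV2 ?posrE// ler_nat ltnS.
  have := nondecreasing_cvg_mu (mu := P1) mF
    (bigcup_measurable (fun m _ => mF m)) ndF.
  rewrite UF => cvgF.
  rewrite -(cvg_lim _ cvgF)//; apply: lime_le.
    by apply/cvg_ex; exists (P1 (orthant c)).
  apply: nearW => m /=.
  apply: (@ball_uniform_le P1 Q1 _ _ x0 (m.+1%:R^-1 ^+ 2)%R) => //.
    exact: measurable_orthant.
  move=> x y Fx xy i; have := Fx i.
  suff : (`|tnth x i - tnth y i| < m.+1%:R^-1)%R.
    by move: (m.+1%:R^-1)%R => e; rewrite ltr_norml => /andP[]; lra.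
  rewrite -(@ltr_pXn2r _ 2)// ?nnegrE ?invr_ge0// real_normK ?num_real//.
  apply: le_lt_trans xy; rewrite /distsq (bigD1 i)//= lerDl.
  by apply: sumr_ge0 => j _; exact: sqr_ge0.
apply: measure_eq_orthants.
  by apply: (le_lt_trans (probability_le1 P measurableT)); exact: ltry.
by move=> c; apply/eqP; rewrite eq_le !le.
Qed.

End spherical_uniqueness.

(** * Coordinatewise squares *)

Section square_tuples.
Context {R : realType}.
Local Notation mu := (@lebesgue_measure R).
Local Open Scope ereal_scope.

(** The vector of the squared coordinates, and the sum of the coordinates. *)
Definition square_tuple n (x : n.-tuple R) : n.-tuple R :=
  [tuple (tnth x i ^+ 2)%R | i < n].

Definition sumt n (x : n.-tuple R) : R := (\sum_i tnth x i)%R.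

(** The density of x ^ 2 for x distributed along Lebesgue measure, and its
    product over the coordinates; it vanishes outside the open orthant. *)
Definition isqrt (y : R) : R := if (0 < y)%R then (y `^ (- 2^-1))%R else 0%R.

Definition isqrt_tuple n (y : n.-tuple R) : R := (\prod_i isqrt (tnth y i))%R.

Lemma isqrt_ge0 y : (0 <= isqrt y)%R.
Proof. by rewrite /isqrt; case: ifP => // _; exact: powR_ge0. Qed.

Lemma isqrt_tuple_ge0 n (y : n.-tuple R) : (0 <= isqrt_tuple y)%R.
Proof. by apply: prodr_ge0 => i _; exact: isqrt_ge0. Qed.

Lemma measurable_isqrt : measurable_fun setT isqrt.
Proof.
by apply: measurable_fun_ifT => //=; exact: measurable_fun_ltr.
Qed.

Lemma measurable_isqrt_tuple n : measurable_fun setT (@isqrt_tuple n).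
Proof.
apply: measurable_prod => i _.
exact: (measurableT_comp measurable_isqrt (measurable_tnth i)).
Qed.

Lemma measurable_sumt n : measurable_fun setT (@sumt n).
Proof. by apply: measurable_sum_ord => i; exact: measurable_tnth. Qed.

Lemma measurable_square_tuple n : measurable_fun setT (@square_tuple n).
Proof.
apply/measurable_fun_tnthP => i.
apply: (eq_measurable_fun (fun x : n.-tuple R => (tnth x i ^+ 2)%R)).
  by move=> x _; rewrite /= tnth_mktuple.
by apply: measurable_funX; exact: measurable_tnth.
Qed.

Lemma square_tuple_cons n a (v : n.-tuple R) :
  square_tuple (cons_tuple a v) = cons_tuple (a ^+ 2)%R (square_tuple v).
Proof.
apply: eq_from_tnth => i; rewrite tnth_mktuple.
by case: (unliftP ord0 i) => [j ->|->]; rewrite ?tnth0 ?tnthS ?tnth_mktuple.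
Qed.

Lemma isqrt_tuple_cons n a (v : n.-tuple R) :
  isqrt_tuple (cons_tuple a v) = (isqrt a * isqrt_tuple v)%R.
Proof.
rewrite /isqrt_tuple big_ord_recl tnth0; congr (_ * _)%R.
by apply: eq_bigr => i _; rewrite tnthS.
Qed.

Lemma normsqE n (x : n.-tuple R) : normsq x = sumt (square_tuple x).
Proof. by apply: eq_bigr => i _; rewrite tnth_mktuple. Qed.

Lemma integral_square_isqrt (f : R -> \bar R) :
  measurable_fun setT f -> (forall x, 0 <= f x) ->
  \int[mu]_x f (x ^+ 2)%R = \int[mu]_y ((isqrt y)%:E * f y).
Proof.
move=> mf f0; rewrite integral_square// integral_mkcond.
apply: eq_integral => y _; rewrite patchE /isqrt.
have -> : (y \in [set y : R | (0 < y)%R]) = (0 < y)%R by apply/idP/idP; rewrite inE.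
by case: ifP => // _; rewrite mul0e.
Qed.

(** The substitution y = x ^ 2 in every coordinate. *)
Lemma tuple_integral_square n (f : n.-tuple R -> \bar R) :
  (forall x, 0 <= f x) -> measurable_fun setT f ->
  tuple_integral (fun x => f (square_tuple x)) =
  tuple_integral (fun y => (isqrt_tuple y)%:E * f y).
Proof.
elim: n f => [|n IH] f f0 mf.
  rewrite /= /isqrt_tuple big_ord0 mul1e; congr f.
  by rewrite (tuple0 (square_tuple _)).
pose F (y : R) := tuple_integral (fun v => (isqrt_tuple v)%:E * f (cons_tuple y v)).
have m1 : measurable_fun setT (fun p : R * n.-tuple R => (isqrt_tuple p.2)%:E).
  by apply/measurable_EFinP; apply: (measurableT_comp (@measurable_isqrt_tuple n)).
have m2 : measurable_fun setT (fun p : R * n.-tuple R => f (cons_tuple p.1 p.2)).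
  by apply: (measurableT_comp mf); exact: measurable_cons_tuple.
have mF : measurable_fun setT F.
  apply: (@measurable_fun_tuple_integral _ n _ _ (fun p : R * n.-tuple R =>
    (isqrt_tuple p.2)%:E * f (cons_tuple p.1 p.2))) => //.
    by move=> p; rewrite mule_ge0// lee_fin isqrt_tuple_ge0.
  exact: emeasurable_funM.
have F0 y : 0 <= F y.
  by apply: tuple_integral_ge0 => v; rewrite mule_ge0// lee_fin isqrt_tuple_ge0.
transitivity (\int[mu]_x F (x ^+ 2)%R).
  apply: eq_integral => x _.
  have fx0 v : 0 <= f (cons_tuple (x ^+ 2)%R v) by [].
  apply: (etrans _ (IH (fun v => f (cons_tuple (x ^+ 2)%R v)) fx0
    (measurable_cons_section _ mf))).
  by congr tuple_integral; apply/funext => v; rewrite square_tuple_cons.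
rewrite integral_square_isqrt//; apply: eq_integral => y _.
rewrite /F -tuple_integralZl ?lee_fin ?isqrt_ge0//.
- by congr tuple_integral; apply/funext => v; rewrite isqrt_tuple_cons EFinM muleA.
- by move=> v; rewrite mule_ge0// lee_fin isqrt_tuple_ge0.
- apply: emeasurable_funM; last exact: measurable_cons_section.
  by apply/measurable_EFinP; exact: measurable_isqrt_tuple.
Qed.

Lemma tuple_integral_prod n (g : R -> R) :
  (forall x, 0 <= g x)%R -> measurable_fun setT g ->
  tuple_integral (fun x : n.-tuple R => (\prod_i g (tnth x i))%:E) =
  (\int[mu]_x (g x)%:E) ^+ n.
Proof.
move=> g0 mg; elim: n => [|n IH]; first by rewrite /= big_ord0.
rewrite expeS muleC -ge0_integralZl//; last 3 first.
- by apply/measurable_EFinP.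
- by move=> x _; rewrite lee_fin.
- by apply: expe_ge0; apply: integral_ge0 => x _; rewrite lee_fin.
apply: eq_integral => x _; rewrite -IH muleC -tuple_integralZl ?lee_fin//.
- congr tuple_integral; apply/funext => v.
  rewrite big_ord_recl tnth0 EFinM; congr (_ * _%:E).
  by apply: eq_bigr => i _; rewrite tnthS.
- by move=> v; rewrite lee_fin prodr_ge0.
- apply/measurable_EFinP; apply: measurable_prod => i _.
  exact: (measurableT_comp mg (measurable_tnth i)).
Qed.

End square_tuples.

(** * Simplex coordinates *)

Section simplex_coordinates.
Context {R : realType}.
Local Notation mu := (@lebesgue_measure R).
Local Open Scope ereal_scope.

Lemma tuple_integral_scale n (s : R) (f : n.-tuple R -> \bar R) : (0 < s)%R ->
  (forall x, 0 <= f x) -> measurable_fun setT f ->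
  tuple_integral f =
  (s ^+ n)%:E * tuple_integral (fun x => f (scale_tuple s x)).
Proof.
move=> s0; elim: n f => [|n IH] f f0 mf.
  by rewrite expr0 mul1e /=; congr f; rewrite (tuple0 (scale_tuple _ _)).
have sn0 : (0 <= s ^+ n)%R by rewrite exprn_ge0// ltW.
pose F (y : R) := tuple_integral (fun v => f (cons_tuple y v)).
have mF : measurable_fun setT F by exact: measurable_tuple_integral_cons.
have F0 y : 0 <= F y by exact: tuple_integral_ge0.
transitivity (\int[mu]_x F x) => //.
rewrite (@integral_affine _ s 0)// ?gt_eqF// gtr0_norm// exprS EFinM -muleA.
congr (_ * _).
rewrite [RHS](_ : _ = (s ^+ n)%:E * \int[mu]_x tuple_integral
   (fun v => f (cons_tuple (s * x)%R (scale_tuple s v)))); last first.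
  congr (_ * _); apply: eq_integral => x _; congr tuple_integral.
  by apply/funext => v; rewrite scale_tuple_cons.
rewrite -ge0_integralZl//.
- apply: eq_integral => x _; rewrite addr0 /F; apply: IH => //.
  exact: measurable_cons_section.
- apply: (@measurable_fun_tuple_integral _ n _ _ (fun p : R * n.-tuple R =>
    f (cons_tuple (s * p.1)%R (scale_tuple s p.2)))) => //.
  apply: (measurableT_comp mf); apply: measurable_cons.
    exact: measurable_funM.
  exact: (measurableT_comp (measurable_scale_tuple s)).
- by move=> x _; apply: tuple_integral_ge0.
Qed.

(** The last barycentric coordinate is determined by the others. *)
Definition simplex_rcons n (p : n.-tuple R) : n.+1.-tuple R :=
  rcons_tuple p (1 - sumt p)%R.

Lemma simplex_pointE n (p : n.-tuple R) :
  @simplex_point R n.+1 p = simplex_rcons p.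
Proof.
apply: eq_from_tnth => i; rewrite tnth_mktuple (tnth_nth 0%R)/= nth_rcons size_tuple.
case: ifPn => // ni; rewrite ifT//.
by rewrite eqn_leq -ltnS ltn_ord/= leqNgt.
Qed.

Lemma tnth_rcons_max n (p : n.-tuple R) z : tnth (rcons_tuple p z) ord_max = z.
Proof. by rewrite (tnth_nth 0%R)/= nth_rcons size_tuple ltnn eqxx. Qed.

Lemma tnth_rcons_widen n (p : n.-tuple R) z (i : 'I_n) :
  tnth (rcons_tuple p z) (widen_ord (leqnSn n) i) = tnth p i.
Proof. by rewrite !(tnth_nth 0%R)/= nth_rcons size_tuple ltn_ord. Qed.

Lemma sumt_rcons n (p : n.-tuple R) z : sumt (rcons_tuple p z) = (sumt p + z)%R.
Proof.
rewrite /sumt big_ord_recr/= tnth_rcons_max; congr (_ + _)%R.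
by apply: eq_bigr => i _; rewrite tnth_rcons_widen.
Qed.

Lemma sumt_simplex n (p : n.-tuple R) : sumt (simplex_rcons p) = 1%R.
Proof. by rewrite sumt_rcons addrC subrK. Qed.

Lemma scale_simplex n s (p : n.-tuple R) :
  scale_tuple s (simplex_rcons p) =
  rcons_tuple (scale_tuple s p) (s - sumt (scale_tuple s p))%R.
Proof.
apply: eq_from_tnth => i; rewrite tnth_mktuple.
case: (unliftP ord_max i) => [j ->|->].
  have -> : lift ord_max j = widen_ord (leqnSn n) j by apply/val_inj; exact: lift_max.
  by rewrite !tnth_rcons_widen tnth_mktuple.
rewrite !tnth_rcons_max mulrBr mulr1 /sumt mulr_sumr; congr (_ - _)%R.
by apply: eq_bigr => k _; rewrite tnth_mktuple.
Qed.

Lemma measurable_rcons_tuple n :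
  measurable_fun setT (fun q : n.-tuple R * R => rcons_tuple q.1 q.2).
Proof.
apply/measurable_fun_tnthP => i.
case: (unliftP ord_max i) => [j ->|->].
  have -> : lift ord_max j = widen_ord (leqnSn n) j by apply/val_inj; exact: lift_max.
  apply: (eq_measurable_fun (fun q : n.-tuple R * R => tnth q.1 j)).
    by move=> q _; rewrite /= tnth_rcons_widen.
  exact: (measurableT_comp (measurable_tnth j)).
apply: (eq_measurable_fun (fun q : n.-tuple R * R => q.2)).
  by move=> q _; rewrite /= tnth_rcons_max.
exact: measurable_snd.
Qed.

Lemma measurable_simplex_rcons n : measurable_fun setT (@simplex_rcons n).
Proof.
have mH : measurable_fun setT (fun p : n.-tuple R => (p, 1 - sumt p)%R).
  apply/measurable_fun_pair => //; apply: measurable_funB => //.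
  exact: measurable_sumt.
exact: (measurableT_comp (@measurable_rcons_tuple n) mH).
Qed.

(** Polar decomposition with respect to the coordinate sum. *)
Lemma tuple_integral_simplex n (f : n.+1.-tuple R -> \bar R) :
  (forall x, 0 <= f x) -> measurable_fun setT f ->
  (forall x, (sumt x <= 0)%R -> f x = 0) ->
  tuple_integral f = \int[mu]_(s in [set s : R | (0 < s)%R])
    ((s ^+ n)%:E * tuple_integral (fun p => f (scale_tuple s (simplex_rcons p)))).
Proof.
move=> f0 mf fneg.
pose G (p : R * n.-tuple R) := f (rcons_tuple p.2 (p.1 - sumt p.2)%R).
have mG : measurable_fun setT G.
  have mH : measurable_fun setT (fun p : R * n.-tuple R => (p.2, p.1 - sumt p.2)%R).
    apply/measurable_fun_pair => //; apply: measurable_funB => //.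
    exact: (measurableT_comp (@measurable_sumt _ n)).
  exact: (measurableT_comp mf (measurableT_comp (@measurable_rcons_tuple n) mH)).
transitivity (tuple_integral (fun v => \int[mu]_s G (s, v))).
  rewrite tuple_integral_rcons; congr tuple_integral; apply/funext => v.
  rewrite -(@integral_shift _ (- sumt v)%R (fun z => f (rcons_tuple v z)))//.
  apply: (measurableT_comp mf).
  exact: (measurableT_comp (@measurable_rcons_tuple n) (measurable_pair1 _)).
have G0 p : 0 <= G p by exact: f0.
apply: (etrans (esym (tuple_integral_swap mu G0 mG))).
rewrite [RHS]integral_mkcond; apply: eq_integral => s _; rewrite patchE.
have -> : (s \in [set s : R | (0 < s)%R]) = (0 < s)%R by apply/idP/idP; rewrite inE.
case: ifPn => s0.
  rewrite (@tuple_integral_scale _ s)//.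
    congr (_ * _); congr tuple_integral; apply/funext => v.
    by rewrite scale_simplex.
  apply: (measurableT_comp mG); exact: measurable_pair1.
rewrite (_ : (fun v => _) = fun=> 0).
  elim: n {f f0 mf fneg G mG G0} => [//|n IH] /=.
  by apply: integral0_eq => x _.
apply/funext => v; rewrite /G fneg// sumt_rcons addrC subrK.
by rewrite leNgt.
Qed.

End simplex_coordinates.

(** * The direction of a Gaussian vector *)

Section gaussian_direction.
Context {R : realType} {n : nat}.
Local Notation T := (n.+1.-tuple R).
Local Notation mu := (@lebesgue_measure R).
Local Open Scope ereal_scope.

(** The direction of a nonzero vector. *)
Definition direction (x : T) : T := scale_tuple (Num.sqrt (normsq x))^-1 x.

(** The Gaussian weight, set to 0 at the origin, where there is no direction. *)
Definition gauss_weight (x : T) : R :=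
  if (0 < normsq x)%R then expR (- normsq x) else 0%R.

Lemma gauss_weight_ge0 x : (0 <= gauss_weight x)%R.
Proof. by rewrite /gauss_weight; case: ifP => // _; exact: expR_ge0. Qed.

Lemma measurable_gauss_weight : measurable_fun setT gauss_weight.
Proof.
have mN := @measurable_normsq R n.+1.
apply: measurable_fun_ifT => //=; first exact: measurable_fun_ltr.
by apply: measurableT_comp => //; exact: measurableT_comp.
Qed.

Lemma measurable_direction : measurable_fun setT direction.
Proof.
have mN := @measurable_normsq R n.+1.
apply/measurable_fun_tnthP => i.
apply: (eq_measurable_fun (fun x : T => (Num.sqrt (normsq x))^-1 * tnth x i)%R).
  by move=> x _; rewrite /= tnth_mktuple.
apply: measurable_funM; last exact: measurable_tnth.
apply: (eq_measurable_fun (fun x : T => normsq x `^ (- 2^-1))%R).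
  by move=> x _; rewrite powRN powR12_sqrt// normsq_ge0.
exact: (measurableT_comp (measurable_powR _) mN).
Qed.

Lemma normsq_direction (x : T) : (0 < normsq x)%R -> normsq (direction x) = 1%R.
Proof.
move=> x0; rewrite normsq_scale exprVn sqr_sqrtr ?ltW// mulVf//.
by rewrite gt_eqF.
Qed.

(** The mass of the Gaussian weight. *)
Lemma tuple_integral_gauss_weight :
  tuple_integral (fun x : T => (gauss_weight x)%:E) =
  (Num.sqrt pi ^+ n.+1)%:E.
Proof.
pose f (y : T) : \bar R := (expR (- sumt y) * (0 < sumt y)%R%:R)%:E.
pose g (y : T) : \bar R := (expR (- sumt y))%:E.
have mg : measurable_fun setT g.
  apply/measurable_EFinP; apply: measurableT_comp => //.
  by apply: measurableT_comp => //; exact: measurable_sumt.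
have mf : measurable_fun setT f.
  apply/measurable_EFinP; apply: measurable_funM; first exact/measurable_EFinP.
  apply: (eq_measurable_fun (fun y : T => if (0 < sumt y)%R then 1%R else 0%R : R)).
    by move=> y _; case: ifP.
  apply: measurable_fun_ifT => //=; apply: measurable_fun_ltr => //.
  exact: measurable_sumt.
transitivity (tuple_integral (fun x : T => f (square_tuple x))).
  congr tuple_integral; apply/funext => x.
  by rewrite /f -normsqE /gauss_weight; case: ifP => _; rewrite ?mulr1 ?mulr0.
rewrite tuple_integral_square//; last first.
  by move=> y; rewrite lee_fin mulr_ge0// expR_ge0.
transitivity (tuple_integral (fun y : T => (isqrt_tuple y)%:E * g y)).
  congr tuple_integral; apply/funext => y; rewrite /f /g.
  have [s0|s0] := ltP 0%R (sumt y); first by rewrite mulr1.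
  rewrite mulr0 mule0 (_ : isqrt_tuple y = 0%R) ?mul0e//.
  have [i yi] : exists i, (tnth y i <= 0)%R.
    apply/not_existsP => H; move: s0; rewrite leNgt => /negP; apply.
    rewrite /sumt big_ord_recl ltr_wpDr//.
      by apply: sumr_ge0 => j _; rewrite leNgt; apply/negP => /ltW /H.
    by rewrite ltNge; apply/negP => /H.
  by rewrite /isqrt_tuple (bigD1 i)//= /isqrt ltNge yi/= mul0r.
rewrite -tuple_integral_square//; last by move=> y; rewrite lee_fin expR_ge0.
rewrite [RHS]EFin_expe -integralT_gauss.
apply: (etrans _ (tuple_integral_prod _ gauss_fun_ge0 measurable_gauss_fun)).
congr tuple_integral; apply/funext => x.
by rewrite /g /gauss_fun -expR_sum -normsqE /normsq sumrN.
Qed.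

Let Z : R := (Num.sqrt pi ^+ n.+1)%R.

Let Z0 : (0 < Z)%R.
Proof. by rewrite exprn_gt0// sqrtr_gt0 pi_gt0. Qed.

(** Averaging over directions with the normalised Gaussian weight. *)
Let L (f : T -> \bar R) : \bar R :=
  Z^-1%:E * tuple_integral (fun x => (gauss_weight x)%:E * f (direction x)).

Let mgd (f : T -> \bar R) : measurable_fun setT f ->
  measurable_fun setT (fun x => (gauss_weight x)%:E * f (direction x)).
Proof.
move=> mf; apply: emeasurable_funM.
  by apply/measurable_EFinP; exact: measurable_gauss_weight.
exact: (measurableT_comp mf measurable_direction).
Qed.

Let gd0 (f : T -> \bar R) : (forall x, 0 <= f x) ->
  forall x, 0 <= (gauss_weight x)%:E * f (direction x).
Proof. by move=> f0 x; rewrite mule_ge0// lee_fin gauss_weight_ge0. Qed.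

Let L0 : L (fun=> 0) = 0.
Proof.
rewrite /L -tuple_integralZl//.
- transitivity (0 * tuple_integral (fun x : T => (gauss_weight x)%:E)).
    rewrite -tuple_integralZl//.
    + by congr tuple_integral; apply/funext => x; rewrite mule0 mule0 mul0e.
    + by move=> x; rewrite lee_fin gauss_weight_ge0.
    + by apply/measurable_EFinP; exact: measurable_gauss_weight.
  by rewrite mul0e.
- by rewrite lee_fin invr_ge0 ltW.
- by move=> x; rewrite mule0.
- exact: (@mgd (fun=> 0) (measurable_cst _)).
Qed.

Let L_ge0 f : (forall x, 0 <= f x) -> 0 <= L f.
Proof.
move=> f0; rewrite /L mule_ge0//; first by rewrite lee_fin invr_ge0 ltW.
by apply: tuple_integral_ge0; exact: gd0.
Qed.

Let L_series (f : nat -> T -> \bar R) : (forall i x, 0 <= f i x) ->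
  (forall i, measurable_fun setT (f i)) ->
  L (fun x => \sum_(i <oo) f i x) = \sum_(i <oo) L (f i).
Proof.
move=> f0 mf; rewrite /L.
rewrite nneseriesZl; last by move=> i _; by apply: tuple_integral_ge0; exact: gd0.
congr (_ * _); rewrite -tuple_integral_nneseries.
- congr tuple_integral; apply/funext => x; rewrite nneseriesZl//.
- by move=> i; exact: gd0.
- by move=> i; exact: mgd.
Qed.

(** The law of the direction of a Gaussian vector. *)
Definition gauss_direction : set T -> \bar R := functional_measure L.

HB.instance Definition _ := Measure.copy gauss_direction
  (measure_of_functional L0 L_ge0 L_series).

Let gauss_directionT : gauss_direction setT = 1.
Proof.
rewrite /gauss_direction /functional_measure /L.
transitivity (Z^-1%:E * tuple_integral (fun x : T => (gauss_weight x)%:E)).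
  congr (_ * _); congr tuple_integral; apply/funext => x.
  by rewrite diracT mule1.
by rewrite tuple_integral_gauss_weight -EFinM mulVf// gt_eqF.
Qed.

HB.instance Definition _ := Measure_isProbability.Build _ _ _
  gauss_direction gauss_directionT.

Lemma gauss_directionE B : gauss_direction B =
  (Num.sqrt pi ^+ n.+1)^-1%:E *
  tuple_integral (fun x : T => (gauss_weight x)%:E * \d_(direction x) B).
Proof. by []. Qed.

Lemma normsq_isometry (rho : T -> T) (x : T) :
  volume_isometry rho -> normsq (rho x) = normsq x.
Proof. by move=> [_ _ d s]; rewrite !normsq_dist0 -s d. Qed.

(** Every point of the sphere is moved to the first axis by a volume-preserving
    isometry, which leaves the Gaussian weight invariant. *)
Lemma ball_uniform_gauss_direction : ball_uniform gauss_direction.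
Proof.
split.
  rewrite -gauss_directionT !gauss_directionE; congr (_ * _).
  congr tuple_integral; apply/funext => x; rewrite /gauss_weight.
  case: ifPn => x0; last by rewrite !mul0e.
  by rewrite diracT diracE mem_set// /unit_sphere/= normsq_direction.
have axis x r : unit_sphere x -> gauss_direction (sq_ball x r) =
    gauss_direction (sq_ball (axis_tuple n.+1 1) r).
  rewrite /unit_sphere/= => Sx.
  have [rho rhoP] := volume_isometry_axis x; rewrite Sx sqrtr1 => rhox.
  have [mrho irho drho srho] := rhoP.
  rewrite !gauss_directionE; congr (_ * _).
  rewrite -[RHS]irho.
  - congr tuple_integral; apply/funext => y.
    have Ny : normsq (rho y) = normsq y by exact: normsq_isometry.
    rewrite /gauss_weight Ny; congr (_ * _).
    rewrite !diracE; congr ((nat_of_bool _)%:R%:E).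
    have -> : direction (rho y) = rho (direction y).
      by rewrite /direction Ny srho.
    by apply/idP/idP; rewrite !inE /sq_ball/= -rhox drho.
  - by move=> u; rewrite mule_ge0// lee_fin gauss_weight_ge0.
  - apply: (@mgd (fun u => \d_u (sq_ball (axis_tuple n.+1 1) r))).
    by apply: measurable_fun_dirac; exact: measurable_sq_ball.
by move=> x y r Sx Sy; exact: (etrans (axis x r Sx) (esym (axis y r Sy))).
Qed.

End gaussian_direction.

(** * The Gamma function *)

Section gamma_function.
Context {R : realType}.
Local Notation mu := (@lebesgue_measure R).
Local Open Scope ereal_scope.

(** The integral of the Gamma function, as an extended real. *)
Definition gamma_integral (a : R) : \bar R :=
  \int[mu]_(x in [set x : R | (0 < x)%R]) (x `^ (a - 1) * expR (- x))%:E.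

Lemma gamma_integral_ge0 a : 0 <= gamma_integral a.
Proof. by apply: integral_ge0 => x _; rewrite lee_fin mulr_ge0 ?powR_ge0 ?expR_ge0. Qed.

Lemma GammaE (a : R) : Gamma a = fine (gamma_integral a).
Proof. by rewrite /Gamma /Rintegral /gamma_integral set_itvoy. Qed.

Lemma gamma_integral_half : gamma_integral 2^-1 = (Num.sqrt pi)%:E.
Proof.
rewrite -integralT_gauss.
pose f (y : R) := (expR (- y))%:E.
have mf : measurable_fun setT f.
  by apply/measurable_EFinP; apply: measurableT_comp.
have f0 y : 0 <= f y by rewrite lee_fin expR_ge0.
apply: (etrans _ (esym (integral_square mf f0))).
apply: eq_integral => y _; rewrite EFinM; congr (_%:E * _).
by congr powR; lra.
Qed.

Lemma Gamma_half : Gamma 2^-1 = Num.sqrt pi :> R.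
Proof. by rewrite GammaE gamma_integral_half. Qed.

End gamma_function.

(** * The squares of a Gaussian direction *)

Section gauss_direction_squares.
Context {R : realType} {n : nat}.
Local Notation T := (n.+1.-tuple R).
Local Notation mu := (@lebesgue_measure R).
Local Open Scope ereal_scope.

Lemma square_direction (x : T) : (0 < normsq x)%R ->
  square_tuple (direction x) =
  scale_tuple (sumt (square_tuple x))^-1 (square_tuple x).
Proof.
move=> x0; apply: eq_from_tnth => i; rewrite !tnth_mktuple -normsqE exprMn.
by rewrite exprVn sqr_sqrtr ?ltW.
Qed.

Lemma isqrtM (s y : R) : (0 < s)%R -> isqrt (s * y) = (isqrt s * isqrt y)%R.
Proof.
move=> s0; rewrite /isqrt s0 pmulr_rgt0//; case: ifPn => y0; rewrite ?mulr0//.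
by rewrite powRM// ltW.
Qed.

Lemma isqrt_tuple_scale m (s : R) (y : m.-tuple R) : (0 < s)%R ->
  isqrt_tuple (scale_tuple s y) = (isqrt s ^+ m * isqrt_tuple y)%R.
Proof.
move=> s0; rewrite /isqrt_tuple.
under eq_bigr do rewrite tnth_mktuple isqrtM//.
by rewrite big_split/= prodr_const card_ord.
Qed.

Lemma sumt_scale m (s : R) (y : m.-tuple R) :
  sumt (scale_tuple s y) = (s * sumt y)%R.
Proof. by rewrite /sumt mulr_sumr; apply: eq_bigr => i _; rewrite tnth_mktuple. Qed.

(** The squared coordinates of a uniform direction follow the Dirichlet
    distribution with all parameters 1/2. *)
Lemma gauss_direction_square (B : set T) : measurable B ->
  @gauss_direction R n (@square_tuple R n.+1 @^-1` B) =
  (Gamma 2^-1 ^+ n.+1)^-1%:E * (gamma_integral (n.+1%:R / 2) *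
  tuple_integral (fun p : n.-tuple R =>
    (isqrt_tuple (simplex_rcons p))%:E * \d_(simplex_rcons p) B)).
Proof.
move=> mB; rewrite gauss_directionE Gamma_half; congr (_ * _).
pose f (y : T) : \bar R := (expR (- sumt y) * (0 < sumt y)%R%:R)%:E *
  \d_(scale_tuple (sumt y `^ (- 1))%R y) B.
have f0 y : 0 <= f y by rewrite mule_ge0// lee_fin mulr_ge0// expR_ge0.
have ms := @measurable_sumt R n.+1.
have mf : measurable_fun setT f.
  apply: emeasurable_funM.
    apply/measurable_EFinP; apply: measurable_funM.
      by apply: measurableT_comp => //; exact: measurableT_comp.
    apply: (eq_measurable_fun (fun y : T => if (0 < sumt y)%R then 1%R else 0%R : R)).
      by move=> y _; case: ifP.
    by apply: measurable_fun_ifT => //=; exact: measurable_fun_ltr.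
  apply: (measurableT_comp (measurable_fun_dirac mB)).
  apply/measurable_fun_tnthP => i.
  apply: (eq_measurable_fun (fun y : T => (sumt y) `^ (- 1) * tnth y i)%R).
    by move=> y _; rewrite /= tnth_mktuple.
  apply: measurable_funM; last exact: measurable_tnth.
  exact: (measurableT_comp (measurable_powR _) ms).
transitivity (tuple_integral (fun x : T => f (square_tuple x))).
  congr tuple_integral; apply/funext => x.
  rewrite /f -normsqE /gauss_weight; case: ifPn => x0; last by rewrite mulr0 !mul0e.
  rewrite mulr1; congr (_ * _); rewrite !diracE; congr ((nat_of_bool _)%:R%:E).
  rewrite powR_inv1 ?normsq_ge0// normsqE -square_direction//.
rewrite tuple_integral_square//.
rewrite tuple_integral_simplex; last 3 first.
- by move=> y; rewrite mule_ge0// lee_fin isqrt_tuple_ge0.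
- apply: emeasurable_funM => //.
  by apply/measurable_EFinP; exact: measurable_isqrt_tuple.
- by move=> y y0; rewrite /f ltNge y0/= mulr0 mul0e mule0.
pose J := tuple_integral (fun p : n.-tuple R =>
    (isqrt_tuple (simplex_rcons p))%:E * \d_(simplex_rcons p) B).
have mJ : measurable_fun setT (fun p : n.-tuple R =>
    (isqrt_tuple (simplex_rcons p))%:E * \d_(simplex_rcons p) B).
  apply: emeasurable_funM.
    apply/measurable_EFinP.
    exact: (measurableT_comp (@measurable_isqrt_tuple R _) (@measurable_simplex_rcons R n)).
  exact: (measurableT_comp (measurable_fun_dirac mB) (@measurable_simplex_rcons R n)).
have J0 p : 0 <= (isqrt_tuple (@simplex_rcons R n p))%:E * \d_(simplex_rcons p) B.
  by rewrite mule_ge0// lee_fin isqrt_tuple_ge0.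
have JJ : 0 <= J by exact: tuple_integral_ge0.
rewrite -/J muleC /gamma_integral.
have mg : measurable_fun setT (fun x : R =>
    (x `^ (n.+1%:R / 2 - 1) * expR (- x))%:E).
  apply/measurable_EFinP; apply: measurable_funM; first exact: measurable_powR.
  by apply: measurableT_comp.
have g0 (x : R) : 0 <= (x `^ (n.+1%:R / 2 - 1) * expR (- x))%:E.
  by rewrite lee_fin mulr_ge0 ?powR_ge0 ?expR_ge0.
rewrite -ge0_integralZl//; last 2 first.
- by rewrite /= -set_itvoy; exact: measurable_itv.
- exact: measurable_funTS.
apply: eq_integral => s; rewrite inE/= => s0.
transitivity ((s ^+ n)%:E * ((isqrt s ^+ n.+1 * expR (- s))%:E * J)).
  congr (_ * _); rewrite -tuple_integralZl//; last first.
    by rewrite lee_fin mulr_ge0 ?expR_ge0// exprn_ge0// isqrt_ge0.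
  congr tuple_integral; apply/funext => p.
  have -> : f (scale_tuple s (simplex_rcons p)) =
      (expR (- s))%:E * \d_(simplex_rcons p) B.
    rewrite /f sumt_scale sumt_simplex mulr1 s0 mulr1 powR_inv1 ?ltW//.
    congr (_ * \d_ _ B); apply: eq_from_tnth => i.
    by rewrite !tnth_mktuple mulrA mulVf ?mul1r// gt_eqF.
  by rewrite isqrt_tuple_scale// !EFinM -!muleA; congr (_ * _); rewrite muleCA.
rewrite muleA -EFinM [RHS]muleC; congr (_%:E * _).
rewrite mulrA; congr (_ * _)%R.
rewrite /isqrt s0 -powR_mulrn ?ltW// -powR_mulrn ?powR_ge0// -powRrM -powRD; last first.
  by rewrite (gt_eqF s0) implybT.
congr powR; rewrite -[n.+1%:R]natr1; move: (n%:R : R) => z; lra.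
Qed.

End gauss_direction_squares.

(** * Orthogonal matrices *)

Section colv_geometry.
Context {R : realType} {k : nat}.
Implicit Types x y : k.-tuple R.

Lemma colvK x : tupv (colv x) = x.
Proof. by apply: eq_from_tnth => i; rewrite tnth_mktuple mxE. Qed.

Lemma tupvK (x : 'cV[R]_k) : colv (tupv x) = x.
Proof. by apply/colP => i; rewrite mxE tnth_mktuple. Qed.

Lemma dotE (x y : 'cV[R]_k) : (x^T *m y) 0 0 = \sum_i x i 0 * y i 0.
Proof. by rewrite mxE; apply: eq_bigr => i _; rewrite mxE. Qed.

Lemma normsq_colv x : normsq x = ((colv x)^T *m colv x) 0 0.
Proof. by rewrite dotE; apply: eq_bigr => i _; rewrite !mxE expr2. Qed.

Lemma distsq_colv x y :
  distsq x y = ((colv x - colv y)^T *m (colv x - colv y)) 0 0.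
Proof. by rewrite dotE; apply: eq_bigr => i _; rewrite !mxE expr2. Qed.

Lemma distsq_orthogonal (Q : 'M[R]_k) x y : Q^T *m Q = 1%:M ->
  distsq (tupv (Q *m colv x)) (tupv (Q *m colv y)) = distsq x y.
Proof.
move=> QQ; rewrite !distsq_colv !tupvK -mulmxBr trmx_mul.
by rewrite -mulmxA (mulmxA Q^T) QQ mul1mx.
Qed.

(** A reflection exchanging two vectors of the same length. *)
Lemma householder x y : normsq x = normsq y ->
  exists2 Q : 'M[R]_k, Q^T *m Q = 1%:M & Q *m colv x = colv y.
Proof.
move=> xy; have [->|neq] := eqVneq x y.
  by exists 1%:M; rewrite ?trmx1 mul1mx.
pose u := colv x - colv y; pose q := (u^T *m u) 0 0.
have uu : u^T *m u = q%:M by rewrite [LHS]mx11_scalar.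
have q0 : q != 0.
  rewrite /q -distsq_colv; apply: contra neq => /eqP d0.
  apply/eqP/eq_from_tnth => i; apply/eqP; rewrite -subr_eq0 -sqrf_eq0.
  have := d0; rewrite /distsq => /eqP; rewrite psumr_eq0; last first.
    by move=> j _; exact: sqr_ge0.
  by move=> /allP/(_ i); rewrite mem_index_enum => /(_ isT).
pose W := u *m u^T; pose c := 2 / q.
have WW : W *m W = q *: W.
  by rewrite /W mulmxA -(mulmxA u) uu mul_mx_scalar scalemxAl.
have cq : c * c * q = c + c by rewrite -mulrA /c divfK// mulrDr mulr1.
have ux : c * (u^T *m colv x) 0 0 = 1.
  rewrite /c mulrAC; apply: (mulIf q0); rewrite divfK// mul1r.
  apply/eqP; rewrite -subr_eq0; apply/eqP.
  rewrite /q !dotE mulr_sumr -sumrB.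
  transitivity (normsq x - normsq y); last by rewrite xy subrr.
  by rewrite /normsq -sumrB; apply: eq_bigr => i _; rewrite /u !mxE; ring.
exists (1%:M - c *: W).
  have -> : (1%:M - c *: W)^T = 1%:M - c *: W.
    by rewrite linearB/= trmx1 linearZ/= trmx_mul trmxK.
  rewrite mulmxBr mulmx1 mulmxBl mul1mx -scalemxAl -scalemxAr WW.
  by rewrite !scalerA cq scalerDl opprB addrK subrK.
rewrite mulmxBl mul1mx -scalemxAl /W -mulmxA [u^T *m _]mx11_scalar.
by rewrite mul_mx_scalar scalerA ux scale1r /u opprB addrC subrK.
Qed.

End colv_geometry.

(** * Uniform directions are Gaussian directions *)

Section uniform_sphere.
Context {R : realType} {n : nat}.
Local Notation T := (n.+1.-tuple R).
Local Open Scope ereal_scope.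

Lemma uniform_sphere_ball_uniform d (O : measurableType d) (P : probability O R)
    (V : {RV P >-> T}) : uniform_sphere_rv V -> ball_uniform (distribution P V).
Proof.
move=> [VS Vrot]; split; first exact: VS.
rewrite /unit_sphere/= => x y r Sx Sy.
have [Q QQ Qxy] : exists2 Q : 'M[R]_n.+1, Q^T *m Q = 1%:M & Q *m colv x = colv y.
  by apply: householder; rewrite Sx Sy.
rewrite /distribution /pushforward.
rewrite -(Vrot Q QQ _ (measurable_sq_ball y r)).
congr (P _); apply/seteqP; split => o; rewrite /sq_ball/=.
  by rewrite -[y]colvK -Qxy distsq_orthogonal.
by rewrite -[y]colvK -Qxy distsq_orthogonal.
Qed.

(** A uniform direction has the law of the direction of a Gaussian vector. *)
Theorem uniform_sphereE d (O : measurableType d) (P : probability O R)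
    (V : {RV P >-> T}) (B : set T) : uniform_sphere_rv V -> measurable B ->
  P (V @^-1` B) = gauss_direction B.
Proof.
move=> /uniform_sphere_ball_uniform Vu mB.
exact: (ball_uniform_unique Vu ball_uniform_gauss_direction mB).
Qed.

End uniform_sphere.

(** * Random signs *)

Section signs.
Context {R : realType} {k : nat}.
Local Notation T := (k.-tuple R).
Local Notation signs := ({ffun 'I_k -> bool}).
Local Open Scope ereal_scope.

(** Changing the signs of coordinates, and the square roots with prescribed
    signs. *)
Definition flip (e : signs) (x : T) : T :=
  [tuple ((-1) ^+ e i * tnth x i)%R | i < k].

Definition signed_sqrt (e : signs) (x : T) : T :=
  [tuple ((-1) ^+ e i * Num.sqrt (tnth x i))%R | i < k].

Lemma measurable_flip e : measurable_fun setT (flip e).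
Proof.
apply/measurable_fun_tnthP => i.
apply: (eq_measurable_fun (fun x : T => (-1) ^+ e i * tnth x i)%R).
  by move=> x _; rewrite /= tnth_mktuple.
by apply: measurable_funM => //; exact: measurable_tnth.
Qed.

Lemma measurable_signed_sqrt e : measurable_fun setT (signed_sqrt e).
Proof.
apply/measurable_fun_tnthP => i.
apply: (eq_measurable_fun (fun x : T => (-1) ^+ e i * Num.sqrt (tnth x i))%R).
  by move=> x _; rewrite /= tnth_mktuple.
apply: measurable_funM => //.
apply: (measurableT_comp (f := @Num.sqrt R)); last exact: measurable_tnth.
by apply: continuous_measurable_fun; exact: sqrt_continuous.
Qed.

(** A sum over all sign changes depends only on the squared coordinates. *)
Lemma sum_flip_signed_sqrt (F : T -> \bar R) (x : T) :
  \sum_e F (flip e x) = \sum_e F (signed_sqrt e (square_tuple x)).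
Proof.
pose s : signs := [ffun i => (tnth x i < 0)%R].
pose h (e : signs) : signs := [ffun i => e i (+) s i].
have hK : involutive h by move=> e; apply/ffunP => i; rewrite !ffunE addbK.
rewrite (reindex_inj (inv_inj hK)); apply: eq_bigr => e _; congr F.
apply: eq_from_tnth => i; rewrite !tnth_mktuple ffunE sqrtr_sqr signr_addb.
rewrite -mulrA; congr (_ * _)%R; rewrite ffunE.
have [x0|x0] := ltP (tnth x i) 0%R; first by rewrite expr1 mulN1r ltr0_norm.
by rewrite expr0 mul1r ger0_norm.
Qed.

End signs.

Section sign_decomposition.
Context {R : realType}.
Local Open Scope ereal_scope.

Lemma measure_bigcup_finType d (T : measurableType d)
    (m : {measure set T -> \bar R}) (I : finType) (F : I -> set T) :
  (forall i, measurable (F i)) -> trivIset setT F ->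
  m (\bigcup_(i in [set: I]) F i) = \sum_i m (F i).
Proof.
move=> mF tF; have fI : finite_set [set: I] by exact: finite_finset.
rewrite measure_fin_bigcup//.
rewrite [LHS]fsbig_finite//=.
apply: perm_big; apply: uniq_perm; rewrite ?finmap.fset_uniq ?index_enum_uniq//.
by move=> i; rewrite in_fset_set// mem_index_enum; apply/mem_set.
Qed.

Lemma sum_signs k : \sum_(e : {ffun 'I_k -> bool}) ((2^-1 ^+ k)%R%:E : \bar R) = 1.
Proof.
rewrite sumEFin sumr_const card_ffun card_bool card_ord; congr EFin.
by rewrite -[LHS]mulr_natl natrX exprVn divff// expf_neq0.
Qed.

Lemma signs_average k (y : \bar R) : 0 <= y ->
  \sum_(e : {ffun 'I_k -> bool}) ((2^-1 ^+ k)%R%:E * y) = y.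
Proof.
by move=> y0; rewrite -ge0_sume_distrl ?sum_signs ?mul1e.
Qed.

(** Sign changes are orthogonal maps. *)
Lemma flip_diag k (e : {ffun 'I_k -> bool}) : exists2 Q : 'M[R]_k,
  Q^T *m Q = 1%:M & forall x : k.-tuple R, tupv (Q *m colv x) = flip e x.
Proof.
exists (diag_mx (\row_i (-1) ^+ e i)%R).
  rewrite tr_diag_mx mul_diag_mx; apply/matrixP => i j; rewrite !mxE.
  by rewrite mulrnAr -expr2 sqrr_sign.
move=> x; apply: eq_from_tnth => i; rewrite !tnth_mktuple.
by rewrite mul_diag_mx !mxE.
Qed.

(** A uniform direction is obtained from its squares by independent random
    signs, by invariance under sign changes. *)
Lemma uniform_sphere_signs n d (O : measurableType d) (P : probability O R)
    (V : {RV P >-> n.+1.-tuple R}) (B : set (n.+1.-tuple R)) :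
  uniform_sphere_rv V -> measurable B ->
  P (V @^-1` B) = \sum_(e : {ffun 'I_n.+1 -> bool}) ((2^-1 ^+ n.+1)%R%:E *
    @gauss_direction R n (square_tuple (n := n.+1) @^-1` (signed_sqrt e @^-1` B))).
Proof.
move=> Vu mB; have [_ Vrot] := Vu.
have mss e : measurable (signed_sqrt (R := R) (k := n.+1) e @^-1` B).
  by rewrite -[X in measurable X]setTI; apply: measurable_signed_sqrt.
have mfl e : measurable (flip (R := R) (k := n.+1) e @^-1` B).
  by rewrite -[X in measurable X]setTI; apply: measurable_flip.
have msq C : measurable C -> measurable (square_tuple (R := R) (n := n.+1) @^-1` C).
  by move=> mC; rewrite -[X in measurable X]setTI; apply: measurable_square_tuple.
pose G := @gauss_direction R n.
have Gdirac C : measurable C -> G C = \int[G]_x \d_x C.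
  move=> mC; transitivity (\int[G]_x (\1_C x)%:E).
    by rewrite integral_indic// setIT.
  by apply: eq_integral => x _; rewrite diracE indicE.
rewrite -(@signs_average n.+1 (P _))//.
transitivity (\sum_(e : {ffun 'I_n.+1 -> bool})
    ((2^-1 ^+ n.+1)%R%:E * G (flip e @^-1` B))).
  apply: eq_bigr => e _; congr (_ * _).
  have [Q QQ Qe] := flip_diag e.
  rewrite -(Vrot Q QQ B mB).
  apply: (etrans _ (uniform_sphereE Vu (mfl e))).
  by congr (P _); apply/seteqP; split => o /=; rewrite Qe.
have distr (F : {ffun 'I_n.+1 -> bool} -> \bar R) : (forall e, 0 <= F e) ->
    \sum_e ((2^-1 ^+ n.+1)%R%:E * F e) = (2^-1 ^+ n.+1)%R%:E * \sum_e F e.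
  by move=> F0; rewrite ge0_sume_distrr.
rewrite !distr; [|by move=> e; exact: measure_ge0..].
congr (_ * _).
transitivity (\int[G]_x \sum_(e : {ffun 'I_n.+1 -> bool}) \d_(flip e x) B).
  rewrite ge0_integral_sum//.
  - by apply: eq_bigr => e _; rewrite Gdirac.
  - by move=> e; exact: (measurableT_comp (measurable_fun_dirac mB) (measurable_flip e)).
under eq_integral do rewrite (sum_flip_signed_sqrt (fun y => \d_y B)).
rewrite ge0_integral_sum//.
- apply: eq_bigr => e _; rewrite [RHS]Gdirac//; exact: msq.
- move=> e; apply: (measurableT_comp (measurable_fun_dirac mB)).
  exact: (measurableT_comp (measurable_signed_sqrt e) (@measurable_square_tuple R n.+1)).
Qed.

Lemma rademacher_signs k d (O : measurableType d) (P : probability O R)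
    (eps : {RV P >-> k.-tuple R}) (e : {ffun 'I_k -> bool}) :
  rademacher_vector eps ->
  P [set o | forall i, tnth (eps o) i = ((-1) ^+ e i)%R] = (2^-1 ^+ k)%R%:E.
Proof.
move=> [eps_ind eps_val].
have := eps_ind (fun i => [set ((-1) ^+ e i)%R]) (fun i => measurable_set1 _).
rewrite /= => ->.
rewrite (eq_bigr (fun=> (2^-1)%R%:E)) => [|i _].
  elim: k {eps eps_ind eps_val e} => [|m IH]; first by rewrite big_ord0.
  by rewrite big_ord_recl IH exprS EFinM.
have [p m] := eps_val i.
by case: (e i); rewrite ?expr1 ?expr0.
Qed.

(** Independent random signs attached to square roots amount to averaging over
    all sign patterns. *)
Lemma rademacher_symmetrization k d (O : measurableType d) (P : probability O R)
    (D eps : {RV P >-> k.-tuple R}) (B : set (k.-tuple R)) :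
  rademacher_vector eps -> independent_rv P D eps -> measurable B ->
  P ((fun o => [tuple tnth (eps o) i * Num.sqrt (tnth (D o) i) | i < k])%R @^-1` B) =
  \sum_(e : {ffun 'I_k -> bool}) ((2^-1 ^+ k)%R%:E *
    P (D @^-1` (signed_sqrt e @^-1` B))).
Proof.
move=> eps_rad ind mB.
pose E (e : {ffun 'I_k -> bool}) : set (k.-tuple R) :=
  [set x | forall i, tnth x i = ((-1) ^+ e i)%R].
have mE e : measurable (E e).
  by apply: (@measurable_tuple_forall _ _ (fun i => [set ((-1) ^+ e i)%R])).
have mss e : measurable (signed_sqrt (R := R) (k := k) e @^-1` B).
  by rewrite -[X in measurable X]setTI; apply: measurable_signed_sqrt.
have mpre (Y : {RV P >-> k.-tuple R}) C : measurable C -> measurable (Y @^-1` C).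
  by move=> mC; rewrite -[X in measurable X]setTI; apply: measurable_funP.
have PE e : P (eps @^-1` E e) = (2^-1 ^+ k)%R%:E by exact: rademacher_signs.
set Y := (fun o => _).
pose A e := D @^-1` (signed_sqrt e @^-1` B) `&` eps @^-1` E e.
have mA e : measurable (A e) by apply: measurableI; exact: mpre.
have tE : trivIset setT (fun e => eps @^-1` E e).
  move=> e e1 _ _; case=> o [/= oe oe']; apply/ffunP => i.
  have := oe i; rewrite oe'; case: (e i); case: (e1 i) => //=; rewrite expr0 expr1; lra.
have mEU : measurable (\bigcup_(e in [set: {ffun 'I_k -> bool}]) (eps @^-1` E e)).
  by apply: fin_bigcup_measurable => // e _; exact: mpre.
have PUE : P (\bigcup_(e in [set: {ffun 'I_k -> bool}]) (eps @^-1` E e)) = 1.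
  rewrite measure_bigcup_finType//; last by move=> e; exact: mpre.
  by rewrite -[RHS](@sum_signs k); apply: eq_bigr => e _; exact: PE.
have mY : measurable (Y @^-1` B).
  pose Y2 (q : k.-tuple R * k.-tuple R) : k.-tuple R :=
    [tuple tnth q.1 i * Num.sqrt (tnth q.2 i) | i < k]%R.
  have mY2 : measurable_fun setT Y2.
    apply/measurable_fun_tnthP => i.
    apply: (eq_measurable_fun (fun q : k.-tuple R * k.-tuple R =>
        tnth q.1 i * Num.sqrt (tnth q.2 i))%R).
      by move=> x _; rewrite /= tnth_mktuple.
    apply: measurable_funM; first exact: (measurableT_comp (measurable_tnth i)).
    apply: (measurableT_comp (f := @Num.sqrt R)).
      by apply: continuous_measurable_fun; exact: sqrt_continuous.
    exact: (measurableT_comp (measurable_tnth i)).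
  have mDe : measurable_fun setT (fun o => (eps o, D o)).
    by apply/measurable_fun_pair; exact: measurable_funP.
  rewrite -[X in measurable X]setTI.
  exact: (measurableT_comp mY2 mDe).
transitivity (P (\bigcup_(e in [set: {ffun 'I_k -> bool}]) A e)).
  set UE := \bigcup_(e in _) _ in PUE mEU.
  have -> : \bigcup_(e in [set: {ffun 'I_k -> bool}]) A e = Y @^-1` B `&` UE.
    apply/seteqP; split => o.
      move=> [e _ [/= Do eo]]; split; last by exists e.
      rewrite /= /Y; move: Do; congr B; apply: eq_from_tnth => i.
      by rewrite !tnth_mktuple eo.
    move=> [Yo [e _ /= eo]]; exists e => //; split => //=.
    move: Yo; rewrite /= /Y; congr B; apply: eq_from_tnth => i.
    by rewrite !tnth_mktuple eo.
  rewrite -[in LHS](setIT (Y @^-1` B)) -(setUv UE) setIUr measureU//.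
  - rewrite [X in _ + X](_ : _ = 0) ?adde0//.
    apply/eqP; rewrite eq_le measure_ge0 andbT.
    have <- : P (~` UE) = 0 by rewrite probability_setC// PUE subee.
    by apply: le_measure; rewrite ?inE//; [apply: measurableI => //|];
      exact: measurableC.
  - exact: measurableI.
  - by apply: measurableI => //; exact: measurableC.
  - by rewrite setIACA setICr setI0.
rewrite measure_bigcup_finType//.
  apply: eq_bigr => e _; apply: (etrans (ind _ _ (mss e) (mE e))).
  by rewrite PE muleC.
move=> e e1 _ _; case=> o [[_ oe] [_ oe']]; apply: (tE e e1) => //.
by exists o.
Qed.

End sign_decomposition.

(** * The density of the symmetrised Dirichlet law *)

Section angular_density.
Context {R : realType} {n : nat}.
Local Notation T := (n.+1.-tuple R).
Variable alpha : 'I_n.+1 -> R.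

(** The contribution of one coordinate to the Dirichlet density. *)
Definition dirichlet_factor (a y : R) : R :=
  if 0 < y then y `^ (a - 1) else 0.

Lemma measurable_dirichlet_factor a : measurable_fun setT (dirichlet_factor a).
Proof. by apply: measurable_fun_ifT => //=; exact: measurable_fun_ltr. Qed.

Lemma dirichlet_densityE (p : T) : dirichlet_density alpha p =
  Gamma (\sum_i alpha i) / (\prod_i Gamma (alpha i)) *
  \prod_i dirichlet_factor (alpha i) (tnth p i).
Proof.
rewrite /dirichlet_density; case: ifPn => [/forallP p0|].
  by congr (_ * _); apply: eq_bigr => i _; rewrite /dirichlet_factor p0.
rewrite negb_forall => /existsP[i pi]; rewrite [X in _ * X](bigD1 i)//=.
by rewrite /dirichlet_factor (negbTE pi) mul0r mulr0.
Qed.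

Lemma Gamma_ge0 (a : R) : 0 <= Gamma a.
Proof. by rewrite GammaE fine_ge0// gamma_integral_ge0. Qed.

Lemma dirichlet_density_ge0 (p : T) : 0 <= dirichlet_density alpha p.
Proof.
rewrite dirichlet_densityE mulr_ge0 ?divr_ge0 ?Gamma_ge0 ?prodr_ge0//.
  by move=> i _; exact: Gamma_ge0.
by move=> i _; rewrite /dirichlet_factor; case: ifP => // _; exact: powR_ge0.
Qed.

Lemma measurable_dirichlet_density : measurable_fun setT (@dirichlet_density R _ alpha).
Proof.
apply: (eq_measurable_fun (fun p : T =>
  Gamma (\sum_i alpha i) / (\prod_i Gamma (alpha i)) *
  \prod_i dirichlet_factor (alpha i) (tnth p i))).
  by move=> p _; rewrite dirichlet_densityE.
apply: measurable_funM => //; apply: measurable_prod => i _.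
exact: (measurableT_comp (measurable_dirichlet_factor _) (measurable_tnth i)).
Qed.

(** The normalisation of a Dirichlet law forces the values of the Gamma function
    in it to be positive. *)
Lemma dirichlet_Gamma_gt0 d (O : measurableType d) (P : probability O R)
    (D : {RV P >-> T}) : dirichlet_rv alpha D ->
  0 < Gamma (\sum_i alpha i) /\ 0 < \prod_i Gamma (alpha i).
Proof.
move=> /(_ setT measurableT); rewrite preimage_setT probability_setT => E.
set g := Gamma _; set h := \prod_i _.
have gh : g / h != 0.
  apply/eqP => gh0; move/eqP: E; rewrite (_ : (fun x => _) = fun=> 0%E).
    suff -> : forall m, tuple_integral (fun _ : m.-tuple R => 0%E) = 0%E :> \bar R.
      by rewrite onee_eq0.
    by elim=> [//|m IH] /=; apply: integral0_eq => x _.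
  by apply/funext => x; rewrite dirichlet_densityE -/g -/h gh0 mul0r mulr0.
have g0 : 0 <= g by exact: Gamma_ge0.
have h0 : 0 <= h by apply: prodr_ge0 => i _; exact: Gamma_ge0.
move: gh; rewrite mulf_eq0 negb_or invr_eq0 => /andP[gn hn].
by rewrite !lt0r gn hn g0 h0.
Qed.

Lemma Gamma_half_expn_gt0 m : 0 < Gamma 2^-1 ^+ m :> R.
Proof. by rewrite Gamma_half exprn_gt0 ?sqrtr_gt0 ?pi_gt0. Qed.

(** The total mass of the squares of a Gaussian direction is 1, so the Gamma
    integral at half the dimension is neither 0 nor infinite. *)
Lemma Gamma_half_dim : 0 < Gamma (n.+1%:R / 2 : R) /\
  gamma_integral (n.+1%:R / 2) = (Gamma (n.+1%:R / 2 : R))%:E.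
Proof.
have Z0 := Gamma_half_expn_gt0 n.+1.
have := @gauss_direction_square R n setT measurableT.
rewrite preimage_setT probability_setT.
set J := tuple_integral _; set g := gamma_integral _ => E.
have J0 : (0 <= J)%E.
  by apply: tuple_integral_ge0 => p; rewrite mule_ge0// lee_fin isqrt_tuple_ge0.
have g0 : (0 <= g)%E by exact: gamma_integral_ge0.
have gJ : (g * J = (Gamma 2^-1 ^+ n.+1)%:E)%E.
  have : ((Gamma 2^-1 ^+ n.+1)%:E * 1 =
      (Gamma 2^-1 ^+ n.+1)%:E * ((Gamma 2^-1 ^+ n.+1)^-1%:E * (g * J)) :> \bar R)%E.
    by rewrite -E.
  by rewrite mule1 muleA -EFinM divff ?mul1e ?gt_eqF.
have gn : g != 0%E.
  by apply/eqP => g00; move: gJ; rewrite g00 mul0e => -[] /esym/eqP; rewrite gt_eqF.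
have Jn : J != 0%E.
  by apply/eqP => J00; move: gJ; rewrite J00 mule0 => -[] /esym/eqP; rewrite gt_eqF.
rewrite GammaE -/g; move: g0 gn gJ; case: g {E} => [r| |]//.
  by rewrite lee_fin eqe => r0 rn _; rewrite /= lt0r rn r0.
by move=> _ _; rewrite gt0_mulye// lt0e Jn J0.
Qed.

(** The density of the symmetrised Dirichlet law with respect to the uniform
    distribution on the sphere, and its normalising constant. *)
Definition angular_constant : R :=
  Gamma (\sum_i alpha i) * Gamma 2^-1 ^+ n.+1 /
  (Gamma (n.+1%:R / 2) * \prod_i Gamma (alpha i)).

Definition angular_density (v : T) : R :=
  angular_constant * \prod_i `|tnth v i| `^ (2 * alpha i - 1).

(** The Dirichlet density is the angular density at a signed square root, times
    the Dirichlet density for the parameters 1/2. *)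
Lemma dirichlet_angular_density (e : {ffun 'I_n.+1 -> bool}) (q : T) :
  (forall i, 0 < tnth q i) -> dirichlet_density alpha q =
  angular_density (signed_sqrt e q) *
  (Gamma (n.+1%:R / 2) / Gamma 2^-1 ^+ n.+1 * isqrt_tuple q).
Proof.
move=> q0; have [g0 _] := Gamma_half_dim.
have Z0 := Gamma_half_expn_gt0 n.+1.
have E : \prod_i tnth q i `^ (alpha i - 1) =
    (\prod_i `|tnth (signed_sqrt e q) i| `^ (2 * alpha i - 1)) * isqrt_tuple q.
  rewrite /isqrt_tuple -big_split/=; apply: eq_bigr => i _.
  rewrite tnth_mktuple normrM normrX normrN1 expr1n mul1r ger0_norm ?sqrtr_ge0//.
  rewrite /isqrt q0 -powR12_sqrt ?ltW// -powRrM -powRD; last first.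
    by rewrite (gt_eqF (q0 i)) implybT.
  by congr powR; lra.
rewrite /dirichlet_density ifT; last exact/forallP.
rewrite E /angular_density /angular_constant.
set W := \prod_i _ `^ _; rewrite invfM; set ih := (\prod_i Gamma _)^-1.
move: g0 Z0; set g2 := Gamma (_ / 2); set Z := _ ^+ n.+1.
move=> /lt0r_neq0 g0 /lt0r_neq0 Z0.
by field; rewrite g0 Z0.
Qed.

End angular_density.

Section density_comparison.
Context {R : realType} {n : nat}.
Local Notation T := (n.+1.-tuple R).
Local Open Scope ereal_scope.

Variables (alpha : 'I_n.+1 -> R).
Context d (O : measurableType d) (P : probability O R) (U : {RV P >-> T}).
Context d' (O' : measurableType d') (P' : probability O' R) (V : {RV P' >-> T}).
Hypotheses (U_SD : symm_dirichlet_rv alpha U) (V_unif : uniform_sphere_rv V).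

(** The constant of the Dirichlet density with parameters 1/2. *)
Let K : R := (Gamma (n.+1%:R / 2) / Gamma 2^-1 ^+ n.+1)%R.

Let K0 : (0 <= K)%R.
Proof.
have [g0 _] := @Gamma_half_dim R n.
by apply: divr_ge0; apply: ltW => //; exact: Gamma_half_expn_gt0.
Qed.

(** Both laws are averages over sign patterns of integrals over the simplex. *)
Let uniform_law (B : set T) : measurable B ->
  P' (V @^-1` B) = \sum_(e : {ffun 'I_n.+1 -> bool}) ((2^-1 ^+ n.+1)%R%:E *
    tuple_integral (fun p : n.-tuple R => (K * isqrt_tuple (simplex_rcons p))%:E *
      \d_(simplex_rcons p) (signed_sqrt e @^-1` B))).
Proof.
move=> mB; rewrite (uniform_sphere_signs V_unif mB); apply: eq_bigr => e _.
have mss : measurable (signed_sqrt (R := R) (k := n.+1) e @^-1` B).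
  by rewrite -[X in measurable X]setTI; apply: measurable_signed_sqrt.
rewrite gauss_direction_square//; have [_ ->] := @Gamma_half_dim R n.
congr (_ * _); rewrite muleA -EFinM -tuple_integralZl//.
- congr tuple_integral; apply/funext => p.
  by rewrite muleA -EFinM /K [(_^-1 * _)%R]mulrC.
- by rewrite lee_fin mulrC.
- by move=> p; rewrite mule_ge0// lee_fin isqrt_tuple_ge0.
- apply: emeasurable_funM.
    apply/measurable_EFinP.
    exact: (measurableT_comp (@measurable_isqrt_tuple R _) (@measurable_simplex_rcons R n)).
  exact: (measurableT_comp (measurable_fun_dirac mss) (@measurable_simplex_rcons R n)).
Qed.

Let dirichlet_law (B : set T) : measurable B ->
  P (U @^-1` B) = \sum_(e : {ffun 'I_n.+1 -> bool}) ((2^-1 ^+ n.+1)%R%:E *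
    tuple_integral (fun p : n.-tuple R => (dirichlet_density alpha (simplex_rcons p))%:E *
      \d_(simplex_rcons p) (signed_sqrt e @^-1` B))).
Proof.
move=> mB; have [d0 [T0 [P0 [D [eps [Ddir epsrad ind Ulaw]]]]]] := U_SD.
rewrite (Ulaw B mB) (rademacher_symmetrization epsrad ind mB); apply: eq_bigr => e _.
congr (_ * _); rewrite Ddir; last first.
  by rewrite -[X in measurable X]setTI; apply: measurable_signed_sqrt.
congr tuple_integral; apply/funext => p.
by rewrite simplex_pointE mulrC EFinM diracE indicE.
Qed.

Let normsq_signed_sqrt (e : {ffun 'I_n.+1 -> bool}) (q : T) :
  (forall i, 0 < tnth q i)%R -> normsq (signed_sqrt e q) = sumt q.
Proof.
move=> q0; apply: eq_bigr => i _; rewrite tnth_mktuple exprMn sqrr_sign mul1r.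
by rewrite sqr_sqrtr// ltW.
Qed.

Let measurable_u (e : {ffun 'I_n.+1 -> bool}) (B : set T) : measurable B ->
  measurable_fun setT (fun p : n.-tuple R =>
   (dirichlet_density alpha (simplex_rcons p))%:E *
      \d_(simplex_rcons p) (signed_sqrt e @^-1` B)).
Proof.
move=> mB; apply: emeasurable_funM.
  apply/measurable_EFinP.
  exact: (measurableT_comp (measurable_dirichlet_density alpha)
    (@measurable_simplex_rcons R n)).
apply: (measurableT_comp (measurable_fun_dirac _) (@measurable_simplex_rcons R n)).
by rewrite -[X in measurable X]setTI; apply: measurable_signed_sqrt.
Qed.

Let measurable_v (e : {ffun 'I_n.+1 -> bool}) (B : set T) : measurable B ->
  measurable_fun setT (fun p : n.-tuple R =>
   (K * isqrt_tuple (simplex_rcons p))%:E *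
      \d_(simplex_rcons p) (signed_sqrt e @^-1` B)).
Proof.
move=> mB; apply: emeasurable_funM.
  apply/measurable_EFinP; apply: measurable_funM => //.
  exact: (measurableT_comp (@measurable_isqrt_tuple R _)
    (@measurable_simplex_rcons R n)).
apply: (measurableT_comp (measurable_fun_dirac _) (@measurable_simplex_rcons R n)).
by rewrite -[X in measurable X]setTI; apply: measurable_signed_sqrt.
Qed.

Let v_ge0 (e : {ffun 'I_n.+1 -> bool}) (B : set T) (p : n.-tuple R) :
  0 <= (K * isqrt_tuple (simplex_rcons p))%:E *
      \d_(simplex_rcons p) (signed_sqrt e @^-1` B).
Proof. by rewrite mule_ge0// lee_fin mulr_ge0// isqrt_tuple_ge0. Qed.

Let u_ge0 (e : {ffun 'I_n.+1 -> bool}) (B : set T) (p : n.-tuple R) :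
  0 <= (dirichlet_density alpha (simplex_rcons p))%:E *
      \d_(simplex_rcons p) (signed_sqrt e @^-1` B).
Proof. by rewrite mule_ge0// lee_fin dirichlet_density_ge0. Qed.

Let factor (c : R) (G : {ffun 'I_n.+1 -> bool} -> \bar R) : (0 <= c)%R ->
  (forall e, 0 <= G e) ->
  c%:E * \sum_(e : {ffun 'I_n.+1 -> bool}) ((2^-1 ^+ n.+1)%R%:E * G e) =
  \sum_(e : {ffun 'I_n.+1 -> bool}) ((2^-1 ^+ n.+1)%R%:E * (c%:E * G e)).
Proof.
move=> c0 G0; rewrite ge0_sume_distrr; last first.
  by move=> e _; rewrite mule_ge0// lee_fin exprn_ge0// invr_ge0.
by apply: eq_bigr => e _; rewrite muleCA.
Qed.

(** Both densities vanish unless all barycentric coordinates are positive. *)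
Let isqrt0 (p : T) : ~ (forall i, 0 < tnth p i)%R -> isqrt_tuple p = 0%R /\
  dirichlet_density alpha p = 0%R.
Proof.
move=> np; have np' : ~~ [forall i, (0 < tnth p i)%R] by apply/forallP.
split; last by rewrite /dirichlet_density (negbTE np').
move: np'; rewrite negb_forall => /existsP[i pi].
by rewrite /isqrt_tuple (bigD1 i)//= /isqrt (negbTE pi) mul0r.
Qed.

(** Bounds for the angular density on a set compare the probabilities of the
    symmetrised Dirichlet vector U and of the uniform direction V. *)
Lemma symm_dirichlet_le (B : set T) (hi : R) : measurable B -> (0 <= hi)%R ->
  (forall v, B v -> normsq v = 1%R -> (angular_density alpha v <= hi)%R) ->
  P (U @^-1` B) <= hi%:E * P' (V @^-1` B).
Proof.
move=> mB hi0 Bhi; rewrite dirichlet_law// uniform_law// factor//; last first.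
  by move=> e; apply: tuple_integral_ge0 => p; exact: v_ge0.
apply: lee_sum => e _; apply: lee_wpmul2l; first by rewrite lee_fin exprn_ge0// invr_ge0.
rewrite -tuple_integralZl//; last first.
  exact: measurable_v.
apply: le_tuple_integral.
- exact: u_ge0.
- exact: measurable_u.
- by apply: emeasurable_funM => //; exact: measurable_v.
move=> p; rewrite diracE; case: (boolP (_ \in _)); last by rewrite !mule0.
rewrite inE/= => Bv; rewrite !mule1 -EFinM lee_fin.
have [q0|nq] := pselect (forall i, 0 < tnth (simplex_rcons p) i)%R; last first.
  by have [-> ->] := isqrt0 nq; rewrite !mulr0.
rewrite (dirichlet_angular_density alpha e q0) ler_wpM2r//.
  by rewrite mulr_ge0// isqrt_tuple_ge0.
by apply: Bhi => //; rewrite normsq_signed_sqrt// sumt_simplex.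
Qed.

Lemma symm_dirichlet_ge (B : set T) (lo : R) : measurable B -> (0 <= lo)%R ->
  (forall v, B v -> normsq v = 1%R -> (lo <= angular_density alpha v)%R) ->
  lo%:E * P' (V @^-1` B) <= P (U @^-1` B).
Proof.
move=> mB lo0 Blo; rewrite dirichlet_law// uniform_law// factor//; last first.
  by move=> e; apply: tuple_integral_ge0 => p; exact: v_ge0.
apply: lee_sum => e _; apply: lee_wpmul2l; first by rewrite lee_fin exprn_ge0// invr_ge0.
rewrite -tuple_integralZl//; last first.
  exact: measurable_v.
apply: le_tuple_integral.
- by move=> p; rewrite mule_ge0// v_ge0.
- by apply: emeasurable_funM => //; exact: measurable_v.
- exact: measurable_u.
move=> p; rewrite diracE; case: (boolP (_ \in _)); last by rewrite !mule0.
rewrite inE/= => Bv; rewrite !mule1 -EFinM lee_fin.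
have [q0|nq] := pselect (forall i, 0 < tnth (simplex_rcons p) i)%R; last first.
  by have [-> ->] := isqrt0 nq; rewrite !mulr0.
rewrite (dirichlet_angular_density alpha e q0) ler_wpM2r//.
  by rewrite mulr_ge0// isqrt_tuple_ge0.
by apply: Blo => //; rewrite normsq_signed_sqrt// sumt_simplex.
Qed.

End density_comparison.

(** * Tails in the Gumbel domain of attraction *)

Section gumbel_tail.
Context {R : realType}.
Variables F w : R -> R.
Hypotheses (F_lt1 : forall r, F r < 1) (F_nd : {homo F : x y / x <= y}).
Hypotheses (F_cvg : F r @[r --> +oo] --> (1 : R)) (F_0 : F 0 = 0).
Hypotheses (w_pos : forall r, 0 < w r) (F_gumbel : gumbel_mda F w).

Let tail r := 1 - F r.

Let tail_gt0 r : 0 < tail r.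
Proof. by rewrite subr_gt0. Qed.

(** If u w(u) were at most K, then u - K / w(u) would be nonpositive and the tail
    there at least 1, so that the quotient of tails, which tends to expR K, would
    be large. *)
Lemma gumbel_scale_pinfty : u * w u @[u --> +oo] --> +oo.
Proof.
apply/cvgryPge => K0; pose K := Num.max K0 1.
have eK : 0 < expR K + 1 by rewrite addr_gt0 ?expR_gt0.
have H1 : \forall u \near +oo, tail (u + (- K) / w u) / tail u < expR K + 1.
  have := @F_gumbel (- K); rewrite opprK => /cvgrPdist_lt/(_ 1 ltr01).
  apply: filterS => u; rewrite distrC ltr_norml => /andP[_].
  by rewrite ltrBlDl.
have H2 : \forall u \near +oo, tail u < (expR K + 1)^-1.
  have eK' : 0 < (expR K + 1)^-1 by rewrite invr_gt0.
  have := F_cvg => /cvgrPdist_lt/(_ _ eK'); apply: filterS => u.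
  by rewrite ltr_norml => /andP[].
near=> u; rewrite leNgt; apply/negP => uK.
have h1 : tail (u + (- K) / w u) / tail u < expR K + 1 by near: u.
have h2 : tail u < (expR K + 1)^-1 by near: u.
have uK' : u * w u < K by apply: (lt_le_trans uK); rewrite le_max lexx.
have h3 : 1 <= tail (u + (- K) / w u).
  rewrite /tail lerBrDr gerDl -F_0; apply: F_nd.
  by rewrite mulNr subr_le0 ler_pdivlMr// ltW.
move: h1; apply/negP; rewrite -leNgt ler_pdivlMr//.
by apply: le_trans h3; apply: ltW; rewrite -ltr_pdivlMl// mulr1.
Unshelve. all: by end_near. Qed.

(** The tail of a law in the Gumbel domain of attraction varies rapidly. *)
Lemma gumbel_rapid_variation (l : R) : 1 < l ->
  (1 - F (l * u)) / (1 - F u) @[u --> +oo] --> (0 : R).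
Proof.
move=> l1; apply/cvgrPdist_lt => e e0.
(* a choice for which expR (- x) = e / expR 1 < e *)
pose x := 1 - ln e.
have ex : expR (- x) < e.
  rewrite /x opprB expRD lnK ?posrE// gtr_pMr// expR_lt1 ltrN10//.
have H1 : \forall u \near +oo, tail (u + x / w u) / tail u < e.
  have ex' : 0 < e - expR (- x) by rewrite subr_gt0.
  have := @F_gumbel x => /cvgrPdist_lt/(_ _ ex').
  apply: filterS => u; rewrite distrC ltr_norml => /andP[_].
  by rewrite ltrD2r.
have H2 : \forall u \near +oo, x / (l - 1) <= u * w u.
  by have /cvgryPge := gumbel_scale_pinfty; apply.
near=> u.
have h1 : tail (u + x / w u) / tail u < e by near: u.
have h2 : x / (l - 1) <= u * w u by near: u.
rewrite sub0r normrN ger0_norm; last by rewrite divr_ge0 ?ltW// tail_gt0.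
apply: le_lt_trans h1; rewrite ler_pM2r ?invr_gt0 ?subr_gt0//.
rewrite /tail lerD2l lerN2; apply: F_nd.
rewrite ler_pdivrMr ?subr_gt0// in h2.
rewrite -lerBrDl -[X in _ <= _ - X]mul1r -mulrBl ler_pdivrMr//.
by rewrite (_ : _ * w u = u * w u * (l - 1))//; ring.
Unshelve. all: by end_near. Qed.

End gumbel_tail.

(** * Subvectors and submatrices *)

Section selection.
Context {R : realType} {k : nat}.

(** The matrix selecting the coordinates with indices in K. *)
Definition selmx (K : {set 'I_k}) : 'M[R]_(#|K|, k) :=
  rowsub (@enum_val _ (mem K)) 1%:M.

Lemma selmxE (K : {set 'I_k}) i j : selmx K i j = (enum_val i == j)%:R.
Proof. by rewrite !mxE. Qed.

Lemma subv_selmx K (x : 'cV[R]_k) : subv K x = selmx K *m x.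
Proof. by rewrite /selmx mul_rowsub_mx mul1mx. Qed.

Lemma subm_selmx K K' (M : 'M[R]_k) :
  subm K K' M = selmx K *m M *m (selmx K')^T.
Proof.
rewrite /selmx mul_rowsub_mx mul1mx; apply/matrixP => i j; rewrite !mxE.
rewrite (bigD1 (enum_val j))//= !mxE eqxx mulr1 big1 ?addr0// => l lj.
by rewrite !mxE eq_sym (negbTE lj) mulr0.
Qed.

Lemma selmxK K : selmx K *m (selmx K)^T = 1%:M.
Proof.
apply/matrixP => i j; rewrite !mxE (bigD1 (enum_val j))//= !mxE eqxx mulr1.
rewrite big1 ?addr0 => [|l lj]; first by rewrite (inj_eq enum_val_inj).
by rewrite !mxE [_ == l in X in _ * X]eq_sym (negbTE lj) mulr0.
Qed.

Lemma selmx_memP (K : {set 'I_k}) i : i \in K ->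
  exists j, forall x : 'cV[R]_k, (selmx K *m x) j 0 = x i 0.
Proof.
move=> iK; exists (enum_rank_in iK i) => x; rewrite -subv_selmx mxE.
by rewrite enum_rankK_in.
Qed.

Lemma dot_eq0 m (x : 'cV[R]_m) : (x^T *m x) 0 0 = 0 -> x = 0.
Proof.
rewrite dotE => /eqP; rewrite psumr_eq0; last by move=> i _; rewrite -expr2 sqr_ge0.
move=> /allP xx; apply/colP => i; rewrite mxE; apply/eqP.
by have := xx i; rewrite mem_index_enum /= mulf_eq0 orbb => /(_ isT).
Qed.

End selection.

(** * The multipliers of the quadratic programme *)

Section minimal_index.
Context {R : realType} {k : nat}.
Variables (A : 'M[R]_k) (a abar : 'cV[R]_k) (I : {set 'I_k}).
Hypotheses (hA : A \in unitmx) (a_pos : forall i, 0 < a i 0).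
Let Sigma := A^T *m A.
Hypothesis hI : minimal_index_set Sigma a abar I.

Let SII_unit : subm I I Sigma \in unitmx.
Proof.
rewrite -row_free_unit; apply: inj_row_free => x; rewrite subm_selmx => xS.
pose y := A *m (selmx I)^T *m x^T.
have y0 : y = 0.
  apply: dot_eq0; rewrite /y !trmx_mul !trmxK.
  have := congr1 (fun X => (X *m x^T) 0 0) xS; rewrite mul0mx [X in _ = X]mxE.
  by rewrite /Sigma !mulmxA.
have : (selmx I)^T *m x^T = 0.
  by rewrite -[LHS](mulKmx hA) [A *m _]mulmxA -/y y0 mulmx0.
move=> /(congr1 (mulmx (selmx I))); rewrite mulmxA selmxK mul1mx mulmx0.
by move=> /(congr1 trmx); rewrite trmxK trmx0.
Qed.

(** The Kuhn-Tucker multipliers of the programme: a vector supported by the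
    minimal index set, positive there, whose image is the solution. *)
Lemma minimal_index_multiplier : exists z : 'cV[R]_k,
  [/\ A^T *m (A *m z) = abar,
      (forall i, i \in I -> 0 < z i 0) /\ (forall i, i \notin I -> z i 0 = 0),
      exists i, i \in I,
      forall i, a i 0 <= abar i 0 &
      quad_form (invmx (subm I I Sigma)) (subv I a) =
      ((A *m z)^T *m (A *m z)) 0 0].
Proof.
have [I0 aI y0 hJ] := hI.
set y := _ *m _ in y0 hJ.
pose z := (selmx I)^T *m y.
have zI i : i \in I -> 0 < z i 0.
  move=> iI; have [j <-] := @selmx_memP R k I i iI.
  by rewrite /z mulmxA selmxK mul1mx.
have zJ i : i \notin I -> z i 0 = 0.
  move=> iI; rewrite mxE big1// => j _; rewrite mxE selmxE.
  case: eqP => [ji|_]; last by rewrite mul0r.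
  by move: iI; rewrite -ji enum_valP.
have abarI i : i \in I -> abar i 0 = a i 0.
  move=> iI; have [j H] := @selmx_memP R k I i iI.
  by rewrite -!H -!subv_selmx aI.
have Sz : Sigma *m z = abar.
  apply/colP => i; have [iI|iI] := boolP (i \in I).
    have [j H] := @selmx_memP R k I i iI.
    rewrite -!H /z (mulmxA Sigma) 2!(mulmxA (selmx I)).
    rewrite -subm_selmx /y mulmxA mulmxV// mul1mx -aI.
    by rewrite subv_selmx.
  have iJ : i \in (~: I)%SET by rewrite inE.
  have J0 : (~: I)%SET != finset.set0 by apply/set0Pn; exists i.
  have [aJ _] := hJ J0.
  have [j H] := @selmx_memP R k (~: I)%SET i iJ.
  by rewrite -!H /z (mulmxA Sigma) 2!(mulmxA (selmx _)) -subm_selmx -aJ subv_selmx.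
exists z; split => //.
- by rewrite mulmxA.
- by apply/set0Pn.
- move=> i; have [iI|iI] := boolP (i \in I); first by rewrite abarI.
  have iJ : i \in (~: I)%SET by rewrite inE.
  have J0 : (~: I)%SET != finset.set0 by apply/set0Pn; exists i.
  have [_ aJ] := hJ J0.
  have [j H] := @selmx_memP R k (~: I)%SET i iJ.
  by have := aJ j; rewrite !subv_selmx !H.
- have -> : (A *m z)^T *m (A *m z) = z^T *m abar.
    by rewrite trmx_mul -mulmxA (mulmxA A^T) Sz.
  rewrite /quad_form -mulmxA -/y -aI subv_selmx trmx_mul -mulmxA -/z.
  by rewrite !dotE; apply: eq_bigr => i _; rewrite mulrC.
Qed.

End minimal_index.

(** * Geometry of exceedances *)

Section orthant_geometry.
Context {R : realType} {k : nat}.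
Variables (A : 'M[R]_k) (z : 'cV[R]_k) (I : {set 'I_k}).
Hypotheses (zI : forall i, i \in I -> 0 < z i 0)
  (zJ : forall i, i \notin I -> z i 0 = 0) (I_neq0 : exists i, i \in I).
Let v0 := A *m z.
Let abar := A^T *m v0.
Variable nrm : R.
Hypotheses (nrm_gt0 : 0 < nrm) (nrm2 : nrm ^+ 2 = (v0^T *m v0) 0 0).

(** An exceedance in a direction far from that of A z requires a radius
    exceeding the minimal one by a fixed proportion: test the exceedance against
    the multipliers z. *)
Lemma exceedance_far (t v : 'cV[R]_k) (r u eta e : R) :
  0 < r -> 0 < u -> 0 < e < 1 ->
  eta * (\sum_i z i 0) <= e / 3 * nrm ^+ 2 ->
  (forall i, i \in I -> u * (abar i 0 - eta) <= t i 0) ->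
  (forall i, t i 0 < (A^T *m (r *: v)) i 0) ->
  (v^T *m v0) 0 0 <= (1 - e) * nrm ->
  (1 + e / 2) * (u * nrm) < r.
Proof.
move=> r0 u0 /andP[e0 e1] etaz tI tv far.
have dot : r * (v^T *m v0) 0 0 = \sum_i (A^T *m (r *: v)) i 0 * z i 0.
  rewrite -dotE trmx_mul trmxK -mulmxA -/v0 linearZ/= -scalemxAl.
  by rewrite [RHS]mxE.
have nz : nrm ^+ 2 = \sum_i abar i 0 * z i 0.
  by rewrite nrm2 -dotE /abar [(A^T *m v0)^T]trmx_mul trmxK -mulmxA.
have lower : u * (nrm ^+ 2 - eta * \sum_i z i 0) <= r * (v^T *m v0) 0 0.
  rewrite dot nz mulr_sumr -sumrB mulr_sumr; apply: ler_sum => i _.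
  have [iI|iI] := boolP (i \in I); last by rewrite zJ// !mulr0 subrr mulr0.
  rewrite -mulrBl mulrA ler_wpM2r ?(ltW (zI iI))//.
  by rewrite (le_trans (tI i iI))// ltW.
have h1 : u * nrm * (1 - e / 3) <= r * (1 - e).
  rewrite -(@ler_pM2r _ nrm)//.
  apply: (@le_trans _ _ (u * (nrm ^+ 2 - eta * \sum_i z i 0))).
    rewrite [leLHS](_ : _ = u * (nrm ^+ 2 - e / 3 * nrm ^+ 2)); last by ring.
    by rewrite ler_pM2l// lerD2l lerN2.
  by rewrite (le_trans lower)// -mulrA ler_pM2l.
have un : 0 < u * nrm by rewrite mulr_gt0.
have h2 : (1 + e / 2) * (u * nrm) * (1 - e) < u * nrm * (1 - e / 3).
  rewrite [ltLHS](_ : _ = u * nrm * ((1 + e / 2) * (1 - e))); last by ring.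
  by rewrite ltr_pM2l//; nra.
by rewrite -(@ltr_pM2r _ (1 - e)) ?subr_gt0// (lt_le_trans h2 h1).
Qed.

(** Every direction close to v0 / nrm gives an exceedance of thresholds near
    u abar as soon as the radius exceeds the minimal one by a proportion kappa. *)
Lemma exceedance_near (t v : 'cV[R]_k) (r u b kappa rho0 : R) :
  0 < u -> 0 < kappa -> 0 < b -> (forall i, b <= abar i 0) ->
  (1 + kappa) * (rho0 * nrm) <= kappa / 2 * b ->
  (1 + kappa) * (u * nrm) < r ->
  (forall i, `|(A^T *m v) i 0 - abar i 0 / nrm| <= rho0) ->
  (forall i, t i 0 <= u * (abar i 0 + kappa / 2 * b)) ->
  forall i, t i 0 < (A^T *m (r *: v)) i 0.
Proof.
move=> u0 k0 b0 bP rho0P rP vP tP i.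
have ab := bP i; have := vP i; rewrite ler_norml => /andP[vi _].
pose s := abar i 0 / nrm - rho0.
have sv : s <= (A^T *m v) i 0 by rewrite /s; lra.
have sn : s * nrm = abar i 0 - rho0 * nrm.
  by rewrite /s mulrBl divfK// gt_eqF.
have k1 : 0 < 1 + kappa by rewrite addr_gt0.
have rn : (1 + kappa) * (s * nrm) >= abar i 0 + kappa / 2 * b.
  rewrite sn mulrBr.
  have : kappa * b <= kappa * abar i 0 by rewrite ler_pM2l.
  by move: rho0P; set q := (1 + kappa) * (rho0 * nrm); lra.
have s0 : 0 < s.
  rewrite -(pmulr_lgt0 _ nrm_gt0) -(pmulr_rgt0 _ k1).
  apply: lt_le_trans rn; rewrite ltr_pwDl ?(lt_le_trans b0)//.
  by rewrite ltW// mulr_gt0// divr_gt0.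
have r0 : 0 < r by apply: lt_trans rP; rewrite !mulr_gt0.
rewrite -scalemxAr mxE; apply: (le_lt_trans (tP i)).
apply: (@lt_le_trans _ _ (r * s)); last by rewrite ler_pM2l.
apply: (@le_lt_trans _ _ (u * ((1 + kappa) * (s * nrm)))); first by rewrite ler_pM2l.
rewrite [ltLHS](_ : _ = (1 + kappa) * (u * nrm) * s); last by ring.
by rewrite ltr_pM2r.
Qed.

End orthant_geometry.

(** * Continuity of the angular density *)

Section angular_continuity.
Context {R : realType} {n : nat}.
Local Notation T := (n.+1.-tuple R).

(** The exponent 0 causes no discontinuity at the origin, as 0 `^ 0 = 1. *)
Lemma cvg_normr_powR (s x0 : R) : (s != 0 -> x0 != 0) ->
  (`|x| `^ s) @[x --> x0] --> `|x0| `^ s.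
Proof.
have [->|s0] := eqVneq s 0.
  move=> _; under eq_fun do rewrite powRr0.
  by rewrite powRr0; exact: cvg_cst.
move=> /(_ isT) x00.
apply: (@continuous_comp _ _ _ (fun x : R => `|x|) (fun y => y `^ s)).
  exact: norm_continuous.
apply: differentiable_continuous; apply/derivable1_diffP.
have nx0 : 0 < `|x0| by rewrite normr_gt0.
by have [] := is_derive1_powR s nx0.
Qed.

(** The density is continuous at points whose coordinates may vanish only where
    the exponent 2 alpha_i - 1 is 0. *)
Lemma angular_density_continuous (alpha : 'I_n.+1 -> R) (v : T) (eta : R) :
  (forall i, alpha i != 2^-1 -> tnth v i != 0) -> 0 < eta ->
  exists2 rho : R, 0 < rho & forall x : T,
    (forall i, `|tnth x i - tnth v i| < rho) ->
    `|angular_density alpha x - angular_density alpha v| < eta.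
Proof.
move=> vP eta0.
pose f (M : 'rV[R]_n.+1) := angular_constant alpha *
   \prod_i `|M 0 i| `^ (2 * alpha i - 1).
pose v' : 'rV[R]_n.+1 := \row_i tnth v i.
have fcvg : f M @[M --> v'] --> f v'.
  apply: cvgMl_tmp; first exact: (nbhs_filter v').
  apply: (@cvg_big R^o _ *%R 1 xpredT) => [||i _].
  - by move=> p; exact: mul_continuous.
  - exact: (nbhs_filter v').
  apply: (@cvg_comp _ _ _ (fun M : 'rV[R]_n.+1 => M 0 i)
    (fun x => `|x| `^ (2 * alpha i - 1)) _ (nbhs (v' 0 i))).
    exact: coord_continuous.
  apply: cvg_normr_powR => s0; rewrite mxE; apply: vP.
  by apply: contra s0 => /eqP ->; rewrite divff ?subrr.
have /cvgrPdist_lt/(_ _ eta0) := fcvg.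
move=> /nbhs_ballP[rho /= rho0 H]; exists rho => // x xv.
have := H (\row_i tnth x i); rewrite /f distrC.
have E (y : T) : angular_constant alpha *
    \prod_i `|(\row_i tnth y i) 0 i| `^ (2 * alpha i - 1) =
    angular_density alpha y.
  by rewrite /angular_density; congr (_ * _); apply: eq_bigr => i _; rewrite mxE.
rewrite !E; apply; split => // i j; rewrite !mxE /ball/= distrC; exact: xv.
Qed.

End angular_continuity.

(** * Independent radius and direction *)

Section pair_law.
Context {R : realType}.
Local Open Scope ereal_scope.

(** The joint law of independent variables is the product of their laws. *)
Lemma independent_rvE d d1 d2 (T : measurableType d) (E1 : measurableType d1)
    (E2 : measurableType d2) (P : probability T R)
    (X : {RV P >-> E1}) (Y : {RV P >-> E2}) (H : set (E1 * E2)) :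
  independent_rv P X Y -> measurable H ->
  P [set t | H (X t, Y t)] =
  \int[distribution P X]_x distribution P Y (xsection H x).
Proof.
move=> ind mH.
pose XY t := (X t, Y t).
have mXY : measurable_fun setT XY by apply/measurable_fun_pair; exact: measurable_funP.
pose m0 : {measure set (E1 * E2) -> \bar R} := pushforward P XY.
pose m := m0 mXY.
suff E : (distribution P X \x distribution P Y) H = m H by exact: (esym E).
by apply: product_measure_unique => // B1 B2 mB1 mB2; exact: ind.
Qed.

End pair_law.

Section exceedance_probabilities.
Context {R : realType} {n : nat}.
Local Notation T := (n.+1.-tuple R).
Local Open Scope ereal_scope.
Variable A : 'M[R]_n.+1.

(** Radius and direction pairs whose image exceeds t in all coordinates. *)
Definition exceedance (t : 'cV[R]_n.+1) : set (R * T) :=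
  [set p | forall i, (t i 0 < (A^T *m (p.1 *: colv p.2)) i 0)%R].

Lemma measurable_exceedance t : measurable (exceedance t).
Proof.
have -> : exceedance t = \bigcap_(i in [set: 'I_n.+1])
    (setT `&` [set p | (t i 0)%:E < (p.1 * \sum_j A j i * tnth p.2 j)%:E]).
  have E p i : ((A^T *m (p.1 *: colv p.2)) i 0 = p.1 * \sum_j A j i * tnth p.2 j)%R.
    by rewrite -scalemxAr !mxE; congr (_ * _)%R; apply: eq_bigr => j _; rewrite !mxE.
  apply/seteqP; split => p H i.
    by move=> _; split => //; rewrite /mkset lte_fin -E; exact: H.
  by have [_] := H i Logic.I; rewrite /mkset lte_fin -E.
apply: fin_bigcap_measurable => // i _.
apply: emeasurable_fun_o_infty => //.
apply/measurable_EFinP; apply: measurable_funM => //.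
apply: measurable_sum_ord => j; apply: measurable_funM => //.
exact: (measurableT_comp (measurable_tnth j)).
Qed.

Context d (O : measurableType d) (P : probability O R) (rad : {RV P >-> R}).

(** The pairs of H with direction in N. *)
Let nearset (H : set (R * T)) (N : set T) : set (R * T) := H `&` (setT `*` N).

Let measurable_near H N : measurable H -> measurable N -> measurable (nearset H N).
Proof. by move=> mH mN; apply: measurableI => //; exact: measurableX. Qed.

Let near_sectionE H N r : xsection (nearset H N) r `<=` N.
Proof. by move=> v; rewrite /xsection/= inE => -[_ []]. Qed.

Variables (alpha : 'I_n.+1 -> R) (U V : {RV P >-> T}).
Hypotheses (U_SD : symm_dirichlet_rv alpha U) (V_unif : uniform_sphere_rv V).
Hypotheses (rad_U : independent_rv P rad U) (rad_V : independent_rv P rad V).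

(** Comparison of U and V for directions in N, by conditioning on the radius. *)
Lemma near_le (H : set (R * T)) (N : set T) (hi : R) :
  measurable H -> measurable N -> (0 <= hi)%R ->
  (forall v, N v -> normsq v = 1%R -> (angular_density alpha v <= hi)%R) ->
  P [set o | nearset H N (rad o, U o)] <=
  hi%:E * P [set o | nearset H N (rad o, V o)].
Proof.
move=> mH mN hi0 Nhi.
rewrite !independent_rvE//; [|exact: measurable_near..].
have mK := measurable_near mH mN.
rewrite -ge0_integralZl//; last first.
  exact: measurable_fun_xsection.
apply: ge0_le_integral => //.
- exact: measurable_fun_xsection.
- apply: emeasurable_funM => //.
  exact: measurable_fun_xsection.
move=> r _; apply: (symm_dirichlet_le U_SD V_unif) => //.
- exact: measurable_xsection.
- by move=> v /near_sectionE; exact: Nhi.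
Qed.

Lemma near_ge (H : set (R * T)) (N : set T) (lo : R) :
  measurable H -> measurable N -> (0 <= lo)%R ->
  (forall v, N v -> normsq v = 1%R -> (lo <= angular_density alpha v)%R) ->
  lo%:E * P [set o | nearset H N (rad o, V o)] <=
  P [set o | nearset H N (rad o, U o)].
Proof.
move=> mH mN lo0 Nlo.
rewrite !independent_rvE//; [|exact: measurable_near..].
have mK := measurable_near mH mN.
rewrite -ge0_integralZl//; last first.
  exact: measurable_fun_xsection.
apply: ge0_le_integral => //.
- by move=> r _; rewrite mule_ge0.
- apply: emeasurable_funM => //.
  exact: measurable_fun_xsection.
- exact: measurable_fun_xsection.
move=> r _; apply: (symm_dirichlet_ge U_SD V_unif) => //.
- exact: measurable_xsection.
- by move=> v /near_sectionE; exact: Nlo.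
Qed.

Lemma symm_dirichlet_sphere : P (U @^-1` ~` @unit_sphere R n.+1) = 0.
Proof.
have mS := @measurable_unit_sphere R n.+1.
apply/eqP; rewrite eq_le measure_ge0 andbT.
have := @symm_dirichlet_le R n alpha _ _ P U _ _ P V U_SD V_unif
  (~` @unit_sphere R n.+1) 0 (measurableC mS) (lexx _).
by rewrite mul0e; apply => v.
Qed.

Lemma uniform_sphere_sphere : P (V @^-1` ~` @unit_sphere R n.+1) = 0.
Proof.
have mS := @measurable_unit_sphere R n.+1.
rewrite -preimage_setC probability_setC; last first.
  by rewrite -[X in measurable X]setTI; apply: measurable_funP.
have [VS _] := uniform_sphere_ball_uniform V_unif.
by rewrite [P _]VS subee.
Qed.

Hypothesis rad_pos : {ae P, forall o, (0 < rad o)%R}.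

Let mpre d1 (E : measurableType d1) (Y : {RV P >-> E}) C :
  measurable C -> measurable (Y @^-1` C).
Proof. by move=> mC; rewrite -[X in measurable X]setTI; apply: measurable_funP. Qed.

Let mpair (Y : {RV P >-> T}) (H : set (R * T)) : measurable H ->
  measurable [set o | H (rad o, Y o)].
Proof.
move=> mH; rewrite -[X in measurable X]setTI.
have mXY : measurable_fun setT (fun o => (rad o, Y o)).
  by apply/measurable_fun_pair; exact: measurable_funP.
exact: mXY.
Qed.

Let mgt (c : R) : measurable [set o | (c < rad o)%R].
Proof.
rewrite (_ : [set _ | _] = rad @^-1` `]c, +oo[%classic); last first.
  by apply/seteqP; split => o /=; rewrite in_itv/= andbT.
by apply: mpre; exact: measurable_itv.
Qed.

(** If directions outside N require a radius larger than c, they contribute at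
    most the tail of the radius at c. *)
Lemma far_le (Y : {RV P >-> T}) (H : set (R * T)) (N : set T) (c : R) :
  P (Y @^-1` ~` @unit_sphere R n.+1) = 0 -> measurable H -> measurable N ->
  (forall r v, (0 < r)%R -> unit_sphere v -> H (r, v) -> ~ N v -> (c < r)%R) ->
  P [set o | nearset H (~` N) (rad o, Y o)] <= P [set o | (c < rad o)%R].
Proof.
move=> YS mH mN HN.
have mS := @measurable_unit_sphere R n.+1.
have mNC := measurableC mN.
have rad0 : P (~` [set o | (0 < rad o)%R]) = 0.
  by apply/negligibleP => //; exact: measurableC.
have mYS : measurable (Y @^-1` ~` @unit_sphere R n.+1).
  by apply: mpre; exact: measurableC.
have mr0 : measurable (~` [set o | (0 < rad o)%R]) by exact: measurableC.
have mn : measurable [set o | nearset H (~` N) (rad o, Y o)].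
  exact: mpair (measurable_near _ _).
pose Z := ~` [set o | (0 < rad o)%R] `|` Y @^-1` ~` @unit_sphere R n.+1.
have mZ : measurable Z by exact: measurableU.
have PZ : P Z = 0 by rewrite measureU0.
have <- : P ([set o | (c < rad o)%R] `|` Z) = P [set o | (c < rad o)%R].
  by rewrite measureU0.
apply: le_measure; rewrite ?inE//; first exact: measurableU.
move=> o [Ho [_ NYo]].
have [r0|r0] := pselect (0 < rad o)%R; last by right; left.
have [So|So] := pselect (unit_sphere (Y o)); last by right; right.
by left; apply: (HN (rad o) (Y o)).
Qed.

(** The two probabilities of H compared: directions in N through the bounds of
    the density, the others through the tail of the radius. *)
Lemma exceedance_upper (H : set (R * T)) (N : set T) (hi c : R) :
  measurable H -> measurable N -> (0 <= hi)%R ->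
  (forall v, N v -> normsq v = 1%R -> (angular_density alpha v <= hi)%R) ->
  (forall r v, (0 < r)%R -> unit_sphere v -> H (r, v) -> ~ N v -> (c < r)%R) ->
  P [set o | H (rad o, U o)] <=
  hi%:E * P [set o | H (rad o, V o)] + P [set o | (c < rad o)%R].
Proof.
move=> mH mN hi0 Nhi HN.
have mNC := measurableC mN.
have -> : [set o | H (rad o, U o)] = [set o | nearset H N (rad o, U o)] `|`
    [set o | nearset H (~` N) (rad o, U o)].
  apply/seteqP; split => o /=.
    by move=> Ho; have [NU|NU] := pselect (N (U o)); [left|right].
  by case=> -[].
rewrite measureU//; [|exact: mpair (measurable_near _ _)..|]; last first.
  by rewrite -subset0 => o /= -[[_ [_ +]] [_ [_]]].
apply: leeD.
  apply: (le_trans (near_le mH mN hi0 Nhi)).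
  apply: lee_wpmul2l; first by rewrite lee_fin.
  apply: le_measure; rewrite ?inE; [exact: mpair (measurable_near _ _)|exact: mpair|].
  by move=> o [].
exact: (far_le symm_dirichlet_sphere).
Qed.

Lemma exceedance_lower (H : set (R * T)) (N : set T) (lo c : R) :
  measurable H -> measurable N -> (0 <= lo)%R ->
  (forall v, N v -> normsq v = 1%R -> (lo <= angular_density alpha v)%R) ->
  (forall r v, (0 < r)%R -> unit_sphere v -> H (r, v) -> ~ N v -> (c < r)%R) ->
  lo%:E * P [set o | H (rad o, V o)] <=
  P [set o | H (rad o, U o)] + lo%:E * P [set o | (c < rad o)%R].
Proof.
move=> mH mN lo0 Nlo HN.
have mNC := measurableC mN.
have -> : [set o | H (rad o, V o)] = [set o | nearset H N (rad o, V o)] `|`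
    [set o | nearset H (~` N) (rad o, V o)].
  apply/seteqP; split => o /=.
    by move=> Ho; have [NV|NV] := pselect (N (V o)); [left|right].
  by case=> -[].
rewrite measureU//; [|exact: mpair (measurable_near _ _)..|]; last first.
  by rewrite -subset0 => o /= -[[_ [_ +]] [_ [_]]].
rewrite ge0_muleDr//; apply: leeD.
  apply: (le_trans (near_ge mH mN lo0 Nlo)).
  apply: le_measure; rewrite ?inE; [exact: mpair (measurable_near _ _)|exact: mpair|].
  by move=> o [].
apply: lee_wpmul2l; first by rewrite lee_fin.
exact: (far_le uniform_sphere_sphere).
Qed.

(** A lower bound by the tail of the radius, if all directions in N and all radii
    larger than c belong to H. *)
Lemma exceedance_positive (H : set (R * T)) (N : set T) (c : R) :
  measurable H -> measurable N ->
  (forall r v, (c < r)%R -> N v -> H (r, v)) ->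
  P (V @^-1` N) * P [set o | (c < rad o)%R] <= P [set o | H (rad o, V o)].
Proof.
move=> mH mN HN.
have mc : measurable (`]c, +oo[%classic : set R) by exact: measurable_itv.
have cE : [set o | (c < rad o)%R] = rad @^-1` `]c, +oo[%classic.
  by apply/seteqP; split => o /=; rewrite in_itv/= andbT.
rewrite cE muleC -rad_V//; apply: le_measure; rewrite ?inE.
- by apply: measurableI; exact: mpre.
- exact: mpair.
- by move=> o [/=]; rewrite in_itv/= andbT => ro No; exact: HN.
Qed.

End exceedance_probabilities.

(** * Limits of ratios *)

Section limit_lemmas.
Context {R : realType}.

(** A ratio p / q converges to g if p and q differ by a factor close to g up to an
    error T2 that is negligible with respect to a lower bound pi0 T1 of q. *)
Lemma ratio_cvg (p q : nat -> R) (g : R) : 0 < g ->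
  (forall eta, 0 < eta < g -> exists T1 T2 : nat -> R, exists pi0 : R,
    [/\ 0 < pi0, forall m, 0 < T1 m, T2 m / T1 m @[m --> \oo] --> (0 : R) &
     \forall m \near \oo, [/\ p m <= (g + eta) * q m + T2 m,
       (g - eta) * q m <= p m + (g - eta) * T2 m & pi0 * T1 m <= q m]]) ->
  p m / q m @[m --> \oo] --> g.
Proof.
move=> g0 H; apply/cvgrPdist_le => e e0.
pose eta := Num.min (e / 2) (g / 2).
have eta0 : 0 < eta by rewrite lt_min !divr_gt0.
have etag : eta < g.
  by rewrite (le_lt_trans (y := g / 2))// ?ge_min ?lexx ?orbT// gtr_pMr// invf_lt1 ?ltr1n.
have etae : eta <= e / 2 by rewrite ge_min lexx.
have [T1 [T2 [pi0 [pi00 T10 T21 Hm]]]] := H eta (introT andP (conj eta0 etag)).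
(* an error T2 <= s q changes the ratio by at most (1 + g) s = e / 2 *)
pose s := e / (2 * (1 + g)).
have s0 : 0 < s by rewrite divr_gt0// mulr_gt0// addr_gt0.
have sg : s * (1 + g) = e / 2.
  by rewrite /s invfM mulrA -mulrA mulVf ?mulr1// gt_eqF// addr_gt0.
have sp : 0 < s * pi0 by rewrite mulr_gt0.
have Hs : \forall m \near \oo, `|T2 m / T1 m| < s * pi0.
  have /cvgrPdist_lt/(_ _ sp) := T21.
  by apply: filterS => m; rewrite sub0r normrN.
near=> m.
have hs : `|T2 m / T1 m| < s * pi0 by near: m.
have [h1 h2 h3] : [/\ p m <= (g + eta) * q m + T2 m,
       (g - eta) * q m <= p m + (g - eta) * T2 m & pi0 * T1 m <= q m] by near: m.
have q0 : 0 < q m by apply: lt_le_trans h3; rewrite mulr_gt0.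
have T2q : T2 m <= s * q m.
  apply: (@le_trans _ _ (s * (pi0 * T1 m))); last by rewrite ler_pM2l.
  by rewrite mulrA -ler_pdivrMr// (le_trans (ler_norm _))// ltW.
rewrite distrC ler_norml; apply/andP; split.
  rewrite lerBrDr addrC ler_pdivlMr//.
  have h4 : (g - eta) * T2 m <= g * (s * q m).
    apply: (@le_trans _ _ ((g - eta) * (s * q m))).
      by rewrite ler_pM2l// subr_gt0.
    by apply: ler_wpM2r; [rewrite ltW// mulr_gt0|rewrite gerBl ltW].
  have h5 : eta * q m <= e / 2 * q m by rewrite ler_pM2r.
  have h6 : g * (s * q m) <= e / 2 * q m.
    by rewrite -sg mulrA ler_pM2r// mulrC ler_pM2l// lerDr.
  have h7 : e * q m = e / 2 * q m + e / 2 * q m by field.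
  by rewrite mulrBl h7; move: h2; rewrite [(g - eta) * q m]mulrBl; lra.
rewrite lerBlDr ler_pdivrMr//.
have h5 : eta * q m <= e / 2 * q m by rewrite ler_pM2r.
have h6 : s * q m <= e / 2 * q m.
  by rewrite ler_pM2r// -sg mulrDr mulr1 lerDl mulr_ge0// ltW.
apply: (le_trans h1); rewrite !mulrDl.
have -> : e * q m = e / 2 * q m + e / 2 * q m by field.
by lra.
Unshelve. all: by end_near. Qed.

Lemma cdf_tail d (O : measurableType d) (P : probability O R)
    (X : {RV P >-> R}) (F : R -> R) : (forall r, cdf X r = (F r)%:E) ->
  forall c, P [set o | c < X o] = (1 - F c)%:E.
Proof.
move=> XF c.
have mc : measurable (X @^-1` `]-oo, c]%classic).
  by rewrite -[X in measurable X]setTI; apply: measurable_funP.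
have -> : [set o | c < X o] = ~` (X @^-1` `]-oo, c]%classic).
  apply/seteqP; split => o /=; rewrite in_itv/=; first by rewrite ltNge => /negP.
  by move=> /negP; rewrite -ltNge.
by rewrite probability_setC// EFinB -XF.
Qed.

End limit_lemmas.

(** * Thresholds *)

Section threshold_bounds.
Context {R : realType} {k : nat}.
Variables (abar : 'cV[R]_k) (u zeta : nat -> R) (t : nat -> 'cV[R]_k) (nrm : R).
Hypotheses (nrm_gt0 : 0 < nrm) (u_pos : forall m, 0 < u m)
  (zeta_pos : forall m, 0 < zeta m)
  (uzeta : u m * zeta m @[m --> \oo] --> +oo).

(** On the minimal index set the thresholds are u abar up to O(1 / zeta), which is
    o(u). *)
Lemma threshold_bounded (q : R) i (eta : R) : 0 < eta ->
  zeta m * (t m - u m *: abar) i 0 @[m --> \oo] --> q ->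
  \forall m \near \oo, u m * (abar i 0 - eta) <= t m i 0 <= u m * (abar i 0 + eta).
Proof.
move=> eta0 cvq.
have H1 : \forall m \near \oo, `|zeta m * (t m - u m *: abar) i 0| < `|q| + 1.
  have /cvgrPdist_lt/(_ _ ltr01) := cvq; apply: filterS => m h.
  by rewrite -ltrBlDl; apply: le_lt_trans h; rewrite distrC; exact: lerB_dist.
have H2 : \forall m \near \oo, (`|q| + 1) / eta <= u m * zeta m.
  by have /cvgryPge := uzeta; apply.
near=> m.
have h1 : `|zeta m * (t m - u m *: abar) i 0| < `|q| + 1 by near: m.
have h2 : (`|q| + 1) / eta <= u m * zeta m by near: m.
have : `|(t m - u m *: abar) i 0| <= u m * eta.
  rewrite -(@ler_pM2l _ (zeta m))// -[X in X * `|_|]gtr0_norm// -normrM.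
  apply: (le_trans (ltW h1)); move: h2; rewrite ler_pdivrMr//.
  by move/le_trans; apply; rewrite le_eqVlt; apply/orP; left; apply/eqP; ring.
rewrite ler_norml !mxE => /andP[]; rewrite mulrBr mulrDr.
by move: (u m * abar i 0) (u m * eta) (t m i 0) => x y z' *; apply/andP; split; lra.
Unshelve. all: by end_near. Qed.

(** Off the minimal index set only an upper bound holds, since the limit may be
    minus infinity; here the scale (u / zeta) ^ (1/2) is also o(u). *)
Lemma threshold_above (q : \bar R) i (eta : R) : 0 < eta -> (q < +oo)%E ->
  (Num.sqrt (zeta m / (u m * nrm)) * (t m - u m *: abar) i 0)%:E
     @[m --> \oo] --> q ->
  \forall m \near \oo, t m i 0 <= u m * (abar i 0 + eta).
Proof.
move=> eta0 qoo cvq.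
have [K K0 qK] : exists2 K : R, 0 < K & (q < K%:E)%E.
  case: q qoo {cvq} => [r| |]// _.
    exists (`|r| + 1); first by rewrite ltr_pwDr.
    by rewrite lte_fin (le_lt_trans (ler_norm _))// ltrDl.
  by exists 1 => //; rewrite ltNyr.
have H1 : \forall m \near \oo,
    ((Num.sqrt (zeta m / (u m * nrm)) * (t m - u m *: abar) i 0)%:E < K%:E)%E.
  exact: (cvq (fun x => (x < K%:E)%E) (open_ereal_lt' qK)).
have H2 : \forall m \near \oo, K ^+ 2 * nrm / eta ^+ 2 <= u m * zeta m.
  by have /cvgryPge := uzeta; apply.
near=> m.
have h1 : ((Num.sqrt (zeta m / (u m * nrm)) *
    (t m - u m *: abar) i 0)%:E < K%:E)%E by near: m.
have h2 : K ^+ 2 * nrm / eta ^+ 2 <= u m * zeta m by near: m.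
rewrite lte_fin in h1.
have un0 : 0 < u m * nrm by rewrite mulr_gt0.
have s0 : 0 < Num.sqrt (zeta m / (u m * nrm)) by rewrite sqrtr_gt0 divr_gt0.
have h3 : K <= Num.sqrt (zeta m / (u m * nrm)) * (u m * eta).
  rewrite -(@ler_pXn2r _ 2) ?nnegrE ?(ltW K0)//; last first.
    by rewrite mulr_ge0 ?sqrtr_ge0// ltW// mulr_gt0.
  rewrite exprMn sqr_sqrtr; last by rewrite divr_ge0// ltW.
  rewrite ler_pdivrMr ?exprn_gt0// in h2.
  rewrite [leRHS](_ : _ = u m * zeta m * eta ^+ 2 / nrm).
    by rewrite ler_pdivlMr.
  by field; rewrite !gt_eqF.
have h4 : (t m - u m *: abar) i 0 < u m * eta.
  by rewrite -(ltr_pM2l s0); exact: lt_le_trans h1 h3.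
by move: h4; rewrite !mxE mulrDr ltrBlDl => /ltW.
Unshelve. all: by end_near. Qed.

End threshold_bounds.

(** * The ratio of the exceedance probabilities *)

Section asymptotic_equivalence.
Context {R : realType} {n : nat}.
Local Notation T := (n.+1.-tuple R).

(** Uniform continuity of the linear map A^T, coordinatewise. *)
Lemma bounded_dilation (A : 'M[R]_n.+1) (rho0 : R) (v : T) : 0 < rho0 ->
  exists2 r0 : R, 0 < r0 & forall x, sq_ball v r0 x ->
    forall i, `|(A^T *m colv x) i 0 - (A^T *m colv v) i 0| <= rho0.
Proof.
move=> rho00.
pose c := 1 + \sum_i \sum_j `|A j i|.
have c0 : 0 < c by rewrite ltr_pwDl// sumr_ge0// => i _; rewrite sumr_ge0.
exists ((rho0 / c) ^+ 2); first by rewrite exprn_gt0// divr_gt0.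
move=> x vx i.
have rc : 0 <= rho0 / c by rewrite ltW// divr_gt0.
have xv j : `|tnth x j - tnth v j| <= rho0 / c.
  rewrite -(@ler_pXn2r _ 2)// ?nnegrE// real_normK ?num_real//.
  apply: ltW; apply: le_lt_trans vx; rewrite distsqC /distsq (bigD1 j)//= lerDl.
  by apply: sumr_ge0 => l _; exact: sqr_ge0.
rewrite !mxE -sumrB; apply: (le_trans (ler_norm_sum _ _ _)).
apply: (@le_trans _ _ (\sum_j `|A j i| * (rho0 / c))).
  apply: ler_sum => j _; rewrite !mxE -mulrBr normrM.
  by rewrite ler_wpM2l.
rewrite -mulr_suml mulrC mulrAC ler_pdivrMr// ler_pM2l//.
rewrite /c [X in _ <= 1 + X](bigD1 i)//= addrCA lerDl addr_ge0// sumr_ge0// => l _.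
by rewrite sumr_ge0.
Qed.

(** On the unit sphere, a large inner product means a small distance. *)
Lemma dot_close (x v : T) (e : R) : normsq x = 1 -> normsq v = 1 ->
  1 - e < ((colv x)^T *m colv v) 0 0 ->
  forall i, (tnth x i - tnth v i) ^+ 2 < 2 * e.
Proof.
move=> x1 v1 xv i.
apply: (@le_lt_trans _ _ (distsq x v)).
  by rewrite /distsq (bigD1 i)//= lerDl; apply: sumr_ge0 => j _; exact: sqr_ge0.
have -> : distsq x v = normsq x + normsq v - 2 * ((colv x)^T *m colv v) 0 0.
  rewrite dotE /distsq /normsq mulr_sumr -big_split/= -sumrB.
  by apply: eq_bigr => j _; rewrite !mxE; ring.
by rewrite x1 v1; move: xv; set y := (_ *m _) 0 0; lra.
Qed.

Variables (alpha : 'I_n.+1 -> R) (A : 'M[R]_n.+1).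
Context d (O : measurableType d) (P : probability O R).
Variables (rad : {RV P >-> R}) (F : R -> R) (U V : {RV P >-> T}).
Hypotheses (rad_pos : {ae P, forall o, 0 < rad o})
  (rad_F : forall r, cdf rad r = (F r)%:E) (U_SD : symm_dirichlet_rv alpha U)
  (rad_U : independent_rv P rad U) (V_unif : uniform_sphere_rv V)
  (rad_V : independent_rv P rad V).
Variables (w : R -> R).
Hypotheses (F_lt1 : forall r, F r < 1) (F_0 : F 0 = 0) (w_pos : forall r, 0 < w r)
  (F_gumbel : gumbel_mda F w).
Variables (z : 'cV[R]_n.+1) (I : {set 'I_n.+1}).
Hypotheses (zI : forall i, i \in I -> 0 < z i 0)
  (zJ : forall i, i \notin I -> z i 0 = 0) (I_neq0 : exists i, i \in I).
Let v0 := A *m z.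
Let abar := A^T *m v0.
Hypothesis abar_pos : forall i, 0 < abar i 0.
Variable nrm : R.
Hypotheses (nrm_gt0 : 0 < nrm) (nrm2 : nrm ^+ 2 = (v0^T *m v0) 0 0).
Let vbar : T := tupv (nrm^-1 *: v0).
Hypothesis vbar_neq0 : forall i, alpha i != 2^-1 -> tnth vbar i != 0.
Hypothesis g_gt0 : 0 < angular_density alpha vbar.
Variables (u : nat -> R) (t : nat -> 'cV[R]_n.+1).
Hypotheses (u_pos : forall m, 0 < u m) (u_infty : u m @[m --> \oo] --> +oo).
Hypothesis t_above : forall eta i, 0 < eta ->
  \forall m \near \oo, t m i 0 <= u m * (abar i 0 + eta).
Hypothesis t_below : forall eta i, 0 < eta -> i \in I ->
  \forall m \near \oo, u m * (abar i 0 - eta) <= t m i 0.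

Let F_nd : {homo F : x y / x <= y}.
Proof.
by move=> x y xy; rewrite -lee_fin -!rad_F; apply: cdf_nondecreasing.
Qed.

Let F_cvg : F r @[r --> +oo] --> (1 : R).
Proof.
have := cvg_cdfy1 rad; rewrite (_ : cdf rad = EFin \o F); last first.
  by apply/funext => r; rewrite /= rad_F.
by move=> /fine_cvgP[].
Qed.

Let dot_vbar (x : T) : ((colv x)^T *m colv vbar) 0 0 =
  nrm^-1 * ((colv x)^T *m v0) 0 0.
Proof. by rewrite tupvK -scalemxAr mxE. Qed.

Let vbar_unit : normsq vbar = 1.
Proof.
have nn : nrm != 0 by rewrite gt_eqF.
have E : ((nrm^-1 *: v0)^T *m v0) 0 0 = nrm^-1 * nrm ^+ 2.
  by rewrite linearZ/= -scalemxAl [LHS]mxE nrm2.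
by rewrite normsq_colv dot_vbar tupvK E; field.
Qed.

Let A_vbar i : (A^T *m colv vbar) i 0 = abar i 0 / nrm.
Proof. by rewrite tupvK -scalemxAr mxE mulrC. Qed.

Let sumz_gt0 : 0 < \sum_i z i 0.
Proof.
have [i iI] := I_neq0; rewrite (bigD1 i)//= ltr_pwDl ?zI// sumr_ge0// => j _.
by have [jI|jI] := boolP (j \in I); [rewrite ltW ?zI|rewrite zJ].
Qed.

(** A positive lower bound of the coordinates of abar; the product of their
    minima with 1 is one. *)
Let min_abar : exists2 b, 0 < b & forall i, b <= abar i 0.
Proof.
have [i0 _] := I_neq0.
pose b := \prod_i Num.min 1 (abar i 0).
have m0 i : 0 < Num.min 1 (abar i 0) by rewrite lt_min ltr01 abar_pos.
exists b; first by apply: prodr_gt0 => i _.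
move=> i; rewrite /b (bigD1 i)//=.
apply: (@le_trans _ _ (Num.min 1 (abar i 0))); last by rewrite ge_min lexx orbT.
rewrite ler_piMr ?(ltW (m0 i))//; apply: prodr_ile1 => j _.
by rewrite (ltW (m0 j)) ge_min lexx.
Qed.

Let delta m := u m * nrm.

Let delta_infty : delta m @[m --> \oo] --> +oo.
Proof.
apply/cvgryPge => K; have /cvgryPge/(_ (K / nrm)) := u_infty.
by apply: filterS => m; rewrite ler_pdivrMr.
Qed.

Let mpre d1 (E : measurableType d1) (Y : {RV P >-> E}) C :
  measurable C -> measurable (Y @^-1` C).
Proof. by move=> mC; rewrite -[X in measurable X]setTI; apply: measurable_funP. Qed.

Let mpair (Y : {RV P >-> T}) (H : set (R * T)) : measurable H ->
  measurable [set o | H (rad o, Y o)].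
Proof.
move=> mH; rewrite -[X in measurable X]setTI.
have mXY : measurable_fun setT (fun o => (rad o, Y o)).
  by apply/measurable_fun_pair; exact: measurable_funP.
exact: mXY.
Qed.

Let fineP (S : set O) : measurable S -> P S = (fine (P S))%:E.
Proof. by move=> mS; rewrite fineK// fin_num_measure. Qed.

(** For directions near vbar the two laws differ by a nearly constant factor; the
    other directions require a radius that is larger by a fixed proportion, which
    is negligible by rapid variation. *)
Lemma exceedance_ratio_cvg :
  fine (P [set o | exceedance A (t m) (rad o, U o)]) /
  fine (P [set o | exceedance A (t m) (rad o, V o)]) @[m --> \oo] -->
  angular_density alpha vbar.
Proof.
set g := angular_density alpha vbar.
apply: ratio_cvg => // eta /andP[eta0 etag].
have [rho rho0 rhoP] := angular_density_continuous vbar_neq0 eta0.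
(* by dot_close, a unit vector with inner product larger than 1 - e lies within
   rho of vbar in each coordinate *)
pose e := Num.min (2^-1) (rho ^+ 2 / 2).
have e0 : 0 < e by rewrite lt_min invr_gt0 ltr0n/= divr_gt0// exprn_gt0.
have e1 : e < 1 by rewrite (le_lt_trans (y := 2^-1))// ?ge_min ?lexx// invf_lt1 ?ltr1n.
have erho : 2 * e <= rho ^+ 2.
  by rewrite mulrC -ler_pdivlMr// ge_min lexx orbT.
(* kappa < e / 2 makes the radius sufficient near vbar smaller, by a fixed factor,
   than the one necessary away from vbar *)
pose kappa := e / 4.
have k0 : 0 < kappa by rewrite divr_gt0.
have [b b0 bP] := min_abar.
(* the largest deviation of A^T v from A^T vbar allowed by exceedance_near *)
pose rho0' := kappa / 2 * b / ((1 + kappa) * nrm).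
have k1 : 0 < 1 + kappa by rewrite addr_gt0.
have rho0'0 : 0 < rho0' by rewrite divr_gt0 ?mulr_gt0// divr_gt0.
have [r0 r00 r0P] := bounded_dilation A vbar rho0'0.
pose N : set T := [set v | 1 - e < ((colv v)^T *m colv vbar) 0 0].
have mN : measurable N.
  rewrite (_ : N = setT `&` [set v : T |
      ((1 - e)%:E < (\sum_i tnth v i * tnth vbar i)%:E)%E]).
    apply: emeasurable_fun_o_infty => //; apply/measurable_EFinP.
    by apply: measurable_sum_ord => i; apply: measurable_funM => //; exact: measurable_tnth.
  have E v : ((colv v)^T *m colv vbar) 0 0 = \sum_i tnth v i * tnth vbar i.
    by rewrite dotE; apply: eq_bigr => i _; rewrite !mxE.
  by apply/seteqP; split => v; rewrite /N /= lte_fin E; [split|case].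
have gN v : N v -> normsq v = 1 ->
    g - eta <= angular_density alpha v /\ angular_density alpha v <= g + eta.
  move=> Nv v1.
  have : `|angular_density alpha v - g| < eta.
    apply: rhoP => i.
    have := dot_close v1 vbar_unit Nv i => h.
    rewrite -(@ltr_pXn2r _ 2)// ?nnegrE ?(ltW rho0)// real_normK ?num_real//.
    exact: lt_le_trans h erho.
  by rewrite ltr_norml => /andP[]; split; lra.
pose c1 m := (1 + kappa) * delta m.
pose c2 m := (1 + e / 2) * delta m.
pose N' := sq_ball vbar r0.
have mN' : measurable N' by exact: measurable_sq_ball.
have Vu := uniform_sphere_ball_uniform V_unif.
have pi0 : 0 < fine (P (V @^-1` N')).
  rewrite -lte_fin -fineP; last exact: mpre.
  exact: (ball_uniform_gt0 Vu vbar_unit r00).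
exists (fun m => 1 - F (c1 m)), (fun m => 1 - F (c2 m)), (fine (P (V @^-1` N'))).
split => //.
- by move=> m; rewrite subr_gt0.
- pose l := (1 + e / 2) / (1 + kappa).
  have l1 : 1 < l.
    by rewrite /l ltr_pdivlMr// mul1r ltrD2l /kappa ltr_pM2l// ltf_pV2 ?posrE// ltr_nat.
  have c1_infty : c1 m @[m --> \oo] --> +oo.
    apply/cvgryPge => K; have /cvgryPge/(_ (K / (1 + kappa))) := delta_infty.
    by apply: filterS => m; rewrite ler_pdivrMr// mulrC.
  have := cvg_comp _ _ c1_infty
    (gumbel_rapid_variation F_lt1 F_nd F_cvg F_0 w_pos F_gumbel l1).
  apply: cvg_trans; apply: near_eq_cvg; apply: nearW => m /=.
  by congr ((1 - F _) / _); rewrite /l /c1 /c2 mulrA divfK// gt_eqF.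
(* the largest error of the thresholds allowed by exceedance_far *)
pose eta' := e / 3 * nrm ^+ 2 / \sum_i z i 0.
have eta'0 : 0 < eta' by rewrite divr_gt0// mulr_gt0 ?exprn_gt0// divr_gt0.
have tA : \forall m \near \oo, forall i, t m i 0 <= u m * (abar i 0 + kappa / 2 * b).
  by apply: filter_forall => i; apply: t_above; rewrite mulr_gt0// divr_gt0.
have tB : \forall m \near \oo, forall i, i \in I -> u m * (abar i 0 - eta') <= t m i 0.
  apply: filter_forall => i; have [iI|iI] := boolP (i \in I).
    by have := t_below eta'0 iI; apply: filterS => m ? _.
  by apply: nearW.
near=> m.
have tAm : forall i, t m i 0 <= u m * (abar i 0 + kappa / 2 * b) by near: m.
have tBm : forall i, i \in I -> u m * (abar i 0 - eta') <= t m i 0 by near: m.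
have mH := measurable_exceedance A (t m).
have farP r v : 0 < r -> unit_sphere v -> exceedance A (t m) (r, v) -> ~ N v ->
    c2 m < r.
  move=> rr Sv Hrv Nv.
  apply: (@exceedance_far _ _ A z I zI zJ nrm nrm_gt0 nrm2 (t m) (colv v)
    r (u m) eta' e) => //.
  - by rewrite e0.
  - by rewrite /eta' divfK// gt_eqF.
  - move/negP: Nv; rewrite -leNgt dot_vbar mulrC ler_pdivrMr//.
have nearP r v : c1 m < r -> N' v -> exceedance A (t m) (r, v).
  move=> rr Nv.
  apply: (@exceedance_near _ _ A z nrm nrm_gt0 (t m) (colv v)
    r (u m) b kappa rho0') => //.
  - by rewrite /rho0' mulrCA divfK// gt_eqF// mulr_gt0.
  - by move=> i; have := r0P v Nv i; rewrite A_vbar.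
split.
- have := exceedance_upper U_SD V_unif rad_U rad_V rad_pos mH mN
    (hi := g + eta) (c := c2 m) _ _ farP.
  rewrite (cdf_tail rad_F) (fineP (mpair U mH)) (fineP (mpair V mH)).
  rewrite -EFinM -EFinD lee_fin.
  apply; first by rewrite ltW// addr_gt0.
  by move=> v Nv v1; have [] := gN v Nv v1.
- have := exceedance_lower U_SD V_unif rad_U rad_V rad_pos mH mN
    (lo := g - eta) (c := c2 m) _ _ farP.
  rewrite (cdf_tail rad_F) (fineP (mpair U mH)) (fineP (mpair V mH)).
  rewrite -!EFinM -EFinD lee_fin.
  apply; first by rewrite ltW// subr_gt0.
  by move=> v Nv v1; have [] := gN v Nv v1.
- have := exceedance_positive rad_V mH mN' nearP.
  by rewrite (cdf_tail rad_F) (fineP (mpair V mH)) (fineP (mpre V mN')) -EFinM lee_fin.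
Unshelve. all: by end_near. Qed.

End asymptotic_equivalence.

(** The constant of the limit is the density at the normalised C abar: a factor
    with alpha_i = 1/2 has exponent 0, and no other factor is excluded because
    the degenerate set is empty. *)
Lemma tail_constantE (R : realType) (n : nat) (alpha : 'I_n.+1 -> R)
    (A : 'M[R]_n.+1) (a abar : 'cV[R]_n.+1) (I : {set 'I_n.+1}) :
  let nrm := norm_sub (A^T *m A) I a in
  let v := invmx A^T *m abar in
  0 < nrm -> degenerate_set alpha (invmx A^T) abar = finset.set0 ->
  tail_constant alpha A a abar I = angular_density alpha (tupv (nrm^-1 *: v)).
Proof.
move=> nrm v nrm0 deg.
rewrite /tail_constant /angular_density /angular_constant [RHS]mulrC.
congr (_ * _); rewrite /tau_star deg -/nrm -/v big_mkcond; apply: eq_bigr => i _.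
rewrite finset.in_setC finset.in_set0 /= tnth_mktuple [in RHS]mxE.
case: eqVneq => [->|ai]/=; first by rewrite divff// subrr powRr0.
have nV : nrm^-1 = nrm `^ (- 1) by rewrite powR_inv1// ltW.
rewrite normrM powRM// gtr0_norm ?invr_gt0// nV -powRrM mulN1r.
by congr (_ `^ _ * _); rewrite opprB.
Qed.

Theorem corollary3p2 (R : realType) (k : nat) (hk : (2 <= k)%N)
  (alpha : 'I_k -> R) (halpha : forall i, 0 < alpha i)
  (A : 'M[R]_k) (hA : A \in unitmx)
  (d : measure_display) (T : measurableType d) (P : probability T R)
  (rad : {RV P >-> R}) (F : R -> R)
  (rad_pos : {ae P, forall o, 0 < rad o})
  (rad_F : forall r, cdf rad r = (F r)%:E)
  (U : {RV P >-> k.-tuple R})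
  (U_SD : symm_dirichlet_rv alpha U)
  (rad_U : independent_rv P rad U)
  (dX : measure_display) (TX : measurableType dX) (PX : probability TX R)
  (X : {RV PX >-> k.-tuple R})
  (X_law : same_law PX P X (fun o => tupv (A^T *m (rad o *: colv (U o)))))
  (V : {RV P >-> k.-tuple R})
  (V_unif : uniform_sphere_rv V)
  (rad_V : independent_rv P rad V)
  (F_lt1 : forall r, F r < 1) (F_0 : F 0 = 0)
  (w : R -> R) (w_pos : forall r, 0 < w r)
  (F_gumbel : gumbel_mda F w)
  (a abar : 'cV[R]_k) (a_pos : forall i, 0 < a i 0)
  (I : {set 'I_k})
  (u : nat -> R) (u_pos : forall n, 0 < u n)
  (u_infty : u n @[n --> \oo] --> +oo)
  (t : nat -> 'cV[R]_k)
  (t_pos : \forall n \near \oo, forall i, 0 < t n i 0)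
  (qI : 'I_k -> R) (qJ : 'I_k -> \bar R) :
  let C := invmx A^T in
  let Sigma := A^T *m A in
  let delta := fun n => u n * norm_sub Sigma I a in
  let zeta := fun n => w (delta n) in
  let Xstar := fun o => A^T *m (rad o *: colv (V o)) in
  qp_solution (invmx Sigma) a abar ->
  minimal_index_set Sigma a abar I ->
  (forall i, i \in I ->
     zeta n * (t n - u n *: abar) i 0 @[n --> \oo] --> qI i) ->
  (forall i, i \notin I -> (qJ i < +oo)%E /\
     (Num.sqrt (zeta n / delta n) * (t n - u n *: abar) i 0)%:E
       @[n --> \oo] --> qJ i) ->
  degenerate_set alpha C abar = finset.set0 ->
  (fine (PX [set o | forall i, t n i 0 < colv (X o) i 0]) /
   fine (P [set o | forall i, t n i 0 < Xstar o i 0]))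
    @[n --> \oo] --> tail_constant alpha A a abar I
  /\ 0 < tail_constant alpha A a abar I.
Proof.
destruct k as [|n]; first by [].
move=> C Sigma delta zeta Xstar _ hI tI tJ deg.
have [z [Sz [zI zJ] I0 aabar Q]] := minimal_index_multiplier hA hI.
pose v0 := A *m z.
have abar_pos i : 0 < (A^T *m v0) i 0 by rewrite Sz; exact: lt_le_trans (aabar i).
pose nrm := norm_sub Sigma I a.
have v0v0 : 0 < (v0^T *m v0) 0 0.
  have -> : (v0^T *m v0) 0 0 = \sum_i z i 0 * (A^T *m v0) i 0.
    by rewrite -dotE mulmxA -trmx_mul.
  have [i iI] := I0; rewrite (bigD1 i)//= ltr_pwDl ?mulr_gt0 ?zI// sumr_ge0// => j _.
  have [jI|jI] := boolP (j \in I); last by rewrite zJ ?mul0r.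
  by rewrite ltW// mulr_gt0// zI.
have nrm0 : 0 < nrm by rewrite /nrm /norm_sub Q sqrtr_gt0.
have nrm2 : nrm ^+ 2 = (v0^T *m v0) 0 0.
  by rewrite /nrm /norm_sub Q sqr_sqrtr// ltW.
have Cabar : C *m abar = v0 by rewrite -Sz mulKmx// unitmx_tr.
have tcE := tail_constantE nrm0 deg.
rewrite -/C Cabar -/nrm in tcE.
set vbar := tupv _ in tcE.
have v0_neq0 i : alpha i != 2^-1 -> v0 i 0 != 0.
  move=> ai; apply/eqP => vi; have : i \in degenerate_set alpha C abar.
    by rewrite inE ai Cabar vi eqxx.
  by rewrite deg inE.
have vbar_neq0 i : alpha i != 2^-1 -> tnth vbar i != 0.
  move=> ai; rewrite tnth_mktuple mxE mulf_neq0 ?v0_neq0//.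
  by rewrite invr_neq0// gt_eqF.
have g0 : 0 < angular_density alpha vbar.
  have [d0 [T0 [P0 [D [eps [Ddir _ _ _]]]]]] := U_SD.
  have [G1 G2] := dirichlet_Gamma_gt0 Ddir.
  have [G3 _] := @Gamma_half_dim R n.
  rewrite mulr_gt0//; last first.
    apply: prodr_gt0 => i _; have [->|ai] := eqVneq (alpha i) 2^-1.
      by rewrite divff ?subrr ?powRr0.
    by rewrite powR_gt0// normr_gt0 vbar_neq0.
  exact: (divr_gt0 (mulr_gt0 G1 (Gamma_half_expn_gt0 _)) (mulr_gt0 G3 G2)).
have delta_infty : delta m @[m --> \oo] --> +oo.
  apply/cvgryPge => K; have /cvgryPge/(_ (K / nrm)) := u_infty.
  by apply: filterS => m; rewrite ler_pdivrMr.
have F_nd : {homo F : x y / x <= y}.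
  by move=> x y xy; rewrite -lee_fin -!rad_F; apply: cdf_nondecreasing.
have F_cvg : F r @[r --> +oo] --> (1 : R).
  have := cvg_cdfy1 rad; rewrite (_ : cdf rad = EFin \o F); last first.
    by apply/funext => r; rewrite /= rad_F.
  by move=> /fine_cvgP[].
have uzeta : u m * zeta m @[m --> \oo] --> +oo.
  have H := cvg_comp _ _ delta_infty
    (gumbel_scale_pinfty F_lt1 F_nd F_cvg F_0 w_pos F_gumbel).
  apply/cvgryPge => K; have /cvgryPge/(_ (K * nrm)) := H.
  apply: filterS => m /=; rewrite /zeta /delta -/nrm.
  by rewrite (mulrAC (u m)) ler_pM2r.
split; last by rewrite tcE.
rewrite tcE.
have zeta_pos m : 0 < zeta m by exact: w_pos.
have t_above eta i : 0 < eta ->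
    \forall m \near \oo, t m i 0 <= u m * ((A^T *m v0) i 0 + eta).
  move=> eta0; rewrite Sz; have [iI|iI] := boolP (i \in I).
    have := threshold_bounded zeta_pos uzeta eta0 (tI i iI).
    by apply: filterS => m /andP[].
  have [qoo cvq] := tJ i iI.
  exact: (threshold_above nrm0 u_pos zeta_pos uzeta eta0 qoo cvq).
have t_below eta i : 0 < eta -> i \in I ->
    \forall m \near \oo, u m * ((A^T *m v0) i 0 - eta) <= t m i 0.
  move=> eta0 iI; rewrite Sz.
  have := threshold_bounded zeta_pos uzeta eta0 (tI i iI).
  by apply: filterS => m /andP[].
have := exceedance_ratio_cvg rad_pos rad_F U_SD rad_U V_unif rad_V F_lt1 F_0
  w_pos F_gumbel zI zJ I0 abar_pos nrm0 nrm2 vbar_neq0 g0 u_pos u_infty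
  t_above t_below.
apply: cvg_trans; apply: near_eq_cvg; apply: nearW => m.
congr (fine _ / _).
pose B : set (n.+1.-tuple R) := [set x | forall i, t m i 0 < tnth x i].
have mB : measurable B.
  apply: (@measurable_tuple_forall _ _ (fun i => [set x | t m i 0 < x])) => i.
  by rewrite -set_itvoy; exact: measurable_itv.
have -> : [set o | forall i, t m i 0 < colv (X o) i 0] = X @^-1` B.
  by apply/seteqP; split => o H i; have := H i; rewrite mxE.
rewrite (X_law B mB); congr (P _).
by apply/seteqP; split => o H i; have := H i; rewrite /= tnth_mktuple.
Qed.
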